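(* Let $c\in\mathbb{C}$ and $r\ge 0$, and suppose that the interior of the closed disk $\overline{B}(c,r)=\{c'\in\mathbb{C}: |c'-c|\le r\}$ contains a superattracting parameter $\tilde c$. Then the following four statements are equivalent: (1) $r\le r_{\mathrm{bif}}(c)$; (2) for every $\omega\in\Omega_{c,r}$ the orbit $\{f^{(n)}_{\omega}(0)\}_{n\ge1}$ is bounded (hence $T_{c,r}(0)=0$); (3) the random Julia set $J_\omega$ is connected for every $\omega\in\Omega_{c,r}$; (4) the set $\overline{\bigcup_{g\in G_{c,r}}\{g(0)\}}$ is a planar minimal set of $G_{c,r}$. Also, the following four statements are equivalent: (1') $r> r_{\mathrm{bif}}(c)$; (2') for $\mathbb{P}_{c,r}$-almost every $\omega\in\Omega_{c,r}$, $f^{(n)}_{\omega}(0)\to\infty$ as $n\to\infty$, i.e. $T_{c,r}(0)=1$; (3') the random Julia set $J_\omega$ is totally disconnected for $\mathbb{P}_{c,r}$-almost every $\omega\in\Omega_{c,r}$; (4') the set $\overline{\bigcup_{g\in G_{c,r}}\{g(0)\}}$ is not bounded in $\mathbb{C}$. Furthermore, either the first group (1)–(4) or the second group (1')–(4') holds.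
   Context: Throughout, $f_c(z)=z^2+c$ for $c\in\mathbb{C}$, extended to the Riemann sphere $\widehat{\mathbb{C}}$ by $f_c(\infty)=\infty$. A parameter $\tilde c$ is superattracting if $f_{\tilde c}^{\circ p}(0)=0$ for some $p\in\mathbb{N}$. For $\omega=(c_n)_{n\ge1}\in\mathbb{C}^{\mathbb{N}}$ write $f^{(n)}_\omega=f_{c_n}\circ\cdots\circ f_{c_1}$. The random (non-autonomous) Julia set is $J_\omega=\{z\in\mathbb{C}:\{f^{(n)}_\omega\}_{n\ge1}$ is not normal on any neighborhood of $z\}$. For $r>0$ let $\mu_{c,r}$ be the normalized Lebesgue measure on $\overline{B}(c,r)$, and for $r=0$ the Dirac measure at $c$; $\mathbb{P}_{c,r}$ is the infinite product of $\mu_{c,r}$ on $\Omega_{c,r}=\prod_{n\ge1}\overline{B}(c,r)$ (Borel $\sigma$-algebra), and $T_{c,r}(z)=\mathbb{P}_{c,r}(\{\omega: f^{(n)}_\omega(z)\to\infty\})$. $G_{c,r}$ is the semigroup (under composition) generated by $\{f_{c'}:c'\in\overline{B}(c,r)\}$. For a polynomial semigroup $G$, a minimal set is a minimal element, with respect to inclusion, of the family of non-empty compact subsets $L\subset\widehat{\mathbb{C}}$ with $g(L)\subset L$ for all $g\in G$; it is planar if $\infty\notin L$. The bifurcation radius $r_{\mathrm{bif}}(c)$ is the supremum of those $r\ge0$ for which $G_{c,r}$ has a planar minimal set (equivalently the infimum of those $r\ge0$ for which $G_{c,r}$ has no planar minimal set); by prior work this value is attained, $G_{c,r}$ has a planar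 minimal set iff $r\le r_{\mathrm{bif}}(c)$, and $r_{\mathrm{bif}}(c)>0$ iff $f_c$ is hyperbolic with $c$ in the Mandelbrot set. *)

(* Defs.v *)
(* The complex plane is R[i] (with
   R : realType), equipped with its normed topology (via the alias ^o). *)
From HB Require Import structures.
From mathcomp Require Import all_boot all_order all_algebra.
From mathcomp Require Import all_classical all_reals all_analysis.
From mathcomp Require Import complex.
Import Order.TTheory GRing.Theory Num.Theory.
Import numFieldNormedType.Exports.

Set Implicit Arguments.
Unset Strict Implicit.
Unset Printing Implicit Defensive.

Local Open Scope ring_scope.
Local Open Scope classical_set_scope.

Section Defs.
Variable R : realType.

Definition C : Type := (R[i])^o.

Definition cmod (z : C) : R := Num.sqrt (complex.Re z ^+ 2 + complex.Im z ^+ 2).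

Definition quad (c : C) : C -> C := fun z => z ^+ 2 + c.

Definition cdisk (c : C) (r : R) : set C := [set c' | cmod (c' - c) <= r].

(** f^{(n)}_omega = f_{c_n} o ... o f_{c_1}, with omega = (c_1, c_2, ...)
    represented as w : nat -> C, w 0 = c_1. *)
Fixpoint fiter (w : nat -> C) (n : nat) (z : C) : C :=
  match n with
  | 0 => z
  | n'.+1 => quad (w n') (fiter w n' z)
  end.

Definition superattracting (ct : C) : Prop :=
  exists p : nat, (0 < p)%N /\ iter p (quad ct) 0 = 0.

(** Riemann sphere = one-point compactification of C; None is infinity. *)
Definition Chat : Type := one_point_compactification C.

Definition hatf (g : C -> C) : Chat -> Chat := fun p => omap g p.

Definition chordal (p q : Chat) : R :=
  match p, q with
  | Some z, Some w =>
      2 * cmod (z - w) / (Num.sqrt (1 + cmod z ^+ 2) * Num.sqrt (1 + cmod w ^+ 2))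
  | Some z, None | None, Some z => 2 / Num.sqrt (1 + cmod z ^+ 2)
  | None, None => 0
  end.

Definition loc_unif_conv (U : set C) (h : nat -> C -> C) (g : C -> Chat) : Prop :=
  forall K : set C, compact K -> K `<=` U ->
  forall e : R, 0 < e -> exists N : nat, forall k, (N <= k)%N ->
    forall z, K z -> chordal (Some (h k z)) (g z) < e.

Definition normal_on (Fam : set (C -> C)) (U : set C) : Prop :=
  forall h : nat -> C -> C, (forall k, Fam (h k)) ->
  exists (psi : nat -> nat) (g : C -> Chat),
    (forall k, (psi k < psi k.+1)%N) /\ loc_unif_conv U (h \o psi) g.

Definition julia (w : nat -> C) : set C :=
  [set z | forall U : set C, open U -> U z ->
     ~ normal_on [set F | exists n : nat, F = fiter w n.+1] U].

Inductive in_G (c : C) (r : R) : (C -> C) -> Prop :=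
  | in_G_gen c' : cdisk c r c' -> in_G c r (quad c')
  | in_G_comp g h : in_G c r g -> in_G c r h -> in_G c r (g \o h).

Definition invariant_set (G : set (C -> C)) (L : set Chat) : Prop :=
  forall g, G g -> hatf g @` L `<=` L.

Definition minimal_set (G : set (C -> C)) (L : set Chat) : Prop :=
  [/\ L !=set0, compact L, invariant_set G L &
      forall K : set Chat, K !=set0 -> compact K -> invariant_set G K ->
        K `<=` L -> K = L].

Definition planar (L : set Chat) : Prop := ~ L None.

Definition has_planar_minimal_set (G : set (C -> C)) : Prop :=
  exists L, minimal_set G L /\ planar L.

Definition rbif (c : C) : R :=
  sup [set r : R | 0 <= r /\ has_planar_minimal_set (in_G c r)].

Definition orbit_closure (c : C) (r : R) : set Chat :=
  closure [set p : Chat | exists g, in_G c r g /\ p = Some (g 0)].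

Definition bounded_in_C (A : set Chat) : Prop :=
  exists M : R, forall p, A p -> exists z : C, p = Some z /\ cmod z <= M.

Definition toC (p : R * R) : C := Complex p.1 p.2.

Definition cmeasurable (A : set C) : Prop := measurable (toC @^-1` A).

Definition leb2 (A : set C) : \bar R :=
  ((@lebesgue_measure R) \x (@lebesgue_measure R))%E (toC @^-1` A).

Definition mu (c : C) (r : R) (A : set C) : \bar R :=
  if r == 0 then (if `[< A c >] then 1%E else 0%E)
  else (fine (leb2 (A `&` cdisk c r)) / fine (leb2 (cdisk c r)))%:E.

Definition cyl (n : nat) (A : nat -> set C) : set (nat -> C) :=
  [set w | forall i, (i < n)%N -> A i (w i)].

Definition cylinders : set (set (nat -> C)) :=
  [set X | exists (n : nat) (A : nat -> set C),
      (forall i, cmeasurable (A i)) /\ X = cyl n A].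

Definition Omega : Type := g_sigma_algebraType cylinders.

Definition is_product_measure (c : C) (r : R) (P : probability Omega R) : Prop :=
  forall (n : nat) (A : nat -> set C), (forall i, cmeasurable (A i)) ->
    P (cyl n A : set Omega) = (\prod_(i < n) mu c r (A i))%E.

Definition Omega_cr (c : C) (r : R) : set (nat -> C) :=
  [set w | forall n, cdisk c r (w n)].

Definition bounded_orbit0 (w : nat -> C) : Prop :=
  exists M : R, forall n, cmod (fiter w n.+1 0) <= M.

Definition escapes0 (w : nat -> C) : Prop :=
  forall M : R, exists N : nat, forall n, (N <= n)%N -> M < cmod (fiter w n 0).

End Defs.

(* Main.v *)
(** The key fact is that a compact set [K] of the plane with [z^2 + c'] in [K]
    for all [z] in [K] and all [c'] near a superattracting parameter [ct] must
    contain [0]. By the Earle-Hamilton trick the derivatives of the iterates of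
    [f_ct] decay geometrically along an orbit in [K]; if [K] missed the
    (finite) critical orbit, the inverse branches of these iterates would exist
    on discs of fixed radius in [K] and bound the same derivatives from below.
    Hence, if [G_(c,r)] has a planar invariant compact set, then the critical
    point never escapes, and conversely its orbit closure is then minimal.

    If no critical orbit escapes, the filled Julia set is a nested intersection
    of connected lemniscates, and its boundary [J_w] is connected since the plane
    is unicoherent. If [0] escapes under [w], then [z - w_1] has a continuous
    square root on the filled Julia set of the shifted sequence, which splits
    the symmetric set [J_w] in two.

    If the critical point can escape, then from every point some block of
    parameters of bounded length leads to escape with probability bounded below,
    so the non-escape probability decays geometrically. Summing it, almost
    surely there are [s] and infinitely many times [m] at which all critical
    values of [f^(m)_w] have escaped by time [m + s]. At such times inverse
    branches exist on discs of fixed radius, another Earle-Hamilton argument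
    makes them contract without bound, and a connected subset of the filled
    Julia set, on which [f^(m)_w] is then injective, is covered by boundedly many
    arbitrarily small pieces. *)

(* Inverse branches are only known to be continuous, so no holomorphic function theory is applied to
   them. All estimates concern polynomials: [poly_open], obtained by factoring over the roots, gives
   maximum and minimum principles, and derivative bounds are read off from the difference quotient,
   which is again a polynomial. A dilated chain of inverse branches is likewise handled through the
   polynomial that it inverts. The escape radius has a margin: a point that stays in the disc for
   one more step lies in the disc of radius [rho - 1]. This margin of 1 turns into discs of a radius
   independent of the time, on which branches exist and can be dilated. Good times are singled out
   because critical values may linger near the filled set for long, so a fixed delay [s] cannot be
   expected to serve every time. In the final argument every statement is compared with (2): its
   failure yields both almost sure statements, and each of those excludes (2) through a single
   admissible sequence. *)
Require Import Defs.
From HB Require Import structures.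
From mathcomp Require Import all_boot all_order all_algebra.
From mathcomp Require Import all_classical all_reals all_analysis.
From mathcomp Require Import measurable_realfun complex ring lra.
Import Order.TTheory GRing.Theory Num.Theory.
Import numFieldNormedType.Exports.

Set Implicit Arguments.
Unset Strict Implicit.
Unset Printing Implicit Defensive.

Local Open Scope ring_scope.
Local Open Scope classical_set_scope.

(** * The complex plane *)

Section ComplexPlane.
Variable R : realType.
Implicit Types (x y z w : C R).

Lemma cmodE z : (cmod z)%:C%C = `|(z : R[i])|.
Proof. by rewrite normc_def. Qed.

Lemma cmod_ge0 z : 0 <= cmod z.
Proof. exact: sqrtr_ge0. Qed.

Lemma cmod0 : cmod (0 : C R) = 0.
Proof. by apply: complexI; rewrite cmodE normr0. Qed.

Lemma cmod1 : cmod (1 : C R) = 1.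
Proof. by apply: complexI; rewrite cmodE normr1. Qed.

Lemma cmod0_eq0 z : cmod z = 0 -> z = 0.
Proof.
by move=> z0; apply/eqP; rewrite -[_ == _]normr_eq0 -cmodE z0.
Qed.

Lemma cmod_gt0 z : z != 0 -> 0 < cmod z.
Proof.
move=> z0; rewrite lt_neqAle cmod_ge0 andbT eq_sym.
by apply: contraNneq z0 => /cmod0_eq0 ->.
Qed.

Lemma cmodM z w : cmod (z * w) = cmod z * cmod w.
Proof. by apply: complexI; rewrite rmorphM /= !cmodE normrM. Qed.

Lemma cmodX z n : cmod (z ^+ n) = cmod z ^+ n.
Proof. by apply: complexI; rewrite rmorphXn /= !cmodE normrX. Qed.

Lemma cmodV z : cmod z^-1 = (cmod z)^-1.
Proof. by apply: complexI; rewrite fmorphV /= !cmodE normfV. Qed.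

Lemma cmodN z : cmod (- z) = cmod z.
Proof. by apply: complexI; rewrite !cmodE normrN. Qed.

Lemma cmodB z w : cmod (z - w) = cmod (w - z).
Proof. by rewrite -opprB cmodN. Qed.

Lemma cmodD z w : cmod (z + w) <= cmod z + cmod w.
Proof. by rewrite -lecR rmorphD /= !cmodE; exact: ler_normD. Qed.

Lemma cmod_triangle y x z : cmod (x - z) <= cmod (x - y) + cmod (y - z).
Proof.
have -> : x - z = (x - y) + (y - z) by ring.
exact: cmodD.
Qed.

Lemma cmod_subr z w : cmod z - cmod w <= cmod (z - w).
Proof.
have := cmodD (z - w) w; rewrite subrK; lra.
Qed.

Lemma cmod_addr z w : cmod z - cmod w <= cmod (z + w).
Proof. by have := cmod_subr z (- w); rewrite opprK cmodN. Qed.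

Lemma cmodR (a : R) : cmod (a%:C%C : C R) = `|a|.
Proof. by rewrite /cmod /= expr0n addr0 sqrtr_sqr. Qed.

Lemma cmod_i : cmod ('i%C : C R) = 1.
Proof. by rewrite /cmod /= expr0n add0r expr1n sqrtr1. Qed.

Lemma Re_le_cmod z : `|complex.Re z| <= cmod z.
Proof. by rewrite -sqrtr_sqr ler_wsqrtr// lerDl sqr_ge0. Qed.

Lemma Im_le_cmod z : `|complex.Im z| <= cmod z.
Proof. by rewrite -sqrtr_sqr ler_wsqrtr// lerDr sqr_ge0. Qed.

Lemma cmod_le_ReIm z : cmod z <= `|complex.Re z| + `|complex.Im z|.
Proof.
rewrite {1}(_ : z = ((complex.Re z)%:C%C : C R) + ('i%C : C R) * (complex.Im z)%:C%C);
  last exact: complexE.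
by apply: le_trans (cmodD _ _) _; rewrite cmodM cmod_i mul1r !cmodR.
Qed.

Definition cball z (e : R) : set (C R) := [set w | cmod (w - z) < e].

(** The norm of [R[i]] takes its values in [R[i]], so the radius of a ball is a complex number.
    Positivity forces its imaginary part to vanish, hence real radii suffice. *)
Lemma nbhs_cballP z (A : set (C R)) :
  nbhs z A <-> exists2 e : R, 0 < e & cball z e `<=` A.
Proof.
split=> [/nbhs_ballP[[e e']]|[e e0 eA]].
  rewrite /= ltcE /= => /andP[/eqP -> e0] eA; exists e => // w ew.
  apply: eA; rewrite -ball_normE /=.
  rewrite -[X in X < _]/(`|(z - w : R[i])|) -cmodE -[X in _ < X]/(e%:C%C) ltcR.
  by rewrite cmodB.
apply/nbhs_ballP; exists (e%:C%C); first by rewrite /= ltcR.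
move=> w; rewrite -ball_normE /= => ew; apply: eA.
by rewrite /cball/= cmodB -ltcR cmodE.
Qed.

Lemma nbhs_cball z (e : R) : 0 < e -> nbhs z (cball z e).
Proof. by move=> e0; apply/nbhs_cballP; exists e. Qed.

Lemma open_cballP (A : set (C R)) :
  open A <-> forall z, A z -> exists2 e : R, 0 < e & cball z e `<=` A.
Proof.
by rewrite openE; split=> oA z Az; apply/nbhs_cballP; exact: oA.
Qed.

Lemma closed_cballP (A : set (C R)) : closed A <->
  forall z, (forall e : R, 0 < e -> exists2 w, A w & cmod (w - z) < e) -> A z.
Proof.
split=> [cA z zA|cA z zA].
  apply: cA => B /nbhs_cballP[e e0 eB]; have [w Aw wz] := zA e e0.
  by exists w; split=> //; exact: eB.
apply: cA => e e0; have [w [Aw ew]] := zA _ (nbhs_cball z e0).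
by exists w.
Qed.

Definition cts (T : topologicalType) (f : T -> C R) := forall t (e : R), 0 < e ->
  \forall s \near t, cmod (f s - f t) < e.

Lemma ctsP (T : topologicalType) (f : T -> C R) : cts f <-> continuous f.
Proof.
split=> [cf t A /nbhs_cballP[e e0 eA]|cf t e e0].
  by apply: filterS (cf t e e0) => s; exact: eA.
exact: (cf t _ (nbhs_cball _ e0)).
Qed.

Lemma continuous_cmodP (f : C R -> C R) : continuous f <->
  forall z (e : R), 0 < e ->
    exists2 d : R, 0 < d & forall w, cmod (w - z) < d -> cmod (f w - f z) < e.
Proof.
split=> [/ctsP cf z e e0|cf]; first by have /nbhs_cballP[d d0 h] := cf z e e0; exists d.
by apply/ctsP => z e e0; have [d d0 h] := cf z e e0; apply/nbhs_cballP; exists d.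
Qed.

Lemma continuous_realP (f : C R -> R) :
  (forall z (e : R), 0 < e ->
    exists2 d : R, 0 < d & forall w, cmod (w - z) < d -> `|f w - f z| < e) ->
  continuous f.
Proof.
move=> cf z A /nbhs_ballP[e e0 eA]; have [d d0 h] := cf z e e0.
apply/nbhs_cballP; exists d => // w /h zw; apply: eA.
by rewrite -ball_normE /= distrC.
Qed.

Lemma continuous_cmod : continuous (@cmod R).
Proof.
apply: continuous_realP => z e e0; exists e => // w zw.
rewrite ltr_norml; have := cmod_subr w z; have := cmod_subr z w.
by rewrite (cmodB z w) => *; apply/andP; split; lra.
Qed.

Lemma continuous_toC : continuous (@toC R).
Proof.
apply/ctsP => -[a b] e e0.
have e20 : 0 < e / 2 by lra.
exists ((ball a (e/2), ball b (e/2))).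
  by split; exact: nbhsx_ballx.
move=> [a' b'] [/= aa bb]; move: aa bb; rewrite -!ball_normE /= => aa bb.
apply: le_lt_trans (cmod_le_ReIm _) _ => /=.
by rewrite (distrC a') (distrC b'); lra.
Qed.

Lemma hausdorff_C : hausdorff_space (C R).
Proof. exact: norm_hausdorff. Qed.

Lemma closed_cdisk z (r : R) : closed (cdisk z r).
Proof.
apply/closed_cballP => w wD; rewrite /cdisk/=; apply/ler_addgt0Pr => e e0.
have [w' zw' ww'] := wD e e0; rewrite /cdisk/= in zw'.
have := cmod_triangle w' w z; rewrite (cmodB w w'); lra.
Qed.

(** Heine-Borel, transported from a square in [R * R] along [toC]. *)
Lemma bounded_closed_compact_C (A : set (C R)) (M : R) :
  closed A -> A `<=` [set z | cmod z <= M] -> compact A.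
Proof.
move=> clA bA.
have cB : compact (@toC R @` (`[- M, M]%classic `*` `[- M, M]%classic)).
  apply: continuous_compact.
    exact/continuous_subspaceT/continuous_toC.
  by apply: compact_setX; exact: segment_compact.
apply: subclosed_compact clA cB _ => z Az; exists (complex.Re z, complex.Im z); last by case: z Az.
have zM := bA z Az; rewrite /= in zM; split => /=; rewrite in_itv /= -ler_norml.
  exact: le_trans (Re_le_cmod z) zM.
exact: le_trans (Im_le_cmod z) zM.
Qed.

Lemma compact_cdisk z (r : R) : compact (cdisk z r).
Proof.
apply: (@bounded_closed_compact_C _ (cmod z + r)); first exact: closed_cdisk.
move=> w /= zw; have := cmodD (w - z) z; rewrite subrK /cdisk /= in zw *; lra.
Qed.

Lemma compact_closed_C (A : set (C R)) : compact A -> closed A.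
Proof. by apply: compact_closed; exact: hausdorff_C. Qed.

Lemma compact_bounded_C (A : set (C R)) : compact A ->
  exists M : R, forall z, A z -> cmod z <= M.
Proof.
move=> cA; have [->|A0] := eqVneq A set0; first by exists 0.
have /set0P A0' := A0.
have [z _ zM] := compact_EVT_max A0' cA (continuous_subspaceT continuous_cmod).
by exists (cmod z) => w Aw; apply: zM; rewrite inE.
Qed.

End ComplexPlane.

(** * Polynomial maps: open mapping and Cauchy estimates *)

Section PolynomialMaps.
Variable R : realType.
Implicit Types (x y z w v : C R) (f g : C R -> C R).

Definition polyfun f := exists p : {poly R[i]}, forall z, f z = p.[z].

Lemma polyfun_id : polyfun id.
Proof. by exists 'X => z; rewrite hornerX. Qed.

Lemma polyfun_cst v : polyfun (fun=> v).
Proof. by exists (v : R[i])%:P => z; rewrite hornerC. Qed.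

Lemma polyfunD f g : polyfun f -> polyfun g -> polyfun (fun z => f z + g z).
Proof. by move=> [p pf] [q qg]; exists (p + q) => z; rewrite hornerD pf qg. Qed.

Lemma polyfunM f g : polyfun f -> polyfun g -> polyfun (fun z => f z * g z).
Proof. by move=> [p pf] [q qg]; exists (p * q) => z; rewrite hornerM pf qg. Qed.

Lemma polyfun_comp f g : polyfun f -> polyfun g -> polyfun (f \o g).
Proof.
by move=> [p pf] [q qg]; exists (p \Po q) => z; rewrite horner_comp /= pf qg.
Qed.

Lemma polyfun_quad c : polyfun (quad c).
Proof.
apply: (@polyfunD (fun z => z ^+ 2) (fun=> c)); last exact: polyfun_cst.
by apply: polyfunM; exact: polyfun_id.
Qed.

Lemma polyfun_fiter (u : nat -> C R) n : polyfun (fiter u n).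
Proof.
elim: n => [|n IH]; first exact: polyfun_id.
exact: polyfun_comp (polyfun_quad _) IH.
Qed.

Lemma poly_bounded (p : {poly R[i]}) (M : R) :
  exists2 B : R, 0 < B & forall z : C R, cmod z <= M -> cmod (p.[z] : C R) <= B.
Proof.
elim/poly_ind: p => [|p c [B B0 pB]].
  by exists 1 => // z _; rewrite horner0 cmod0.
exists (B * `|M| + cmod (c : C R) + 1).
  by rewrite ltr_wpDl// addr_ge0 ?mulr_ge0 ?cmod_ge0// ltW.
move=> z zM; rewrite hornerMXaddC.
apply: le_trans (cmodD _ _) _; rewrite cmodM.
have : cmod (p.[z] : C R) * cmod z <= B * `|M|.
  apply: ler_pM; rewrite ?cmod_ge0 ?pB//.
  exact: le_trans zM (ler_norm _).
lra.
Qed.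

Lemma polyfun_quotient f w : polyfun f ->
  exists q : {poly R[i]}, forall z, f z - f w = (z - w) * q.[z].
Proof.
move=> [p pf].
have : root (p - (p.[w])%:P) w.
  by rewrite /root !hornerE subrr.
move=> /factor_theorem[q pq]; exists q => z.
have := congr1 (horner^~ z) pq; rewrite !hornerE /= -!pf => ->.
by rewrite mulrC.
Qed.

Lemma polyfun_continuous f : polyfun f -> continuous f.
Proof.
move=> pf; apply/continuous_cmodP => w e e0.
have [q qf] := polyfun_quotient w pf.
have [B B0 qB] := poly_bounded q (cmod w + 1).
exists (Num.min 1 (e / B)); first by rewrite lt_min ltr01 divr_gt0.
move=> z; rewrite lt_min => /andP[z1 zB].
rewrite qf cmodM; have {}qB : cmod (q.[z] : C R) <= B.
  by apply: qB; have := cmod_subr z w; lra.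
have : cmod (z - w) * cmod (q.[z] : C R) <= cmod (z - w) * B.
  by rewrite ler_wpM2l ?cmod_ge0.
move: zB; rewrite ltr_pdivlMr//; lra.
Qed.

(* If every root of [q - y] were at distance [>= e] from [w], then
   [|q(w) - y|] would be at least [|lead_coef q| * e ^ deg q]. *)
Lemma poly_open (q : {poly R[i]}) w (e : R) : (1 < size q)%N -> 0 < e ->
  exists2 d : R, 0 < d & forall y, cmod (y - q.[w]) < d ->
    exists2 z, cmod (z - w) < e & q.[z] = y.
Proof.
move=> q1 e0; have q0 : q != 0 by rewrite -size_poly_gt0 (ltn_trans _ q1).
have lq : 0 < cmod (lead_coef q : C R) by rewrite cmod_gt0// lead_coef_eq0.
exists (cmod (lead_coef q : C R) * e ^+ (size q).-1).
  by rewrite mulr_gt0// exprn_gt0.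
move=> y yd; apply: contrapT => nz.
have sy : (size (- (y : R[i])%:P) < size q)%N.
  by rewrite size_polyN (leq_ltn_trans (size_polyC_leq1 _)).
have sp : size (q + - (y : R[i])%:P) = size q by rewrite size_polyDl.
have lp : lead_coef (q - (y : R[i])%:P) = lead_coef q by rewrite lead_coefDl.
have [r pr] := closed_field_poly_normal (q - (y : R[i])%:P).
have sr : size r = (size q).-1.
  by rewrite -sp pr size_scale ?lp ?lead_coef_eq0// size_prod_XsubC.
have rE (z : R[i]) : z \in r -> e <= cmod ((w : C R) - z).
  move=> zr; rewrite leNgt; apply/negP => zw; apply: nz; exists z.
    by rewrite cmodB.
  have : root (q - (y : R[i])%:P) z by rewrite pr rootZ ?lp ?lead_coef_eq0// root_prod_XsubC.
  by rewrite /root !hornerE subr_eq0 => /eqP.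
move: yd; apply/negP; rewrite -leNgt.
have -> : cmod (y - q.[w]) = cmod ((q - (y : R[i])%:P).[w] : C R).
  by rewrite !hornerE cmodB.
rewrite pr hornerZ lp cmodM ler_wpM2l ?cmod_ge0// horner_prod -sr.
elim: r rE {pr sr} => [|z r IH] rE; first by rewrite big_nil cmod1.
rewrite big_cons cmodM /= exprS ler_pM ?exprn_ge0 ?(ltW e0)//.
  by rewrite !hornerE rE// mem_head.
by apply: IH => t tr; apply: rE; rewrite inE tr orbT.
Qed.

(** Strict derivative: both points vary near [w]. This is what makes a non-zero derivative yield
    local injectivity with a quantitative bound. *)
Definition sderiv f w (a : C R) := forall e : R, 0 < e ->
  exists2 d : R, 0 < d & forall x y, cmod (x - w) < d -> cmod (y - w) < d ->
    cmod (f x - f y - a * (x - y)) <= e * cmod (x - y).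

Lemma sderiv_id w : sderiv id w 1.
Proof.
move=> e e0; exists 1 => // x y _ _.
by rewrite mul1r subrr cmod0 mulr_ge0 ?cmod_ge0// ltW.
Qed.

Lemma sderiv_affine w (a b : C R) : sderiv (fun z => a * z + b) w a.
Proof.
move=> e e0; exists 1 => // x y _ _.
have -> : a * x + b - (a * y + b) - a * (x - y) = 0 by ring.
by rewrite cmod0 mulr_ge0 ?cmod_ge0// ltW.
Qed.

Lemma sderiv_quad c w : sderiv (quad c) w (w *+ 2).
Proof.
move=> e e0; exists (e / 2) => [|x y xw yw]; first lra.
have -> : quad c x - quad c y - w *+ 2 * (x - y) =
  ((x - w) + (y - w)) * (x - y) by rewrite /quad; ring.
rewrite cmodM ler_wpM2r ?cmod_ge0//.
have := cmodD (x - w) (y - w); lra.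
Qed.

Lemma sderiv_continuous f w a : sderiv f w a -> forall e : R, 0 < e ->
  exists2 d : R, 0 < d & forall x, cmod (x - w) < d -> cmod (f x - f w) < e.
Proof.
move=> fa e e0; have [d d0 fd] := fa 1 ltr01.
have a1 : 0 < cmod a + 1 by have := cmod_ge0 a; lra.
exists (Num.min d (e / (cmod a + 1))); first by rewrite lt_min d0 divr_gt0.
move=> x; rewrite lt_min => /andP[xd xe].
have := fd x w xd; rewrite subrr cmod0 => /(_ d0).
have := cmod_subr (f x - f w) (a * (x - w)); rewrite cmodM.
move: xe; rewrite ltr_pdivlMr//; nra.
Qed.

Lemma sderiv_comp f g w a b : sderiv f w a -> sderiv g (f w) b ->
  sderiv (g \o f) w (b * a).
Proof.
move=> fa gb e e0.
(* [K] is a local Lipschitz constant of [f] (as [e1 <= 1]) and also bounds [cmod b], so each of the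
   two error terms costs at most [K * e1]. *)
pose K := cmod b + cmod a + 1.
have K0 : 0 < K by rewrite /K; have := cmod_ge0 a; have := cmod_ge0 b; lra.
pose e1 := Num.min 1 (e / (2 * K)).
have e10 : 0 < e1 by rewrite lt_min ltr01 divr_gt0// mulr_gt0.
have e11 : e1 <= 1 by rewrite ge_min lexx.
have e1K : 2 * K * e1 <= e.
  rewrite mulrC -ler_pdivlMr ?mulr_gt0// ge_min lexx orbT//.
have [d1 d10 fd] := fa e1 e10.
have [d2 d20 gd] := gb e1 e10.
have [d3 d30 cd] := sderiv_continuous fa d20.
exists (Num.min d1 d3); first by rewrite lt_min d10.
move=> x y; rewrite !lt_min => /andP[x1 x3] /andP[y1 y3].
have h1 := fd x y x1 y1.
have h2 := gd (f x) (f y) (cd _ x3) (cd _ y3).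
have -> : (g \o f) x - (g \o f) y - b * a * (x - y) =
  (g (f x) - g (f y) - b * (f x - f y)) + b * (f x - f y - a * (x - y)).
  by rewrite /=; ring.
apply: le_trans (cmodD _ _) _; rewrite cmodM.
have h3 := cmod_subr (f x - f y) (a * (x - y)); rewrite cmodM in h3.
have xy := cmod_ge0 (x - y); have b0 := cmod_ge0 b; have a0 := cmod_ge0 a.
have h4 : cmod (f x - f y) <= K * cmod (x - y) by rewrite /K; nra.
have h5 : e1 * cmod (f x - f y) <= e1 * (K * cmod (x - y)) by rewrite ler_wpM2l// ltW.
have h6 : cmod b * cmod (f x - f y - a * (x - y)) <= K * (e1 * cmod (x - y)).
  by apply: ler_pM; rewrite ?cmod_ge0// /K; lra.
have : 2 * K * e1 * cmod (x - y) <= e * cmod (x - y) by rewrite ler_wpM2r.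
lra.
Qed.

Lemma sderiv_inj f w a : a != 0 -> sderiv f w a ->
  exists2 d : R, 0 < d & forall x y, cmod (x - w) < d -> cmod (y - w) < d ->
    cmod a / 2 * cmod (x - y) <= cmod (f x - f y).
Proof.
move=> /cmod_gt0 a0 /(_ (cmod a / 2)) []; first lra.
move=> d d0 fd; exists d => // x y xw yw; have := fd x y xw yw.
have := cmod_subr (a * (x - y)) (f x - f y).
rewrite (cmodB (a * _)) cmodM; lra.
Qed.

(* The quotient [(f z - f w) / (z - w)] is a polynomial whose value at [w] is
   the derivative, so derivative bounds reduce to extremum principles. *)
Lemma quotient_at f w a (q : {poly R[i]}) : sderiv f w a ->
  (forall z, f z - f w = (z - w) * q.[z]) -> q.[w] = a.
Proof.
move=> fa qf; apply/eqP; rewrite -subr_eq0; apply/eqP/cmod0_eq0/eqP.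
rewrite eq_le cmod_ge0 andbT; apply/ler_addgt0Pr => e e0; rewrite add0r.
have e20 : 0 < e / 2 by lra.
have [d d0 fd] := fa _ e20.
have cq : continuous (fun z : C R => q.[z] : C R) by apply: polyfun_continuous; exists q.
have /continuous_cmodP/(_ w _ e20)[d' d'0 qd] := cq.
pose m := Num.min d d'; have m0 : 0 < m by rewrite lt_min d0.
pose z : C R := w + (m / 2)%:C%C.
have zw : z - w = (m / 2)%:C%C by rewrite /z addrC addKr.
have zwn : cmod (z - w) = m / 2 by rewrite zw cmodR ger0_norm; lra.
have md : m <= d by rewrite ge_min lexx.
have md' : m <= d' by rewrite ge_min lexx orbT.
have h1 : cmod (q.[z] - q.[w] : C R) < e / 2 by apply: qd; rewrite zwn; lra.
have := fd z w; rewrite subrr cmod0 => /(_ _ d0) h2.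
have {}h2 := h2 ltac:(rewrite zwn; lra).
have := h2; rewrite qf [(z - w) * _]mulrC -mulrBl cmodM ler_pM2r; last by rewrite zwn; lra.
move=> h3; have := cmod_triangle (q.[z] : C R) q.[w] a.
rewrite cmodB in h1 => h4; apply: le_trans h4 _.
by apply: le_trans (lerD (ltW h1) h3) _; lra.
Qed.

(** The difference quotient [q] is bounded by [M / eps] on the circle. An interior maximum of [|q|]
    is impossible, since by [poly_open] the larger value [(1 + t) * q.[w1]] is attained nearby. *)
Lemma cauchy_lipschitz f z0 (eps M : R) : polyfun f -> 0 < eps ->
  (forall w, cmod (w - z0) <= eps -> cmod (f w - f z0) <= M) ->
  forall w, cmod (w - z0) <= eps -> cmod (f w - f z0) <= M / eps * cmod (w - z0).
Proof.
move=> pf eps0 fM; have [q qf] := polyfun_quotient z0 pf.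
pose b : C R := z0 + eps%:C%C.
have bz : cmod (b - z0) = eps by rewrite /b addrC addKr cmodR ger0_norm// ltW.
have M0 : 0 <= M by apply: le_trans (fM b _); rewrite ?cmod_ge0// bz.
have qb w : cmod (w - z0) = eps -> cmod (q.[w] : C R) <= M / eps.
  move=> wz; have := fM w; rewrite wz qf cmodM wz => /(_ (lexx _)).
  by rewrite ler_pdivlMr// mulrC.
have cq : continuous (fun z : C R => cmod (q.[z] : C R)).
  move=> z; apply: (@continuous_comp _ _ _ (fun z : C R => q.[z] : C R)).
    by apply: polyfun_continuous; exists q.
  exact: continuous_cmod.
have D0 : cdisk z0 eps !=set0 by exists z0; rewrite /cdisk/= subrr cmod0 ltW.
have [w1] := compact_EVT_max D0 (@compact_cdisk _ z0 eps) (continuous_subspaceT cq).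
rewrite inE {1}/cdisk/= => w1D w1M.
suff q1 : cmod (q.[w1] : C R) <= M / eps.
  move=> w wD; rewrite qf cmodM mulrC ler_wpM2r ?cmod_ge0//.
  by apply: le_trans q1; apply: w1M; rewrite inE.
move: w1D; rewrite le_eqVlt => /orP[/eqP/qb//|w1D].
have [q1|q1] := leqP (size q) 1.
  by have := qb b bz; rewrite (size1_polyC q1) !hornerC.
have [->|qw0] := eqVneq q.[w1] 0; first by rewrite cmod0 divr_ge0// ltW.
have [d d0 qd] := @poly_open q w1 (eps - cmod (w1 - z0)) q1 ltac:(rewrite subr_gt0//).
have cq0 := cmod_gt0 qw0.
pose t := d / (2 * cmod (q.[w1] : C R)).
have t0 : 0 < t by rewrite divr_gt0// mulr_gt0.
have [z zw qz] := qd ((1 + t)%:C%C * q.[w1]) ltac:(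
  rewrite (_ : _ - _ = (t%:C%C : C R) * q.[w1]);
  [rewrite cmodM cmodR gtr0_norm// /t; rewrite invfM mulrA mulfVK ?gt_eqF//; lra
  | rewrite rmorphD /= rmorph1; ring]).
have : cmod (q.[z] : C R) <= cmod (q.[w1] : C R).
  apply: w1M; rewrite inE /cdisk/=; have := cmod_triangle w1 z z0; lra.
rewrite qz cmodM cmodR gtr0_norm; nra.
Qed.

Lemma cauchy_sderiv f z0 (eps M : R) a : polyfun f -> 0 < eps ->
  (forall w, cmod (w - z0) <= eps -> cmod (f w - f z0) <= M) ->
  sderiv f z0 a -> cmod a <= M / eps.
Proof.
move=> pf eps0 fM fa; have fL := cauchy_lipschitz pf eps0 fM.
apply/ler_addgt0Pr => e e0; have [d d0 fd] := fa e e0.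
pose m := Num.min d eps; have m0 : 0 < m by rewrite lt_min d0.
have md : m <= d by rewrite ge_min lexx.
have me : m <= eps by rewrite ge_min lexx orbT.
pose z : C R := z0 + (m / 2)%:C%C.
have zw : cmod (z - z0) = m / 2 by rewrite /z addrC addKr cmodR gtr0_norm; lra.
have h1 := fL z ltac:(rewrite zw; lra).
have h2 := fd z z0 ltac:(rewrite zw; lra) ltac:(by rewrite subrr cmod0).
have h3 := cmod_subr (a * (z - z0)) (f z - f z0).
rewrite (cmodB (a * _)) cmodM in h3.
rewrite -(@ler_pM2r _ (cmod (z - z0))); last by rewrite zw; lra.
lra.
Qed.

(* The polynomial [q = (f - f (g v)) / (X - g v)] has no zero on the image of
   the inverse branch [g], and the minimum of [|q|] over this image is taken over
   the boundary circle. *)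
Lemma inverse_branch_bound f g v (eps M : R) a :
  polyfun f -> 0 < eps -> 0 < M -> continuous g ->
  (forall z, cmod (z - v) <= eps -> f (g z) = z) ->
  (forall z, cmod (z - v) <= eps -> cmod (g z - g v) <= M) ->
  (forall z, cmod (z - v) <= eps -> exists2 b, b != 0 & sderiv f (g z) b) ->
  sderiv f (g v) a -> eps / M <= cmod a.
Proof.
move=> pf eps0 M0 cg fg gM fb fa.
have fgv : f (g v) = v by apply: fg; rewrite subrr cmod0 ltW.
have [q qf] := polyfun_quotient (g v) pf.
have qa := quotient_at fa qf.
have gq z : cmod (z - v) <= eps -> z - v = (g z - g v) * q.[g z].
  by move=> zv; rewrite -qf fgv fg.
have a0 : a != 0.
  have [b b0 fb'] := fb v ltac:(by rewrite subrr cmod0 ltW).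
  by have := quotient_at fb' qf; rewrite qa => ->.
have q0 z : cmod (z - v) <= eps -> q.[g z] != 0.
  move=> zv; have [->|zv0] := eqVneq z v; first by rewrite qa.
  apply: contraNneq zv0 => qz; rewrite -subr_eq0 gq// qz mulr0 eqxx//.
have qb z : cmod (z - v) = eps -> eps / M <= cmod (q.[g z] : C R).
  move=> zv; have := congr1 (@cmod R) (gq z ltac:(by rewrite zv)).
  rewrite zv cmodM => ->; rewrite ler_pdivrMr// mulrC ler_wpM2l ?cmod_ge0// gM ?zv//.
rewrite -qa.
have cq : continuous (fun z : C R => cmod (q.[g z] : C R)).
  move=> z; apply: (@continuous_comp _ _ _ (fun z : C R => q.[g z] : C R)).
    apply: (@continuous_comp _ _ _ g (fun z : C R => q.[z] : C R)); first exact: cg.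
    by apply: polyfun_continuous; exists q.
  exact: continuous_cmod.
have D0 : cdisk v eps !=set0 by exists v; rewrite /cdisk/= subrr cmod0 ltW.
have [w1] := compact_EVT_min D0 (@compact_cdisk _ v eps) (continuous_subspaceT cq).
rewrite inE {1}/cdisk/= => w1D w1M.
apply: (@le_trans _ _ (cmod (q.[g w1] : C R))); last first.
  by apply: w1M; rewrite inE /cdisk/= subrr cmod0 ltW.
have w1D' := w1D; move: w1D; rewrite le_eqVlt => /orP[/eqP/qb//|w1D].
have [q1|q1] := leqP (size q) 1.
  have bz : cmod ((v + eps%:C%C) - v) = eps by rewrite addrC addKr cmodR ger0_norm// ltW.
  by have := qb _ bz; rewrite (size1_polyC q1) !hornerC.
exfalso.
(* Since [f] is injective near [g w1], a point [z] close to it equals [g (f z)] and so lies in the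
   image of the branch. Choosing [z] with [q.[z] = (1 - t) * q.[g w1]] then undercuts the interior
   minimum. *)
have [b b0 /(sderiv_inj b0)[d1 d10 finj]] := fb w1 w1D'.
pose m := eps - cmod (w1 - v); have m0 : 0 < m by rewrite subr_gt0.
have /continuous_cmodP/(_ w1 _ d10)[d2 d20 gd] := cg.
have m20 : 0 < Num.min m d2 by rewrite lt_min m0.
have /continuous_cmodP/(_ (g w1) _ m20)[d3 d30 fd] := polyfun_continuous pf.
have d130 : 0 < Num.min d1 d3 by rewrite lt_min d10.
have [d d0 qd] := poly_open (g w1) q1 d130.
have cq0 := cmod_gt0 (q0 _ w1D').
pose t := Num.min (1/2) (d / (2 * cmod (q.[g w1] : C R))).
have t0 : 0 < t by rewrite lt_min; apply/andP; split; [lra|rewrite divr_gt0// mulr_gt0].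
have t1 : t <= 1/2 by rewrite ge_min lexx.
have tq : t * cmod (q.[g w1] : C R) < d.
  have : t <= d / (2 * cmod (q.[g w1] : C R)) by rewrite ge_min lexx orbT.
  rewrite ler_pdivlMr ?mulr_gt0//; nra.
have [z zw qz] := qd ((1 - t)%:C%C * q.[g w1]) ltac:(
  rewrite (_ : _ - _ = - ((t%:C%C : C R) * q.[g w1]));
  [by rewrite cmodN cmodM cmodR gtr0_norm
  | rewrite rmorphB /= rmorph1; ring]).
move: zw; rewrite lt_min => /andP[zd1 zd3].
have := fd z zd3; rewrite fg// lt_min => /andP[zm zd2].
have fzD : cmod (f z - v) <= eps by have := cmod_triangle w1 (f z) v; rewrite /m in zm; lra.
have := finj z (g (f z)) zd1 (gd _ zd2); rewrite fg// subrr cmod0.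
have b0' := cmod_gt0 b0; rewrite pmulr_rle0; last lra.
move=> zg0; have zg : z = g (f z).
  apply/eqP; rewrite -subr_eq0; apply/eqP/cmod0_eq0/eqP.
  by rewrite eq_le cmod_ge0 zg0.
have : cmod (q.[g w1] : C R) <= cmod (q.[g (f z)] : C R) by apply: w1M; rewrite inE.
rewrite -zg qz cmodM cmodR ger0_norm; nra.
Qed.

End PolynomialMaps.

(** * Continuous square roots *)

Section Continuity.
Variable R : realType.
Implicit Types (x y z w v : C R) (f g : C R -> C R).

(** Compactness enters in its near-covering form, with the filter [0^'+] of small radii as
    parameter, which merges the local radii into one. *)
Lemma heine_C f (K : set (C R)) (e : R) : continuous f -> compact K -> 0 < e ->
  exists2 d : R, 0 < d &
    forall x y, K x -> cmod (x - y) < d -> cmod (f x - f y) < e.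
Proof.
move=> /continuous_cmodP cf cK e0.
have /compact_near_coveringP := cK.
move=> /(_ R (0^'+)%R (fun d x => forall y, cmod (x - y) < d -> cmod (f x - f y) < e)).
case.
  move=> x Kx; have e20 : 0 < e / 2 by lra.
  have [d d0 fd] := cf x _ e20.
  exists (cball x (d / 2), [set t | t < d / 2]).
    split; first by apply: nbhs_cball; lra.
    by apply: nbhs_right_lt; lra.
  move=> [x' t] [/= x'x td] y yx; rewrite /cball/= in x'x.
  have h1 : cmod (f x' - f x) < e / 2 by apply: fd; lra.
  have h2 : cmod (f y - f x) < e / 2.
    by apply: fd; have := cmod_triangle x' y x; rewrite (cmodB y x'); lra.
  have := cmod_triangle (f x) (f x') (f y); rewrite (cmodB (f x)); lra.
move=> d d0 dK; exists (d / 2) => [|x y Kx xy]; first by rewrite divr_gt0.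
apply: (dK (d / 2)) => //=; last by rewrite divr_gt0.
by rewrite sub0r normrN gtr0_norm ?divr_gt0// gtr_pMr// invf_lt1// ltr1n.
Qed.

Lemma compact_closed_dist (A B : set (C R)) : closed A -> compact B ->
  A `&` B = set0 -> exists2 e : R, 0 < e &
  forall a b, A a -> B b -> e <= cmod (a - b).
Proof.
move=> cA cB AB; have /compact_near_coveringP := cB.
move=> /(_ R (0^'+)%R (fun d b => forall a, A a -> d <= cmod (a - b))).
case.
  move=> x Bx; have nAx : (~` A) x by move=> Ax; have : (A `&` B) x by []; rewrite AB.
  have /open_cballP/(_ x nAx)[d d0 dA] := closed_openC cA.
  exists (cball x (d / 2), [set t | t < d / 2]).
    split; first by apply: nbhs_cball; lra.
    by apply: nbhs_right_lt; lra.
  move=> [x' t] [/= x'x td] a Aa; rewrite /cball/= in x'x.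
  rewrite leNgt; apply/negP => ax; apply: (dA a) => //; rewrite /cball/=.
  by have := cmod_triangle x' a x; lra.
move=> d d0 dK; exists (d / 2) => [|a b Aa Bb]; first by rewrite divr_gt0.
apply: (dK (d / 2)) => //=; last by rewrite divr_gt0.
by rewrite sub0r normrN gtr0_norm ?divr_gt0// gtr_pMr// invf_lt1// ltr1n.
Qed.

Lemma contD f g : continuous f -> continuous g -> continuous (fun z => f z + g z).
Proof. by move=> cf cg z; exact: (@continuousD _ _ _ f g z (cf z) (cg z)). Qed.

Lemma contB f g : continuous f -> continuous g -> continuous (fun z => f z - g z).
Proof. by move=> cf cg z; exact: (@continuousB _ _ _ f g z (cf z) (cg z)). Qed.

Lemma contM f g : continuous f -> continuous g -> continuous (fun z => f z * g z).
Proof. by move=> cf cg z; exact: (@continuousM _ _ f g z (cf z) (cg z)). Qed.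

Lemma contV f : continuous f -> (forall z, f z != 0) ->
  continuous (fun z => (f z)^-1).
Proof. by move=> cf f0 z; exact: (@continuousV _ _ f z (f0 z) (cf z)). Qed.

Lemma cont_cst v : continuous (fun _ : C R => v).
Proof. by move=> z; exact: cst_continuous. Qed.

Lemma cont_comp f g : continuous f -> continuous g -> continuous (fun z => g (f z)).
Proof. by move=> cf cg z; exact: (@continuous_comp _ _ _ f g z (cf z) (cg _)). Qed.

Lemma cont_real_complex (h : C R -> R) : continuous h ->
  continuous (fun z => (h z)%:C%C : C R).
Proof.
move=> ch; apply/continuous_cmodP => z e e0.
have /nbhs_cballP[d d0 hd] := ch z _ (nbhsx_ballx (h z) e e0).
exists d => // w /hd; rewrite -rmorphB /= cmodR -ball_normE /= distrC//.
Qed.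

(** The principal square root on the right half-plane, in coordinates. Its real part is positive
    there, which keeps [psqrt v + psqrt u] away from 0 and gives the Lipschitz bound
    [psqrt_dist]. *)
Definition psqrt (u : C R) : C R :=
  let s := Num.sqrt ((cmod u + complex.Re u) / 2) in
  Complex s (complex.Im u / (2 * s)).

Lemma psqrt_gt0 (u : C R) : 0 < complex.Re u -> 0 < complex.Re (psqrt u).
Proof.
by move=> u0; rewrite /= sqrtr_gt0; have := cmod_ge0 u; lra.
Qed.

Lemma psqrtK (u : C R) : 0 < complex.Re u -> psqrt u ^+ 2 = u.
Proof.
move=> u0; have s0 := psqrt_gt0 u0; rewrite /= in s0.
have nu : cmod u ^+ 2 = complex.Re u ^+ 2 + complex.Im u ^+ 2.
  by rewrite sqr_sqrtr// addr_ge0 ?sqr_ge0.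
have s2 : Num.sqrt ((cmod u + complex.Re u) / 2) ^+ 2 = (cmod u + complex.Re u) / 2.
  by rewrite sqr_sqrtr//; have := cmod_ge0 u; lra.
have n0 : cmod u + complex.Re u != 0 by apply: lt0r_neq0; have := cmod_ge0 u; lra.
have H (a b n s : R) : n ^+ 2 = a ^+ 2 + b ^+ 2 -> s ^+ 2 = (n + a) / 2 ->
    s != 0 -> n + a != 0 -> (Complex s (b / (2 * s)) : C R) ^+ 2 = Complex a b.
  move=> nab ss s00 na; rewrite expr2; congr Complex; last by field.
  have -> : s * s - b / (2 * s) * (b / (2 * s)) = s ^+ 2 - b ^+ 2 / (4 * s ^+ 2) by field.
  rewrite ss; have -> : b ^+ 2 = n ^+ 2 - a ^+ 2 by rewrite nab; ring.
  by field.
rewrite /psqrt (H _ _ _ _ nu s2 (lt0r_neq0 s0) n0).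
by case: u {u0 s0 nu s2 n0}.
Qed.

Lemma psqrt1 : psqrt 1 = 1.
Proof.
rewrite /psqrt cmod1 /=; have -> : (1 + 1) / 2 = 1 :> R by lra.
by rewrite sqrtr1 mul0r.
Qed.

Lemma psqrt_dist (u v : C R) : 0 < complex.Re u -> 0 < complex.Re v ->
  cmod (psqrt v - psqrt u) * complex.Re (psqrt u) <= cmod (v - u).
Proof.
move=> u0 v0; have su := psqrt_gt0 u0; have sv := psqrt_gt0 v0.
have -> : v - u = (psqrt v - psqrt u) * (psqrt v + psqrt u).
  by rewrite -{1}(psqrtK u0) -{1}(psqrtK v0); ring.
rewrite cmodM ler_wpM2l ?cmod_ge0//.
apply: le_trans (Re_le_cmod _); apply: le_trans (ler_norm _).
by move: sv; case: (psqrt u) => a b; case: (psqrt v) => a' b' /=; lra.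
Qed.

Lemma psqrt_near (u : C R) (e : R) : 0 < complex.Re u -> 0 < e ->
  exists2 d : R, 0 < d & forall v, 0 < complex.Re v -> cmod (v - u) < d ->
    cmod (psqrt v - psqrt u) < e.
Proof.
move=> u0 e0; have su := psqrt_gt0 u0.
exists (e * complex.Re (psqrt u)); first by rewrite mulr_gt0.
move=> v v0 vu; rewrite -(ltr_pM2r su).
by apply: le_lt_trans vu; exact: psqrt_dist.
Qed.

Lemma cont_psqrt f : continuous f -> (forall z, 0 < complex.Re (f z)) ->
  continuous (fun z => psqrt (f z)).
Proof.
move=> /continuous_cmodP cf f0; apply/continuous_cmodP => z e e0.
have [d d0 pd] := psqrt_near (f0 z) e0.
have [d' d'0 fd] := cf z d d0.
by exists d' => // w /fd; exact: pd.
Qed.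

Lemma Re_near1 (u : C R) : cmod (u - 1) < 1 -> 0 < complex.Re u.
Proof.
move=> u1; have := le_lt_trans (Re_le_cmod _) u1; case: u {u1} => a b /=.
by rewrite ltr_norml => /andP[]; lra.
Qed.

(** Radial retraction of the plane onto a disc. It lets functions that matter only on the disc be
    continuous on the whole plane. *)
Definition retract v (e : R) z : C R :=
  v + (e / Num.max e (cmod (z - v)))%:C%C * (z - v).

Lemma retract_in v (e : R) z : 0 < e -> cmod (retract v e z - v) <= e.
Proof.
move=> e0; rewrite /retract addrC addKr cmodM cmodR.
have m0 : 0 < Num.max e (cmod (z - v)) by rewrite lt_max e0.
rewrite gtr0_norm ?divr_gt0// mulrAC ler_pdivrMr// ler_pM2l//.
by rewrite le_max lexx orbT.
Qed.

Lemma retract_id v (e : R) z : 0 < e -> cmod (z - v) <= e -> retract v e z = z.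
Proof.
move=> e0 ze; rewrite /retract max_l// divff ?gt_eqF// rmorph1 mul1r.
by rewrite addrC subrK.
Qed.

Lemma retract_out v (e : R) z : 0 < e -> e <= cmod (z - v) ->
  cmod (retract v e z - v) = e.
Proof.
move=> e0 ze; rewrite /retract addrC addKr cmodM cmodR max_r//.
have z0 := lt_le_trans e0 ze.
by rewrite ger0_norm ?divr_ge0 ?cmod_ge0 ?(ltW e0)// mulfVK// gt_eqF.
Qed.

Lemma cont_retract v (e : R) : 0 < e -> continuous (retract v e).
Proof.
move=> e0; apply: contD; first exact: cont_cst.
apply: contM; last by apply: contB; [move=> z; exact: id|exact: cont_cst].
apply: cont_real_complex => z.
have cm : {for z, continuous (fun z : C R => cmod (z - v))}.
  apply: (@continuous_comp _ _ _ (fun z : C R => z - v) (@cmod R)).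
    by apply: contB; [move=> ?; exact: id|exact: cont_cst].
  exact: continuous_cmod.
apply: (@continuousM R (C R) (fun=> e) (fun z => (Num.max e (cmod (z - v)))^-1) z).
  exact: cst_continuous.
apply: (@continuousV R (C R) (fun z => Num.max e (cmod (z - v))) z).
  by rewrite gt_eqF// lt_max e0.
by apply: (@continuous_max R (C R) (fun=> e)) => //; exact: cst_continuous.
Qed.

(* Along the radii, [phi] is multiplied at each of [N] small steps by a factor
   close to 1, whose principal square root is continuous. *)
Lemma sqrt_lift (phi : C R -> C R) v (e : R) s0 : continuous phi -> 0 < e ->
  (forall z, cmod (z - v) <= e -> phi z != 0) -> s0 ^+ 2 = phi v ->
  exists2 s : C R -> C R, continuous s &
    s v = s0 /\ forall z, cmod (z - v) <= e -> s z ^+ 2 = phi z.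
Proof.
move=> cphi e0 phi0 s0E.
have D0 : cdisk v e !=set0 by exists v; rewrite /cdisk/= subrr cmod0 ltW.
have cphi' : continuous (fun z : C R => cmod (phi z)).
  by move=> z; apply: continuous_comp; [exact: cphi|exact: continuous_cmod].
have [w1] := compact_EVT_min D0 (@compact_cdisk _ v e) (continuous_subspaceT cphi').
rewrite inE {1}/cdisk/= => w1D w1M.
(* [m] is the minimum of [|phi|] on the disc. Steps of length below [d] change [phi] by less than
   [m], so successive quotients lie within 1 of 1. *)
have m0 := cmod_gt0 (phi0 _ w1D); set m := cmod _ in m0.
have [d d0 phid] := heine_C cphi (@compact_cdisk _ v e) m0.
have [N N0 eN] : exists2 N : nat, (0 < N)%N & e / N%:R < d.
  exists (Num.truncn (e / d)).+1 => //.
  rewrite ltr_pdivrMr ?ltr0n// mulrC -ltr_pdivrMr//.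
  exact: truncnS_gt.
pose p (k : nat) z : C R := v + (k%:R / N%:R)%:C%C * (retract v e z - v).
have pD k z : (k <= N)%N -> cmod (p k z - v) <= e.
  move=> kN; rewrite /p addrC addKr cmodM cmodR ger0_norm ?divr_ge0//.
  apply: le_trans (retract_in v z e0); rewrite ler_piMl ?cmod_ge0//.
  by rewrite ler_pdivrMr ?ltr0n// mul1r ler_nat.
have pS k z : cmod (p k.+1 z - p k z) < d.
  have -> : p k.+1 z - p k z = (N%:R^-1)%:C%C * (retract v e z - v).
    rewrite /p -natr1 mulrDl mul1r rmorphD /=; ring.
  rewrite cmodM cmodR ger0_norm ?invr_ge0//.
  apply: le_lt_trans eN; rewrite mulrC ler_wpM2r ?invr_ge0//.
  exact: retract_in.
have cp k : continuous (p k).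
  apply: contD; first exact: cont_cst.
  apply: contM; first exact: cont_cst.
  by apply: contB; [exact: cont_retract|exact: cont_cst].
have pv k : p k v = v.
  by rewrite /p retract_id ?subrr ?mulr0 ?addr0// cmod0 ltW.
suff H k : (k <= N)%N -> exists2 s : C R -> C R, continuous s &
    s v = s0 /\ forall z, s z ^+ 2 = phi (p k z).
  have [s cs [sv sp]] := H N (leqnn N); exists s => //; split=> // z zv.
  rewrite sp /p divff ?pnatr_eq0 -?lt0n// rmorph1 mul1r retract_id//.
  by rewrite addrC subrK.
elim: k => [_|k IH kN].
  exists (fun=> s0); first exact: cont_cst.
  by split=> // z; rewrite /p mul0r rmorph0 mul0r addr0.
have [s cs [sv sp]] := IH (ltnW kN).
have phik z : phi (p k z) != 0 by apply: phi0; rewrite pD// ltnW.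
pose u z := phi (p k.+1 z) / phi (p k z).
have cu : continuous u.
  have cpk j : continuous (fun z => phi (p j z)) := cont_comp (cp j) cphi.
  exact: contM (cpk k.+1) (contV (cpk k) phik).
have u0 z : 0 < complex.Re (u z).
  apply: Re_near1.
  have -> : u z - 1 = (phi (p k.+1 z) - phi (p k z)) / phi (p k z).
    by rewrite /u mulrBl divff.
  rewrite cmodM cmodV ltr_pdivrMr ?cmod_gt0// mul1r.
  apply: (@lt_le_trans _ _ m).
    by apply: phid; [rewrite /cdisk/= pD|exact: pS].
  by apply: w1M; rewrite inE /cdisk/= pD// ltnW.
exists (fun z => s z * psqrt (u z)); first exact: contM cs (cont_psqrt cu u0).
split; first by rewrite /u !pv divff ?psqrt1 ?mulr1// phi0// subrr cmod0 ltW.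
move=> z; rewrite exprMn sp psqrtK// /u mulrC mulfVK//.
Qed.

End Continuity.

(** * Plane topology *)

Section PlaneTopology.
Variable R : realType.
Implicit Types (x y z w v : C R) (f g : C R -> C R) (X D : set (C R)).

Lemma cmod_nat n : cmod (n%:R : C R) = n%:R.
Proof. by apply: complexI; rewrite cmodE normr_nat rmorph_nat. Qed.

Definition cont_on D f := forall z, D z -> forall e : R, 0 < e ->
  exists2 d : R, 0 < d &
    forall w, D w -> cmod (w - z) < d -> cmod (f w - f z) < e.

Lemma continuous_cont_on D f : continuous f -> cont_on D f.
Proof.
move=> /continuous_cmodP cf z _ e e0; have [d d0 fd] := cf z e e0.
by exists d => // w _; exact: fd.
Qed.

(** A locally constant part is relatively open and so is its complement. In this form a
    connectedness argument only asks for a radius at each point. *)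
Lemma connected_locally X (B : set (C R)) : connected X -> B `<=` X ->
  B !=set0 ->
  (forall z, X z -> exists2 d : R, 0 < d &
     forall w, X w -> cmod (w - z) < d -> (B w <-> B z)) -> B = X.
Proof.
move=> cX BX B0 lB.
have H (Y : set (C R)) : Y `<=` X ->
    (forall z, X z -> exists2 d : R, 0 < d &
       forall w, X w -> cmod (w - z) < d -> (Y w <-> Y z)) ->
    exists2 V, open V & Y = X `&` V.
  move=> YX lY.
  exists [set w | exists z (d : R), [/\ Y z, cmod (w - z) < d &
      forall w, X w -> cmod (w - z) < d -> Y w]].
    apply/open_cballP => w [z [d [Yz wz zd]]]; exists (d - cmod (w - z)).
      by rewrite subr_gt0.
    move=> t; rewrite /cball/= => tw; exists z, d; split=> //.
    by have := cmod_triangle w t z; lra.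
  apply/seteqP; split=> [z Yz|w [Xw [z [d [Yz wz zd]]]]]; last exact: zd.
  split; first exact: YX.
  have [d d0 zd] := lY z (YX _ Yz); exists z, d; split=> //.
    by rewrite subrr cmod0.
  by move=> w Xw /(zd w Xw)[_]; exact.
have [V oV BV] := H B BX lB.
have [V' oV' BV'] : exists2 V, open V & X `\` B = X `&` V.
  apply: H => [z []//|z Xz]; have [d d0 zd] := lB z Xz; exists d => // w Xw wz.
  have [h1 h2] := zd w Xw wz.
  by split=> -[_ nB]; split=> // Bw; apply: nB; [exact: h2|exact: h1].
apply: cX => //; first by exists V.
exists (~` V'); first exact: open_closedC.
apply/seteqP; split=> [z Bz|z [Xz nV]].
  have Xz := BX z Bz; split=> // V'z.
  by have : (X `&` V') z by []; rewrite -BV' => -[].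
by apply: contrapT => nBz; apply: nV; have : (X `\` B) z by []; rewrite BV' => -[].
Qed.

(** A change of sign between nearby points would be a jump of size [2 * cmod (q z)], while [p] and
    [q] together vary by less than [cmod (q z)]. *)
Lemma connected_sign X p q : connected X -> cont_on X p -> cont_on X q ->
  (forall z, X z -> p z ^+ 2 = q z ^+ 2) -> (forall z, X z -> q z != 0) ->
  (forall z, X z -> p z = q z) \/ (forall z, X z -> p z = - q z).
Proof.
move=> cX cp cq pq q0.
have pm z : X z -> p z = q z \/ p z = - q z.
  by move=> /pq/eqP; rewrite eqf_sqr => /orP[]/eqP; [left|right].
have [[z0 [Xz0 pq0]]|nB] := pselect (exists z, X z /\ p z = q z); last first.
  by right=> z Xz; have [pz|//] := pm z Xz; exfalso; apply: nB; exists z.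
left=> z Xz; suff : [set z | X z /\ p z = q z] = X by move=> /seteqP[_ /(_ z Xz)[]].
apply: connected_locally => //; [by move=> ? []|by exists z0|move=> {Xz}z Xz].
have qz := cmod_gt0 (q0 z Xz); have q20 : 0 < cmod (q z) / 2 by lra.
have [d1 d10 pd] := cp z Xz _ q20; have [d2 d20 qd] := cq z Xz _ q20.
exists (Num.min d1 d2); first by rewrite lt_min d10.
move=> w Xw; rewrite lt_min => /andP[/(pd w Xw) pw /(qd w Xw) qw].
have two : cmod (q z + q z) = 2 * cmod (q z).
  by rewrite -mulr2n -[q z *+ 2]mulr_natl cmodM cmod_nat.
split=> -[_ pqw]; split=> //.
  have [//|pzN] := pm z Xz; exfalso; move: pw; rewrite pqw pzN opprK => pw.
  have := cmod_subr (q z + q z) (q z - q w); rewrite (_ : q z + q z - (q z - q w) = q w + q z); last by ring.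
  by rewrite two (cmodB (q z)); lra.
have [//|pwN] := pm w Xw; exfalso; move: pw; rewrite pqw pwN => pw.
have := cmod_subr (q z + q z) (q z - q w); rewrite (_ : q z + q z - (q z - q w) = q z + q w); last by ring.
move: pw; rewrite -opprD cmodN addrC => pw.
by rewrite two (cmodB (q z)) addrC; lra.
Qed.

End PlaneTopology.

(** * Connected plane sets and square roots off a compact set *)

Section PlaneSets.
Variable R : realType.
Implicit Types (x y z w v : C R) (f g : C R -> C R) (X D : set (C R)).

Definition seg v z (t : R) : C R := v + t%:C%C * (z - v).

Lemma seg0 v z : seg v z 0 = v.
Proof. by rewrite /seg rmorph0 mul0r addr0. Qed.

Lemma seg1 v z : seg v z 1 = z.
Proof. by rewrite /seg rmorph1 mul1r addrC subrK. Qed.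

Lemma seg_dist v z (s t : R) : cmod (seg v z s - seg v z t) = `|s - t| * cmod (z - v).
Proof.
have -> : seg v z s - seg v z t = (s - t)%:C%C * (z - v) by rewrite /seg rmorphB /=; ring.
by rewrite cmodM cmodR.
Qed.

Lemma cont_seg v z : continuous (seg v z).
Proof.
apply/ctsP => t e e0; have k0 : 0 < cmod (z - v) + 1 by have := cmod_ge0 (z - v); lra.
apply/nbhs_ballP; exists (e / (cmod (z - v) + 1)); first by rewrite /= divr_gt0.
move=> s; rewrite -ball_normE /= ltr_pdivlMr// distrC seg_dist.
by have := normr_ge0 (s - t); nra.
Qed.

Lemma star_connected X v : X v ->
  (forall z (t : R), X z -> 0 <= t <= 1 -> X (seg v z t)) -> connected X.
Proof.
move=> Xv sX.
have -> : X = \bigcup_(z in X) (seg v z @` `[0, 1]%classic).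
  apply/seteqP; split=> [z Xz|_ [z Xz [t + <-]]].
    by exists z => //; exists 1; [rewrite /= in_itv /= lexx ler01|exact: seg1].
  by rewrite /= in_itv /= => t01; exact: sX.
apply: bigcup_connected.
  exists v => z Xz; exists 0; last exact: seg0.
  by rewrite /= in_itv /= lexx ler01.
move=> z Xz; apply: connected_continuous_connected.
  exact: segment_connected.
exact/continuous_subspaceT/cont_seg.
Qed.

Lemma cdisk_connected v (r : R) : 0 <= r -> connected (cdisk v r).
Proof.
move=> r0; apply: (@star_connected _ v); first by rewrite /cdisk/= subrr cmod0.
move=> z t; rewrite /cdisk/= => zr /andP[t0 t1].
rewrite /seg addrC addKr cmodM cmodR ger0_norm//.
by apply: le_trans zr; rewrite ler_piMl// cmod_ge0.
Qed.

Let halfplane (l : C R -> R) (r : R) : set (C R) := [set z | r < l z].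

Let halfplane_connected (l : C R -> R) (r : R) p :
  (forall v z t, l (seg v z t) = l v + t * (l z - l v)) -> r < l p ->
  connected (halfplane l r).
Proof.
move=> ls rp; apply: (@star_connected _ p) => // z t; rewrite /halfplane/= ls.
move=> rz /andP[t0 t1].
have h : 0 <= (1 - t) * (l p - r) by rewrite mulr_ge0// subr_ge0// ltW.
move: t0; rewrite le_eqVlt => /orP[/eqP <-|t0]; first by rewrite mul0r addr0.
have : 0 < t * (l z - r) by rewrite mulr_gt0// subr_gt0.
lra.
Qed.

(** The four half-planes outside the square of half-side [r] overlap at its corners; every point of
    the exterior reaches their union [Q] along its ray. *)
Lemma exterior_connected (r : R) : 0 <= r -> connected [set z : C R | r < cmod z].
Proof.
move=> r0.
pose q (a b : R) : C R := Complex a b.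
have ReS v z t : complex.Re (seg v z t) = complex.Re v + t * (complex.Re z - complex.Re v).
  by case: v => a b; case: z => a' b' /=; ring.
have ImS v z t : complex.Im (seg v z t) = complex.Im v + t * (complex.Im z - complex.Im v).
  by case: v => a b; case: z => a' b' /=; ring.
pose m := r + 1.
have c1 : connected (halfplane (@complex.Re R) r).
  by apply: (@halfplane_connected _ _ (q m 0)) => //=; rewrite /m; lra.
have c2 : connected (halfplane (@complex.Im R) r).
  by apply: (@halfplane_connected _ _ (q 0 m)) => //=; rewrite /m; lra.
have c3 : connected (halfplane (fun z => - complex.Re z) r).
  apply: (@halfplane_connected _ _ (q (- m) 0)); last by rewrite /= /m; lra.
  by move=> v z t; rewrite ReS; ring.
have c4 : connected (halfplane (fun z => - complex.Im z) r).
  apply: (@halfplane_connected _ _ (q 0 (- m))); last by rewrite /= /m; lra.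
  by move=> v z t; rewrite ImS; ring.
pose Q := halfplane (@complex.Re R) r `|` halfplane (@complex.Im R) r `|`
  halfplane (fun z => - complex.Re z) r `|` halfplane (fun z => - complex.Im z) r.
have cQ : connected Q.
  apply: connectedU => //.
    by exists (q m (- m)); split; [left; left|]; rewrite /halfplane/= /m; lra.
  apply: connectedU => //.
    by exists (q (- m) m); split; [right|]; rewrite /halfplane/= /m; lra.
  apply: connectedU => //.
  by exists (q m m); split; rewrite /halfplane/= /m; lra.
pose ray z := [set w : C R | exists2 t : R, 1 <= t & w = t%:C%C * z].
have -> : [set z : C R | r < cmod z] = \bigcup_(z in [set z : C R | r < cmod z]) (ray z `|` Q).
  apply/seteqP; split=> [z rz|w [z /= rz [[t t1 ->]|]]].
    by exists z => //; left; exists 1 => //; rewrite rmorph1 mul1r.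
    by rewrite cmodM cmodR ger0_norm; nra.
  rewrite /Q /halfplane /=.
  have h1 := Re_le_cmod w; have h2 := Im_le_cmod w.
  have := ler_norm (complex.Re w); have := ler_norm (complex.Im w).
  have := ler_norm (- complex.Re w); have := ler_norm (- complex.Im w).
  rewrite !normrN => h3 h4 h5 h6.
  by case=> [[[|]|]|] ?; lra.
apply: bigcup_connected.
  by exists (q m m) => z _; right; left; left; left; rewrite /halfplane/= /m; lra.
move=> z /= rz; apply: connectedU => //; last first.
  apply: (@star_connected _ z); first by exists 1 => //; rewrite rmorph1 mul1r.
  move=> _ t [s s1 ->] /andP[t0 t1]; exists (1 + t * (s - 1)); first nra.
  by rewrite /seg rmorphD rmorphM rmorphB /= rmorph1; ring.
(* Scaled to modulus above [2 * m], the point has a coordinate of absolute value above [r] and so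
   lies in [Q]. *)
pose k := 2 * m / cmod z + 1.
have z0 : 0 < cmod z by lra.
have k1 : 1 <= k by rewrite /k lerDr divr_ge0 ?cmod_ge0// /m; lra.
have kz : 2 * m < k * cmod z by rewrite /k [(_ + 1) * _]mulrDl mulfVK ?gt_eqF//; lra.
exists (k%:C%C * z); split; first by exists k.
have := cmod_le_ReIm (k%:C%C * z); rewrite cmodM cmodR ger0_norm; last by lra.
rewrite /Q /halfplane /=; set a := complex.Re _; set b := complex.Im _ => ab.
have [ma|ma] := ltP r `|a|.
  by move: ma; rewrite ltr_normr => /orP[] ?; [left; left; left|left; right].
have mb : r < `|b| by rewrite /m in kz; lra.
by move: mb; rewrite ltr_normr => /orP[] ?; [left; left; right|right].
Qed.

(* A square root of [z - a] is transported to nearby poles [a'] by the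
   principal square root of [(z - a') / (z - a)]. *)
Lemma sqrt_off_compact D a : compact D -> connected (~` D) -> ~ D a ->
  exists2 s : C R -> C R, cont_on D s & forall z, D z -> s z ^+ 2 = z - a.
Proof.
move=> cD cnD nDa.
pose S a := exists2 s : C R -> C R, cont_on D s & forall z, D z -> s z ^+ 2 = z - a.
have trans a1 a2 : ~ D a1 -> (forall z, D z -> cmod (a1 - a2) < cmod (z - a1)) ->
    S a1 -> S a2.
  move=> nDa1 a12 [s cs ss].
  have za z : D z -> z - a1 != 0.
    by move=> Dz; rewrite subr_eq0; apply: contra_notN nDa1 => /eqP <-.
  pose u z := (z - a2) / (z - a1).
  have uE z : D z -> u z - 1 = (a1 - a2) / (z - a1).
    by move=> /za h; rewrite /u; field.
  have u0 z : D z -> 0 < complex.Re (u z).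
    move=> Dz; apply: Re_near1; rewrite uE// cmodM cmodV.
    by rewrite ltr_pdivrMr ?cmod_gt0 ?za// mul1r a12.
  exists (fun z => s z * psqrt (u z)); last first.
    move=> z Dz; rewrite exprMn ss// psqrtK ?u0// /u mulrC mulfVK// za//.
  move=> z Dz e e0.
  have [dp dp0 pd] := psqrt_near (u0 z Dz) ltr01.
  pose k := cmod (s z) + cmod (psqrt (u z)) + 1 + 1.
  have k0 : 0 < k by rewrite /k; have := cmod_ge0 (s z); have := cmod_ge0 (psqrt (u z)); lra.
  have ek : 0 < e / k by rewrite divr_gt0.
  have [d1 d10 sd] := cs z Dz _ ek.
  have [d2 d20 pd2] := psqrt_near (u0 z Dz) ek.
  have zap := cmod_gt0 (za z Dz).
  pose A := cmod (a1 - a2).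
  have A0 : 0 <= A := cmod_ge0 _.
  have [d3 d30 ud] : exists2 d3 : R, 0 < d3 & forall w, D w -> cmod (w - z) < d3 ->
      cmod (u w - u z) < Num.min d2 dp.
    have m0 : 0 < Num.min d2 dp by rewrite lt_min d20.
    (* The first bound keeps [w] at distance at least [cmod (z - a1) / 2] from [a1]; the second
       makes the numerator of [u w - u z] small enough. *)
    pose m := Num.min (cmod (z - a1) / 2) (Num.min d2 dp * cmod (z - a1) ^+ 2 / (2 * (A + 1))).
    exists m.
      rewrite lt_min; apply/andP; split; first lra.
      by rewrite divr_gt0// mulr_gt0 ?exprn_gt0//; lra.
    move=> w Dw; rewrite lt_min => /andP[wz1 wz2].
    have -> : u w - u z = (a1 - a2) * (z - w) / ((w - a1) * (z - a1)).
      by have := za w Dw; have := za z Dz => *; rewrite /u; field; apply/andP.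
    rewrite !cmodM cmodV cmodM -/A ltr_pdivrMr; last by rewrite mulr_gt0 ?cmod_gt0 ?za.
    have wa : cmod (z - a1) / 2 <= cmod (w - a1).
      by have := cmod_triangle w z a1; rewrite (cmodB z w); lra.
    move: wz2; rewrite ltr_pdivlMr; last by lra.
    rewrite (cmodB z w) => wz2.
    have : Num.min d2 dp * (cmod (z - a1) / 2 * cmod (z - a1)) <=
           Num.min d2 dp * (cmod (w - a1) * cmod (z - a1)).
      by rewrite ler_wpM2l ?(ltW m0)// ler_wpM2r// ltW.
    have := cmod_ge0 (w - z); nra.
  exists (Num.min d1 d3); first by rewrite lt_min d10.
  move=> w Dw; rewrite lt_min => /andP[/(sd w Dw) w1 /(ud w Dw)].
  rewrite lt_min => /andP[/(pd2 _ (u0 w Dw)) w2 /(pd _ (u0 w Dw)) w3].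
  have -> : s w * psqrt (u w) - s z * psqrt (u z) =
    (s w - s z) * psqrt (u w) + s z * (psqrt (u w) - psqrt (u z)) by ring.
  apply: le_lt_trans (cmodD _ _) _; rewrite !cmodM.
  have h1 : cmod (psqrt (u w)) <= cmod (psqrt (u z)) + 1.
    by have := cmod_subr (psqrt (u w)) (psqrt (u z)); lra.
  have h2 : cmod (s w - s z) * cmod (psqrt (u w)) <= e / k * (cmod (psqrt (u z)) + 1).
    by apply: ler_pM; rewrite ?cmod_ge0// ltW.
  have h3 : cmod (s z) * cmod (psqrt (u w) - psqrt (u z)) <= cmod (s z) * (e / k).
    by rewrite ler_wpM2l ?cmod_ge0// ltW.
  have : e / k * k = e by rewrite mulfVK// gt_eqF.
  by rewrite {2}/k; lra.
(* The poles that admit a root form a locally constant part of the connected complement. It is not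
   empty: for a pole [b] of modulus larger than all of [D], [1 - z / b] stays in the right
   half-plane. *)
suff : [set a | ~ D a /\ S a] = ~` D by move=> /seteqP[_ /(_ a nDa)[]].
apply: connected_locally => //; first by move=> ? [].
  have [M DM] := compact_bounded_C cD.
  have [b cb] : exists b : C R, cmod b = `|M| + 1.
    by exists (`|M| + 1)%:C%C; rewrite cmodR ger0_norm// addr_ge0.
  have DbM z : D z -> cmod z < cmod b.
    by move=> /DM zM; have := ler_norm M; rewrite cb; lra.
  exists b; split; first by move=> /DbM; rewrite ltxx.
  have b0 : b != 0.
    apply/eqP => b0; have := normr_ge0 M; move: cb; rewrite b0 cmod0; lra.
  have [sb sbE] : exists sb : C R, sb ^+ 2 = - b.
    by exists (sqrtc (- b : R[i])); rewrite sqr_sqrtc.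
  have u0 z : D z -> 0 < complex.Re (1 - z / b).
    move=> Dz; apply: Re_near1; rewrite addrC addrA addNr sub0r cmodN cmodM cmodV.
    by rewrite ltr_pdivrMr ?cmod_gt0// mul1r DbM.
  exists (fun z => sb * psqrt (1 - z / b)); last first.
    by move=> z Dz; rewrite exprMn sbE psqrtK ?u0//; field.
  move=> z Dz e e0.
  have e1 : 0 < e / (cmod sb + 1) by rewrite divr_gt0//; have := cmod_ge0 sb; lra.
  have [d d0 pd] := psqrt_near (u0 z Dz) e1.
  exists (d * cmod b); first by rewrite mulr_gt0// cmod_gt0.
  move=> w Dw wz.
  have /(pd _ (u0 w Dw)) : cmod (1 - w / b - (1 - z / b)) < d.
    have -> : 1 - w / b - (1 - z / b) = (z - w) / b by field.
    by rewrite cmodM cmodV ltr_pdivrMr ?cmod_gt0// cmodB.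
  rewrite -mulrBr cmodM ltr_pdivlMr; last by have := cmod_ge0 sb; lra.
  by have := cmod_ge0 (psqrt (1 - w / b) - psqrt (1 - z / b)); nra.
move=> b nDb.
have /open_cballP/(_ b nDb)[d d0 dD] := closed_openC (compact_closed_C cD).
have dD' z : D z -> d <= cmod (z - b).
  by move=> Dz; rewrite leNgt; apply/negP => zb; exact: (dD z zb).
exists (d / 2) => [|b' nDb' bb]; first lra.
split=> -[_ Sb]; split=> //.
  apply: trans Sb => // z Dz; have := dD' z Dz; have := cmod_triangle b' z b; lra.
by apply: trans Sb => // z Dz; have := dD' z Dz; rewrite (cmodB b); lra.
Qed.

End PlaneSets.

(** * Unicoherence of the plane *)

Section Unicoherence.
Variable R : realType.
Implicit Types (x y z w v : C R) (f g : C R -> C R) (X D : set (C R)).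

Lemma urysohn_C (A B : set (C R)) : closed A -> compact B -> A `&` B = set0 ->
  exists u : C R -> R, [/\ continuous u, (forall z, 0 <= u z <= 1),
    (forall z, A z -> u z = 0) & (forall z, B z -> u z = 1)].
Proof.
move=> cA cB AB; have [e e0 eAB] := compact_closed_dist cA cB AB.
have us : uniform_separator A B.
  apply: uniform_separatorW; exists [set xy : C R * C R | ball xy.1 (e%:C%C : R[i]) xy.2].
    by rewrite -entourage_from_ballE; exists (e%:C%C) => //=; rewrite ltcR.
  apply/seteqP; split=> // -[a b] [[/= Aa Bb]]; rewrite -ball_normE /=.
  rewrite -[X in X < _]/(`|(a - b : R[i])|) -cmodE -[X in _ < X]/(e%:C%C) ltcR.
  by rewrite ltNge eAB.
exists (@Urysohn (C R) R A B); split.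
- exact: Urysohn_continuous.
- by move=> z; have := @Urysohn_range _ R A B _ (imageT _ z); rewrite /= in_itv.
- by move=> z Az; exact: (Urysohn_sub0 us (imageP _ Az)).
- by move=> z Bz; exact: (Urysohn_sub1 us (imageP _ Bz)).
Qed.

Lemma continuous_pasting (K E : set (C R)) f g : closed K -> closed E ->
  K `|` E = setT -> continuous f -> continuous g ->
  (forall z, K z -> E z -> f z = g z) ->
  continuous (fun z => if `[< K z >] then f z else g z).
Proof.
move=> cK cE KE /continuous_cmodP cf /continuous_cmodP cg fg.
apply/continuous_cmodP => z e e0.
have [d1 d10 fd] := cf z e e0; have [d2 d20 gd] := cg z e e0.
pose h w := if `[< K w >] then f w else g w; rewrite -/(h _).
have hK w : K w -> h w = f w by rewrite /h; case: asboolP.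
have hE w : E w -> h w = g w by move=> Ew; rewrite /h; case: asboolP => // Kw; exact: fg.
have KEw w : K w \/ E w by have : (K `|` E) w by rewrite KE.
have [Kz|nKz] := pselect (K z); last first.
  have /open_cballP/(_ z nKz)[d d0 dK] := closed_openC cK.
  have Ez : E z by have [] := KEw z.
  exists (Num.min d d2) => [|w]; first by rewrite lt_min d0.
  rewrite lt_min => /andP[/dK nKw /gd].
  by rewrite -/(h w) !hE//; have [] := KEw w.
have [Ez|nEz] := pselect (E z); last first.
  have /open_cballP/(_ z nEz)[d d0 dE] := closed_openC cE.
  exists (Num.min d d1) => [|w]; first by rewrite lt_min d0.
  rewrite lt_min => /andP[/dE nEw /fd].
  by rewrite -/(h w) !hK//; have [] := KEw w.
exists (Num.min d1 d2) => [|w]; first by rewrite lt_min d10.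
rewrite lt_min -/(h w) => /andP[/fd fw /gd gw].
have [Kw|Ew] := KEw w; first by rewrite !hK.
by rewrite !hE.
Qed.

(* A separation of [K `&` E] would give a nonvanishing function equal to
   [((1 - u) + iu)^2] on [K] and to [((1 - u) - iu)^2] on [E]; the signs of its
   continuous square root on [K] and on [E] cannot match at both parts. *)
Lemma unicoherent_C (K E : set (C R)) (M : R) : closed K -> closed E ->
  connected K -> connected E -> K `|` E = setT -> K `<=` cdisk 0 M ->
  connected (K `&` E).
Proof.
move=> cK cE cnK cnE KE KM B [b Bb] [V oV BV] [V' cV' BV'].
apply: contrapT => BJ.
have [a [[Ka Ea] nBa]] : exists a, (K `&` E) a /\ ~ B a.
  apply: contrapT => na; apply: BJ; apply/seteqP; split=> [z|z Jz]; first by rewrite BV => -[].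
  by apply: contrapT => nBz; apply: na; exists z.
have [Kb Eb] : (K `&` E) b by move: Bb; rewrite BV => -[].
pose A := (K `&` E) `&` ~` V.
have cA : closed A by apply: closedI; [exact: closedI|exact: open_closedC].
have cB : compact B.
  apply: (@bounded_closed_compact_C _ _ M).
    by rewrite BV'; apply: closedI => //; exact: closedI.
  by move=> z; rewrite BV => -[[/KM]]; rewrite /cdisk/= subr0.
pose N := `|M| + 1.
have N0 : 0 < N by rewrite /N ltr_wpDl.
have MN : M < N by rewrite /N; have := ler_norm M; lra.
(* Making [u] vanish on [far] too gives [phi = 1] off a disc, so a square root found on the disc
   extends to the plane through the radial retraction. *)
pose far := [set z : C R | N <= cmod z].
have cfar : closed far.
  apply/closed_cballP => z zf; rewrite /far /=; apply/ler_addgt0Pr => e e0.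
  have [w] := zf e e0; rewrite /far/= => Nw wz.
  by have := cmod_subr w z; lra.
have AB : (A `|` far) `&` B = set0.
  apply/seteqP; split=> // z [[[_ nV]|fz]] Bz; move: (Bz); rewrite BV => -[[Kz _] Vz] //.
  by have := KM _ Kz; rewrite /cdisk /= subr0; move: fz; rewrite /far /=; lra.
have [u [cu u01 uA uB]] := urysohn_C (closedU cA cfar) cB AB.
pose tK z : C R := (1 - u z)%:C%C + 'i%C * (u z)%:C%C.
pose tE z : C R := (1 - u z)%:C%C - 'i%C * (u z)%:C%C.
have cuc : continuous (fun z => (u z)%:C%C : C R) := cont_real_complex cu.
have ci : continuous (fun _ : C R => 'i%C : C R) by exact: cont_cst.
have cui : continuous (fun z => ('i%C : C R) * ((u z)%:C%C : C R)).
  exact: contM ci cuc.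
have cu1 : continuous (fun z => (1 - u z)%:C%C : C R).
  have -> : (fun z => (1 - u z)%:C%C : C R) = (fun z => 1 - (u z)%:C%C).
    by apply/funext => z; rewrite rmorphB rmorph1.
  have c1 : continuous (fun _ : C R => 1 : C R) by exact: cont_cst.
  exact: contB c1 cuc.
have ctK : continuous tK := contD cu1 cui.
have ctE : continuous tE := contB cu1 cui.
have tK0 z : tK z != 0.
  rewrite /tK eq_complex /= !mul0r !mul1r !subr0 ?addr0 ?add0r; apply/negP => /andP[/eqP h /eqP h'].
  by move: h h'; lra.
have tE0 z : tE z != 0.
  rewrite /tE eq_complex /= !mul0r !mul1r ?subr0 ?addr0 ?add0r; apply/negP => /andP[/eqP h /eqP h'].
  by move: h h'; lra.
have i2 : ('i%C : C R) ^+ 2 = -1 by exact: sqr_i.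
pose phi z := if `[< K z >] then tK z ^+ 2 else tE z ^+ 2.
have ttJ z : K z -> E z -> tK z ^+ 2 = tE z ^+ 2.
  move=> Kz Ez; have [Bz|nBz] := pselect (B z).
    rewrite /tK /tE uB// subrr rmorph0 rmorph1 add0r mulr1 sub0r sqrrN//.
  rewrite /tK /tE uA ?rmorph0 ?mulr0 ?addr0 ?subr0//; left; split=> // Vz.
  by apply: nBz; rewrite BV.
have cphi : continuous phi.
  apply: (continuous_pasting cK cE KE _ _ ttJ).
    exact: (contM ctK ctK).
  exact: (contM ctE ctE).
have phi0 z : phi z != 0 by rewrite /phi; case: asboolP => _; rewrite expf_neq0.
have phifar z : N <= cmod z -> phi z = 1.
  move=> Nz; have uz : u z = 0 by apply: uA; right.
  rewrite /phi /tK /tE uz subr0 rmorph1 rmorph0 mulr0 addr0 subr0 expr1n.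
  by case: asboolP.
have [s0 s0E] : exists s0 : C R, s0 ^+ 2 = phi 0.
  by exists (sqrtc (phi 0 : R[i])); rewrite sqr_sqrtc.
have [s cs [_ sphi]] := sqrt_lift cphi N0 (fun z _ => phi0 z) s0E.
pose t z := s (retract 0 N z).
have cr : continuous (retract 0 N : C R -> C R) by exact: cont_retract.
have ct : continuous t := cont_comp cr cs.
have tphi z : t z ^+ 2 = phi z.
  rewrite /t sphi ?retract_in//.
  have [zN|Nz] := leP (cmod z) N; first by rewrite retract_id// subr0.
  rewrite !phifar ?(ltW Nz)//.
  by have := @retract_out _ 0 N z N0; rewrite !subr0 => ->//; exact: ltW.
have tK2 z : K z -> t z ^+ 2 = tK z ^+ 2 by rewrite tphi /phi; case: asboolP.
have tE2 z : E z -> t z ^+ 2 = tE z ^+ 2.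
  by move=> Ez; rewrite tphi /phi; case: asboolP => // Kz; exact: ttJ.
have uAa : u a = 0.
  by apply: uA; left; split=> // Va; apply: nBa; rewrite BV.
have uBb : u b = 1 by exact: uB.
have tKa : tK a = 1 by rewrite /tK uAa subr0 rmorph1 rmorph0 mulr0 addr0.
have tEa : tE a = 1 by rewrite /tE uAa subr0 rmorph1 rmorph0 mulr0 subr0.
have tKb : tK b = 'i%C by rewrite /tK uBb subrr rmorph1 rmorph0 mulr1 add0r.
have tEb : tE b = - 'i%C by rewrite /tE uBb subrr rmorph1 rmorph0 mulr1 sub0r.
have ne (x : C R) : x != 0 -> x = - x -> False.
  move=> x0 /eqP; rewrite -subr_eq0 opprK -mulr2n mulrn_eq0 (negbTE x0)//.
have i0 : ('i%C : C R) != 0 by rewrite eq_complex /= oner_eq0 andbF.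
(* At [a] both [tK] and [tE] are 1, at [b] they are [i] and [-i]. Equal choices of sign on [K] and
   [E] conflict at [b], opposite ones at [a]. *)
have [h1|h1] := connected_sign cnK (continuous_cont_on ct) (continuous_cont_on ctK) tK2 (fun z _ => tK0 z);
have [h2|h2] := connected_sign cnE (continuous_cont_on ct) (continuous_cont_on ctE) tE2 (fun z _ => tE0 z).
- by apply: (ne _ i0); rewrite -{1}tKb -h1// h2// tEb.
- by apply: (ne 1 (oner_neq0 _)); rewrite -{1}tKa -h1// h2// tEa.
- by apply: (ne 1 (oner_neq0 _)); rewrite -{1}tEa -h2// h1// tKa.
- by apply: (ne _ i0); rewrite -{2}tKb -h1// h2// tEb opprK.
Qed.

End Unicoherence.

(** * Non-autonomous quadratic iteration *)

Section Dynamics.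
Variable R : realType.
Implicit Types (x y z w v : C R) (f g : C R -> C R) (u : nat -> C R).

Definition sshift (m : nat) u : nat -> C R := fun k => u (m + k)%N.

Lemma sshift_sshift m n u : sshift n (sshift m u) = sshift (m + n) u.
Proof. by apply/funext => k; rewrite /sshift addnA. Qed.

Lemma sshift0 u : sshift 0 u = u.
Proof. by []. Qed.

Lemma fiterD u m n z : fiter u (m + n) z = fiter (sshift m u) n (fiter u m z).
Proof. by elim: n => [|n IH]; [rewrite addn0|rewrite addnS /= IH]. Qed.

Lemma fiter_front u n z : fiter u n.+1 z = fiter (sshift 1 u) n (quad (u 0%N) z).
Proof. by rewrite -(fiterD u 1). Qed.

Lemma eq_fiter u u' n z : (forall k, (k < n)%N -> u k = u' k) ->
  fiter u n z = fiter u' n z.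
Proof.
elim: n => // n IH uu /=; rewrite uu// IH// => k kn; apply: uu.
exact: ltn_trans kn _.
Qed.

Lemma fiter_cst (c : C R) n z : fiter (fun=> c) n z = iter n (quad c) z.
Proof. by elim: n => //= n ->. Qed.

Lemma fiterN u n z : fiter u n.+1 (- z) = fiter u n.+1 z.
Proof. by rewrite !fiter_front /quad sqrrN. Qed.

Lemma cont_fiter u n : continuous (fiter u n).
Proof. exact/polyfun_continuous/polyfun_fiter. Qed.

Fixpoint fder u (n : nat) z : C R :=
  if n is m.+1 then (fiter u m z) *+ 2 * fder u m z else 1.

Lemma sderiv_fiter u n z : sderiv (fiter u n) z (fder u n z).
Proof.
elim: n => [|n IH]; first exact: sderiv_id.
exact: sderiv_comp IH (sderiv_quad _ _).
Qed.

Lemma fderD u m n z : fder u (m + n) z = fder (sshift m u) n (fiter u m z) * fder u m z.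
Proof.
elim: n => [|n IH]; first by rewrite addn0 mul1r.
by rewrite addnS /= IH fiterD mulrA.
Qed.

Lemma fder_neq0 u n z : (forall k, (k < n)%N -> fiter u k z != 0) -> fder u n z != 0.
Proof.
elim: n => [|n IH] h /=; first exact: oner_neq0.
rewrite mulf_neq0 ?mulrn_eq0 ?h// IH// => k kn; apply: h.
exact: ltn_trans kn _.
Qed.

(* The hypothesis says that no critical value of [fiter u n] lies in the image
   of [G], so that the square roots of the successive lifts exist. *)
Lemma inverse_branch u n G v (e : R) w : continuous G -> 0 < e ->
  fiter u n w = G v ->
  (forall z j, cmod (z - v) <= e -> (j < n)%N -> fiter (sshift j u) (n - j) 0 <> G z) ->
  exists2 g : C R -> C R, continuous g &
    g v = w /\ forall z, cmod (z - v) <= e -> fiter u n (g z) = G z.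
Proof.
move=> cG e0; elim: n u w => [|n IH] u w wG crit; first by exists G.
have [||g cg [gv gG]] := IH (sshift 1 u) (quad (u 0%N) w).
- by rewrite -fiter_front.
- move=> z j zv jn; rewrite sshift_sshift; apply: (crit z j.+1 zv).
  by rewrite ltnS.
have cg' : continuous (fun z => g z - u 0%N).
  have c0 : continuous (fun _ : C R => u 0%N) by exact: cont_cst.
  exact: contB cg c0.
have [s cs [sv sg]] : exists2 s : C R -> C R, continuous s &
    s v = w /\ forall z, cmod (z - v) <= e -> s z ^+ 2 = g z - u 0%N.
  apply: sqrt_lift => // [z zv|]; last by rewrite gv /quad addrK.
  rewrite subr_eq0; apply/eqP => gz; apply: (crit z 0%N zv) => //.
  by rewrite subn0 sshift0 fiter_front /quad expr0n add0r -gz gG.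
exists s => //; split=> // z zv; rewrite fiter_front -gG//.
by congr fiter; rewrite /quad sg// subrK.
Qed.

Lemma expr_unbounded (t M : R) : 0 < t -> exists k : nat, M < (1 + t) ^+ k.
Proof.
move=> t0; have B k : 1 + k%:R * t <= (1 + t) ^+ k.
  elim: k => [|k IH]; first by rewrite mul0r addr0 expr0.
  rewrite exprS -natr1; have : 0 <= k%:R * t :> R by rewrite mulr_ge0// ltW.
  nra.
exists (Num.truncn (`|M| / t)).+1; apply: lt_le_trans (B _).
have : `|M| / t < (Num.truncn (`|M| / t)).+1%:R by exact: truncnS_gt.
rewrite ltr_pdivrMr//; have := ler_norm M; lra.
Qed.

(** * The escape radius *)

Section Escape.
Variable rho : R.
Hypothesis rho4 : 4 <= rho.

Definition pbound u := forall n, cmod (u n) <= rho.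

Lemma pbound_sshift m u : pbound u -> pbound (sshift m u).
Proof. by move=> bu n; exact: bu. Qed.

(** One radius bounds the parameters and the disc: [|z|^2 >= 4 |z|] and [|c| <= |z|] leave
    [3 |z|]. *)
Lemma quad_escape c z : cmod c <= rho -> rho <= cmod z ->
  3 * cmod z <= cmod (quad c z).
Proof.
have r4 := rho4; move=> cr rz; have := cmod_addr (z ^+ 2) c; rewrite cmodX /quad expr2.
have : 4 * cmod z <= cmod z * cmod z .
  by rewrite ler_wpM2r ?cmod_ge0//; lra.
lra.
Qed.

(** Here [|z|^2 <= 2 * rho <= (rho - 1)^2], by [rho >= 4]. The gain of 1 is the room later used for
    perturbations that must not escape. *)
Lemma quad_stay c z : cmod c <= rho -> cmod (quad c z) <= rho -> cmod z <= rho - 1.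
Proof.
have r4 := rho4; move=> cr qz; have := cmod_addr (z ^+ 2) c; rewrite cmodX -/(quad c z) => h.
have z2 : cmod z ^+ 2 <= (rho - 1) ^+ 2 by nra.
by rewrite -ler_sqr ?nnegrE ?cmod_ge0//; lra.
Qed.

Lemma fiter_stay u m n z : pbound u -> (m <= n)%N -> cmod (fiter u n z) <= rho ->
  cmod (fiter u m z) <= rho.
Proof.
move=> bu; elim: n => [|n IH]; first by rewrite leqn0 => /eqP ->.
rewrite leq_eqVlt => /predU1P[->//|mn] fz; apply: IH => //.
by have := quad_stay (bu n) fz; lra.
Qed.

Lemma fiter_stay1 u m n z : pbound u -> (m < n)%N -> cmod (fiter u n z) <= rho ->
  cmod (fiter u m z) <= rho - 1.
Proof.
move=> bu mn fz; apply: quad_stay (bu m) _.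
exact: (@fiter_stay u m.+1 n).
Qed.

Lemma fiter_escape u m n z : pbound u -> (m <= n)%N -> rho < cmod (fiter u m z) ->
  rho < cmod (fiter u n z).
Proof. by move=> bu mn; rewrite !ltNge; apply: contraNN; exact: fiter_stay. Qed.

Lemma fiter_infty_unif u (M : R) m : pbound u -> exists j, forall n z, (m + j <= n)%N ->
  rho < cmod (fiter u m z) -> M < cmod (fiter u n z).
Proof.
have r4 := rho4; move=> bu.
(* The factor 3 of [quad_escape], in the form [1 + 2]. *)
have [k kM] := @expr_unbounded 2 `|M| ltac:(lra).
exists k => n z mkn mz.
have H j : rho * (1 + 2) ^+ j <= cmod (fiter u (m + j) z).
  elim: j => [|j IH]; first by rewrite mulr1 addn0 ltW.
  have rk : rho <= cmod (fiter u (m + j) z).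
    exact: ltW (fiter_escape bu (leq_addr _ _) mz).
  have := quad_escape (bu (m + j)%N) rk; rewrite addnS /= exprS; lra.
have mn : (m <= n)%N := leq_trans (leq_addr _ _) mkn.
have := H (n - m)%N; rewrite subnKC//; apply: lt_le_trans.
have kn : (1 + 2) ^+ k <= (1 + 2) ^+ (n - m) :> R.
  by rewrite ler_weXn2l ?leq_subRL//; lra.
have := ler_norm M; have := normr_ge0 M; nra.
Qed.

Lemma fiter_infty u m z (M : R) : pbound u -> rho < cmod (fiter u m z) ->
  exists N, forall n, (N <= n)%N -> M < cmod (fiter u n z).
Proof.
by move=> bu mz; have [j h] := fiter_infty_unif M m bu; exists (m + j)%N => n mn; exact: h.
Qed.

(** The non-autonomous filled Julia set. Boundedness is encoded as never leaving one disc, time 0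
    included; by [bounded_orbit_filled] any other bound gives the same points. *)
Definition filled u : set (C R) := [set z | forall n, cmod (fiter u n z) <= rho].

Lemma nfilled u z : pbound u -> ~ filled u z -> exists m, rho < cmod (fiter u m z).
Proof.
move=> bu nK; apply: contrapT => nm; apply: nK => n; rewrite leNgt; apply/negP => h.
by apply: nm; exists n.
Qed.

Lemma bounded_orbit_filled u z (M : R) : pbound u ->
  (forall n, cmod (fiter u n.+1 z) <= M) -> filled u z.
Proof.
move=> bu zM; apply: contrapT => /(nfilled bu)[m mz].
have [N hN] := fiter_infty M bu mz.
by have := hN N.+1 (leqnSn _); rewrite ltNge zM.
Qed.

Lemma filled_closed u : closed (filled u).
Proof.
have -> : filled u = \bigcap_n (fiter u n @^-1` cdisk 0 rho).
  apply/seteqP; split=> z /= h n; first by move=> _; rewrite /cdisk/= subr0.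
  by have := h n I; rewrite /cdisk/= subr0.
apply: closed_bigI => n _; apply: closed_comp => [z _|]; first exact: cont_fiter.
exact: closed_cdisk.
Qed.

Lemma filled_compact u : compact (filled u).
Proof.
apply: (bounded_closed_compact_C (@filled_closed u)) => z /(_ 0%N); exact.
Qed.

Lemma filled_front u z : pbound u ->
  filled u z <-> filled (sshift 1 u) (quad (u 0%N) z).
Proof.
have r4 := rho4; move=> bu; split=> h n; first by rewrite -fiter_front.
case: n => [|n]; last by rewrite fiter_front.
by have := quad_stay (bu 0%N) (h 0%N); rewrite /=; lra.
Qed.

End Escape.

(* Earle-Hamilton: [w |-> f w + t (f w - z_(k+1))] still maps [K] into itself,
   which makes the derivative of the iterates decay geometrically along an
   orbit in [K]; if [K] missed the critical orbit, the inverse branches would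
   bound it from below. *)
Lemma noisy_invariant_crit (K : set (C R)) (ct : C R) (eps : R) :
  compact K -> K !=set0 -> 0 < eps -> superattracting ct ->
  (forall z c', K z -> cmod (c' - ct) <= eps -> K (quad c' z)) -> K 0.
Proof.
move=> cK [y0 Ky0] eps0 [p [p0 pct]] Kinv; apply: contrapT => nK0.
pose f := quad ct; pose u := (fun _ : nat => ct).
have Kf z : K z -> K (f z) by move=> Kz; apply: Kinv; rewrite ?subrr ?cmod0// ltW.
have Kfe z t : K z -> cmod (t - f z) <= eps -> K t.
  move=> Kz tz; have -> : t = quad (ct + (t - f z)) z by rewrite /f /quad; ring.
  by apply: Kinv => //; rewrite addrC addKr.
have Kiter n z : K z -> K (iter n f z) by move=> Kz; elim: n => //= n /Kf.
have per k : iter (k * p) f 0 = 0.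
  by elim: k => // k IH; rewrite mulSn iterD IH.
(* Every point of the critical orbit returns to 0 and [K] is forward invariant, so [K] misses the
   whole orbit once it misses 0. *)
have nKP k : ~ K (iter k f 0).
  move=> /(Kiter (k * p - k)%N); rewrite -iterD subnK ?leq_pmulr//.
  by rewrite per.
have [M KM] := compact_bounded_C cK.
pose rho := `|M| + cmod ct + 4.
have rho4 : 4 <= rho by rewrite /rho; have := normr_ge0 M; have := cmod_ge0 ct; lra.
have Krho z : K z -> cmod z <= rho.
  by move=> /KM; rewrite /rho; have := ler_norm M; have := cmod_ge0 ct; lra.
have bu : pbound rho u by move=> n; rewrite /rho /u; have := normr_ge0 M; lra.
(* The orbit [z] starts at an image, so each [z n] is [f] of a point of [K] and the disc of radius
   [eps] about it lies in [K]. *)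
pose y n := iter n f y0; pose z n := f (y n).
have Ky n : K (y n) by exact: Kiter.
have Kz n : K (z n) by exact: Kf.
have KD n w : cmod (w - z n) <= eps -> K w by exact: Kfe (Ky n).
have zS n : z n.+1 = f (z n) by rewrite /z /y.
have zE n : fiter u n (z 0%N) = z n.
  by elim: n => //= n ->; rewrite zS.
have rr0 : 0 < 2 * rho by lra.
have K2 a b : K a -> K b -> cmod (a - b) <= 2 * rho.
  move=> /Krho ar /Krho br; have := cmodD a (- b); rewrite cmodN; lra.
have low n : eps / (2 * rho) <= cmod (fder u n (z 0%N)).
  have cid : continuous (fun x : C R => x) by move=> ?; exact: id.
  have crit w j : cmod (w - z n) <= eps -> (j < n)%N ->
      fiter (sshift j u) (n - j) 0 <> w.
    move=> /KD Kw jn E; apply: (nKP (n - j)%N).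
    by rewrite -/f in E *; rewrite -fiter_cst E.
  have [g cg [gv gG]] := inverse_branch cid eps0 (zE n) crit.
  have gr w : cmod (w - z n) <= eps -> cmod (g w) <= rho.
    move=> wz; apply: (@fiter_stay _ rho4 u 0 n (g w) bu) => //.
    by rewrite gG//; apply/Krho/KD; exact: wz.
  have := sderiv_fiter u n (z 0%N); rewrite -{1}gv.
  apply: (inverse_branch_bound (v := z n) (eps := eps) (polyfun_fiter u n)) => //.
    move=> w wz; have := gr w wz; have := gr (z n).
    rewrite subrr cmod0 => /(_ (ltW eps0)).
    by have := cmodD (g w) (- g (z n)); rewrite cmodN; lra.
  move=> w wz; exists (fder u n (g w)); last exact: sderiv_fiter.
  apply: fder_neq0 => k kn; apply/eqP => gk; apply: (nKP (n - k)%N).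
  rewrite -/f -fiter_cst -gk -[X in fiter X](_ : sshift k u = _)// -fiterD subnKC ?(ltnW kn)//.
  by rewrite gG//; exact: KD wz.
(* Points of [K] are at most [2 * rho] apart, so the perturbation in [PhiS] has modulus at most
   [eps] and counts as admissible noise. The same number is the lower bound in [low]. *)
pose t := eps / (2 * rho); have t0 : 0 < t by rewrite divr_gt0.
pose Phi := fix Phi (k : nat) (w : C R) : C R :=
  if k is m.+1 then (1 + t)%:C%C * f (Phi m w) - t%:C%C * z m.+1 else w.
have PhiS k w : Phi k.+1 w = f (Phi k w) + t%:C%C * (f (Phi k w) - z k.+1).
  by rewrite /= rmorphD rmorph1; ring.
have Phiz k : Phi k (z 0%N) = z k.
  by elim: k => // k IH; rewrite PhiS IH -zS subrr mulr0 addr0.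
have PhiK k w : cmod (w - z 0%N) <= eps -> K (Phi k w).
  move=> wz; elim: k => [|k IH]; first exact: KD wz.
  rewrite PhiS; apply: (Kfe _ _ IH); rewrite addrC addKr cmodM cmodR gtr0_norm//.
  rewrite /t mulrAC ler_pdivrMr// ler_pM2l//.
  by apply: K2; [exact: Kf|exact: Kz].
have pPhi k : polyfun (Phi k).
  elim: k => [|k IH]; first exact: polyfun_id.
  apply: (@polyfunD _ (fun w => (1 + t)%:C%C * f (Phi k w)) (fun=> - (t%:C%C * z k.+1))).
    apply: (@polyfunM _ (fun=> (1 + t)%:C%C)); first exact: polyfun_cst.
    exact: polyfun_comp (polyfun_quad ct) IH.
  exact: polyfun_cst.
have dPhi k : sderiv (Phi k) (z 0%N) (((1 + t)%:C%C) ^+ k * fder u k (z 0%N)).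
  elim: k => [|k IH]; first by rewrite expr0 mul1r; exact: sderiv_id.
  have h1 := sderiv_comp IH (sderiv_quad ct (Phi k (z 0%N))).
  have := sderiv_comp h1 (@sderiv_affine _ (quad ct (Phi k (z 0%N))) ((1 + t)%:C%C) (- (t%:C%C * z k.+1))).
  congr sderiv; rewrite Phiz /= zE exprS; ring.
have up k : (1 + t) ^+ k * cmod (fder u k (z 0%N)) <= 2 * rho / eps.
  have := @cauchy_sderiv _ (Phi k) (z 0%N) eps (2 * rho) _ (pPhi k) eps0 _ (dPhi k).
  rewrite cmodM cmodX cmodR gtr0_norm; last lra.
  apply=> w wz; apply: K2; apply: PhiK => //.
  by rewrite subrr cmod0 ltW.
have [k kM] := @expr_unbounded t (2 * rho / eps / t) t0.
have := up k; have := low k; rewrite -/t => lk uk.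
move: kM; rewrite ltr_pdivrMr//.
have : (1 + t) ^+ k * t <= (1 + t) ^+ k * cmod (fder u k (z 0%N)).
  by rewrite ler_wpM2l// exprn_ge0//; lra.
lra.
Qed.

End Dynamics.

(** * Bifurcation radius *)

Section Bifurcation.
Variable R : realType.
Implicit Types (x y z : C R) (w u : nat -> C R) (c ct : C R) (r : R).

Lemma fiter_near w n z (e : R) : 0 < e -> exists2 d : R, 0 < d &
  forall w' z', cmod (z' - z) < d -> (forall i, (i < n)%N -> cmod (w' i - w i) < d) ->
    cmod (fiter w' n z' - fiter w n z) < e.
Proof.
elim: n e => [|n IH] e e0; first by exists e.
have e20 : 0 < e / 2 by lra.
have /continuous_cmodP/(_ (fiter w n z) _ e20)[d1 d10 qd] :
  continuous (quad (w n)) := polyfun_continuous (polyfun_quad _).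
have [d2 d20 fd] := IH d1 d10.
exists (Num.min d2 (e / 2)) => [|w' z']; first by rewrite lt_min d20.
rewrite lt_min => /andP[zz _] ww.
have ww1 i : (i < n)%N -> cmod (w' i - w i) < d2.
  by move=> /ltnW/(ww i); rewrite lt_min => /andP[].
have := ww n (ltnSn n); rewrite lt_min => /andP[_ wn].
have := qd _ (fd w' z' zz ww1) => qn.
rewrite /= (_ : quad (w' n) _ - _ =
  (quad (w n) (fiter w' n z') - quad (w n) (fiter w n z)) + (w' n - w n)); last first.
  by rewrite /quad; ring.
by apply: le_lt_trans (cmodD _ _) _; lra.
Qed.

Lemma cdisk_center c r : 0 <= r -> cdisk c r c.
Proof. by move=> r0; rewrite /cdisk/= subrr cmod0. Qed.

Lemma Omega_cst c r c' : cdisk c r c' -> Omega_cr c r (fun=> c').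
Proof. by move=> ? ?. Qed.

Lemma Omega_sshift c r m w : Omega_cr c r w -> Omega_cr c r (sshift m w).
Proof. by move=> h n; exact: (h (m + n)%N). Qed.

Lemma in_G_fiter c r w n : Omega_cr c r w -> in_G c r (fiter w n.+1).
Proof.
move=> hw; elim: n => [|n IH]; first exact: in_G_gen (hw 0%N).
exact: in_G_comp (in_G_gen (hw n.+1)) IH.
Qed.

Definition scat (n : nat) w w' : nat -> C R :=
  fun k => if (k < n)%N then w k else w' (k - n)%N.

Lemma Omega_scat c r n w w' : Omega_cr c r w -> Omega_cr c r w' ->
  Omega_cr c r (scat n w w').
Proof. by move=> hw hw' k; rewrite /scat; case: ifP. Qed.

Lemma fiter_scat n m w w' z :
  fiter (scat n w w') (n + m) z = fiter w' m (fiter w n z).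
Proof.
rewrite fiterD; have -> : sshift n (scat n w w') = w'.
  by apply/funext => k; rewrite /sshift /scat ltnNge leq_addr /= addKn.
by congr fiter; apply: eq_fiter => k kn; rewrite /scat kn.
Qed.

Lemma in_GP c r g : in_G c r g ->
  exists n w, Omega_cr c r w /\ g = fiter w n.+1.
Proof.
elim=> {g} [c' hc'|g h _ [n [w [hw ->]]] _ [m [w' [hw' ->]]]].
  by exists 0%N, (fun=> c'); split=> //; exact: Omega_cst.
exists (m.+1 + n)%N, (scat m.+1 w' w); split; first exact: Omega_scat.
by apply/funext => z; rewrite -addnS fiter_scat.
Qed.

Lemma in_G_continuous c r g : in_G c r g -> continuous g.
Proof. by move=> /in_GP[n [w [_ ->]]]; exact: cont_fiter. Qed.

(** A point at distance at least [r] could be pushed radially outwards within its neighbourhood; at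
    the centre itself any direction serves. *)
Lemma interior_cdisk c r ct : interior (cdisk c r) ct -> cmod (ct - c) < r.
Proof.
move=> /nbhs_cballP[e e0 eD]; rewrite ltNge; apply/negP => rc.
have [ctc|ctc] := eqVneq ct c.
  have := eD (ct + (e / 2)%:C%C); rewrite /cball /cdisk /= {1}addrC addKr.
  rewrite cmodR gtr0_norm; last by lra.
  move=> /(_ ltac:(lra)); rewrite ctc addrC addKr cmodR gtr0_norm; last by lra.
  by move: rc; rewrite ctc subrr cmod0; lra.
have n0 : 0 < cmod (ct - c) by rewrite cmod_gt0// subr_eq0.
pose k := e / 2 / cmod (ct - c).
have k0 : 0 < k by rewrite divr_gt0//; lra.
have kn : k * cmod (ct - c) = e / 2 by rewrite /k mulfVK// gt_eqF.
have := eD (ct + k%:C%C * (ct - c)); rewrite /cball /cdisk /= {1}addrC addKr.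
rewrite cmodM cmodR gtr0_norm// kn => /(_ ltac:(lra)).
have -> : ct + k%:C%C * (ct - c) - c = (1 + k)%:C%C * (ct - c).
  by rewrite rmorphD rmorph1; ring.
rewrite cmodM cmodR gtr0_norm; last by lra.
by rewrite mulrDl mul1r kn; lra.
Qed.

Definition plane_part (L : set (Chat R)) : set (C R) := [set z | L (Some z)].

Lemma compact_plane_part (L : set (Chat R)) : compact L -> planar L ->
  compact (plane_part L).
Proof.
move=> cL pL F PF FL.
have FSL : (Some @ F : set_system (Chat R)) L by exact: FL.
have [[z|] [Lp clp]] := cL (Some @ F : set_system (Chat R)) _ FSL; last by [].
exists z; split=> // A B FA zB.
have FSA : F (Some @^-1` (Some @` A)) by apply: filterS FA => a Aa; exists a.
have [p [[a Aa <-] [b Bb ba]]] := clp _ _ FSA (one_point_compactification_some_nbhs _ _ zB).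
by case: ba => ba; exists a; split=> //; rewrite -ba.
Qed.

Lemma invariant_orbit c r (L : set (Chat R)) w n z :
  invariant_set (in_G c r) L -> Omega_cr c r w -> L (Some z) ->
  L (Some (fiter w n z)).
Proof.
move=> iL hw Lz; case: n => [//|n].
by apply: (iL _ (in_G_fiter n hw)); exists (Some z).
Qed.

(** The disc of radius [r - cmod (ct - c)] about [ct] consists of admissible parameters, so
    invariance provides the noise asked for by [noisy_invariant_crit]. *)
Lemma planar_invariant_crit c r ct (L : set (Chat R)) :
  cmod (ct - c) < r -> superattracting ct ->
  L !=set0 -> compact L -> invariant_set (in_G c r) L -> planar L -> L (Some 0).
Proof.
move=> ctr sct [[z|] Lz] cL iL pL //.
pose eps := r - cmod (ct - c).
have eps0 : 0 < eps by rewrite subr_gt0.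
apply: (@noisy_invariant_crit _ (plane_part L) ct eps) => //.
- exact: compact_plane_part.
- by exists z.
move=> y c' Ly cc'; apply: (iL (quad c')); last by exists (Some y).
apply: in_G_gen; rewrite /cdisk/=; have := cmod_triangle ct c' c.
by rewrite /eps in cc'; lra.
Qed.

(** Bounds the set whose supremum is [rbif c]. If [r > |c| + 1], taking the parameter displaced from
    [c] in the direction of [y ^+ 2] gives modulus at least [|y|^2 + r - |c| > |y| + 3/4], so orbits
    in the set would be unbounded. *)
Lemma planar_radius_ub c r : has_planar_minimal_set (in_G c r) -> r <= cmod c + 1.
Proof.
move=> [L [[[[z|] Lz] cL iL _] pL]] //.
rewrite leNgt; apply/negP => cr.
have [M LM] := compact_bounded_C (compact_plane_part cL pL).
suff H n : exists2 y, L (Some y) & n%:R * (3 / 4) <= cmod y.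
  have [y Ly yn] := H (Num.truncn (`|M| / (3 / 4))).+1.
  have : `|M| / (3 / 4) < (Num.truncn (`|M| / (3 / 4))).+1%:R by exact: truncnS_gt.
  rewrite ltr_pdivrMr; last by lra.
  by have := LM y Ly; have := ler_norm M; lra.
elim: n => [|n [y Ly yn]]; first by exists z; rewrite // mul0r cmod_ge0.
have [d d1 dy] : exists2 d : C R, cmod d = 1 & y ^+ 2 = (cmod y ^+ 2)%:C%C * d.
  have [->|y0] := eqVneq y 0.
    by exists 1; rewrite ?cmod1// cmod0 expr0n /= expr0n rmorph0 mul0r.
  have y20 : cmod y ^+ 2 != 0 by rewrite expf_neq0// gt_eqF// cmod_gt0.
  exists ((cmod y ^+ 2)^-1%:C%C * y ^+ 2).
    by rewrite cmodM cmodR cmodX ger0_norm ?mulVf// invr_ge0 exprn_ge0// cmod_ge0.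
  by rewrite mulrA -rmorphM /= mulfV// rmorph1 mul1r.
have r0 : 0 <= r by have := cmod_ge0 c; lra.
pose c' := c + r%:C%C * d.
exists (quad c' y).
  apply: (iL (quad c')); last by exists (Some y).
  by apply: in_G_gen; rewrite /cdisk/= /c' addrC addKr cmodM cmodR d1 mulr1 ger0_norm.
have -> : quad c' y = (cmod y ^+ 2 + r)%:C%C * d + c.
  by rewrite /quad /c' dy rmorphD /=; ring.
apply: le_trans (cmod_addr _ _); rewrite cmodM cmodR d1 mulr1 ger0_norm; last first.
  by rewrite addr_ge0// exprn_ge0// cmod_ge0.
rewrite -natr1; have : 0 <= (cmod y - 1 / 2) ^+ 2 by rewrite sqr_ge0.
rewrite !expr2; lra.
Qed.

(** Parameters in the disc have modulus at most [cmod c + r]; the 4 ensures the lower bound on the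
    escape radius. *)
Definition escrad c r : R := 4 + cmod c + r.

Lemma escrad4 c r : 0 <= r -> 4 <= escrad c r.
Proof. by move=> r0; rewrite /escrad; have := cmod_ge0 c; lra. Qed.

Lemma Omega_pbound c r w : Omega_cr c r w -> pbound (escrad c r) w.
Proof.
move=> hw n; have := hw n; rewrite /cdisk /escrad /=.
by have := cmod_subr (w n) c; lra.
Qed.

Lemma bounded_orbit0P c r w : 0 <= r -> Omega_cr c r w ->
  bounded_orbit0 w <-> filled (escrad c r) w 0.
Proof.
move=> r0 hw; split=> [[M wM]|h]; last by exists (escrad c r) => n; exact: h.
exact: (@bounded_orbit_filled _ _ (escrad4 c r0) _ _ M (Omega_pbound hw) wM).
Qed.

(** The supremum [rbif c] is only approached. So an escaping sequence is contracted towards [c] by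
    [1 - k], still escapes at time [n], and fits in a smaller disc whose semigroup has a planar
    minimal set. *)
Lemma rbif_bounded c r ct : 0 <= r -> cmod (ct - c) < r -> superattracting ct ->
  r <= rbif c -> forall w, Omega_cr c r w -> bounded_orbit0 w.
Proof.
move=> r0 ctr sct rb w hw; apply/(bounded_orbit0P r0 hw) => n.
rewrite leNgt; apply/negP => wn.
have e0 : 0 < cmod (fiter w n 0) - escrad c r by rewrite subr_gt0.
have [d d0 wd] := fiter_near w n 0 e0.
pose k := Num.min (1 / 2) (d / (2 * (r + 1))).
have k0 : 0 < k by rewrite lt_min; apply/andP; split; [lra|rewrite divr_gt0//; lra].
have k1 : k <= 1 / 2 by rewrite ge_min lexx.
have kr : k * r < d.
  have : k <= d / (2 * (r + 1)) by rewrite ge_min lexx orbT.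
  rewrite ler_pdivlMr; last by lra.
  nra.
pose w' i := c + (1 - k)%:C%C * (w i - c).
have w'w i : cmod (w' i - w i) < d.
  have -> : w' i - w i = - (k%:C%C * (w i - c)) by rewrite /w' rmorphB rmorph1; ring.
  rewrite cmodN cmodM cmodR gtr0_norm//; apply: le_lt_trans kr.
  by rewrite ler_pM2l//; exact: hw.
have := wd w' 0; rewrite subrr cmod0 => /(_ d0 (fun i _ => w'w i)) fw.
have w'n : escrad c r < cmod (fiter w' n 0).
  by have := cmod_subr (fiter w n 0) (fiter w' n 0); rewrite (cmodB (fiter w n 0)); lra.
have rpos : 0 < r by have := cmod_ge0 (ct - c); lra.
pose E := [set r : R | 0 <= r /\ has_planar_minimal_set (in_G c r)].
have E0 : E !=set0.
  (* The supremum of the empty set is 0, which is below [r]. *)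
  apply/set0P/eqP => E0; move: rb; rewrite /rbif -/E E0 sup0; lra.
have sE : has_sup E.
  by split=> //; exists (cmod c + 1) => s [_]; exact: planar_radius_ub.
(* A radius [s > m] keeps [ct] in the interior of the disc and still admits [w']. *)
pose m := Num.max (cmod (ct - c)) ((1 - k) * r).
have mr : m < r by rewrite gt_max ctr /=; nra.
have mE : 0 < sup E - m by rewrite -/(rbif c) subr_gt0; exact: lt_le_trans mr rb.
have [s [s0 [L [[L0 cL iL _] pL]]]] := sup_adherent mE sE.
rewrite opprB addrC subrK gt_max => /andP[cts krs].
have L00 := planar_invariant_crit cts sct L0 cL iL pL.
have hw' : Omega_cr c s w'.
  move=> i; rewrite /cdisk/= /w' addrC addKr cmodM cmodR ger0_norm; last by lra.
  apply: le_trans (ltW krs); rewrite ler_wpM2l//; [lra|exact: hw].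
have hw'r : Omega_cr c r w'.
  move=> i; rewrite /cdisk/= /w' addrC addKr cmodM cmodR ger0_norm; last by lra.
  by have := hw i; rewrite /cdisk/=; have := cmod_ge0 (w i - c); nra.
have [M LM] := compact_bounded_C (compact_plane_part cL pL).
have : filled (escrad c r) w' 0.
  apply/(bounded_orbit0P r0 hw'r); exists M => j; apply: LM.
  exact: (invariant_orbit _ iL hw' L00).
by move=> /(_ n); rewrite leNgt w'n.
Qed.

Lemma closure_Some (A : set (Chat R)) (z : C R) :
  closure A (Some z) <-> closure (plane_part A) z.
Proof.
split=> [clA B zB|clA B zB].
  have [p [Ap [b Bb bp]]] := clA _ (one_point_compactification_some_nbhs _ _ zB).
  by exists b; split=> //; rewrite /plane_part /= bp.
by have [b [Ab Bb]] := clA (Some @^-1` B) zB; exists (Some b).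
Qed.

Lemma closure_planar (A : set (Chat R)) (M : R) :
  (forall p, A p -> exists z : C R, p = Some z /\ cmod z <= M) ->
  forall p, closure A p -> exists z : C R, p = Some z /\ cmod z <= M.
Proof.
move=> AM p clp.
have cD := @compact_cdisk R 0 M.
have NU : nbhs (None : Chat R) ((Some @` (~` cdisk (0 : C R) M)) `|` [set None]).
  by exists (cdisk 0 M) => //; split=> //; exact: closed_cdisk.
case: p clp => [z|] clp; last first.
  have [p [Ap [[y yD yp]|pN]]] := clp _ NU.
    have [y' [py' yM]] := AM p Ap; apply: False_ind; apply: yD.
    by move: py'; rewrite -yp /cdisk/= subr0 => -[->].
  by have [y' [py' _]] := AM p Ap; rewrite pN in py'.
exists z; split=> //; suff : cdisk 0 M z by rewrite /cdisk/= subr0.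
move/closure_Some : clp => /(closure_subset (_ : _ `<=` cdisk 0 M)).
rewrite -(closure_id _).1; first by apply=> y /AM[y' [[->]]]; rewrite /cdisk/= subr0.
exact: closed_cdisk.
Qed.

Lemma orbit_closure_bounded c r : 0 <= r ->
  (forall w, Omega_cr c r w -> bounded_orbit0 w) ->
  forall p, orbit_closure c r p -> exists z : C R, p = Some z /\ cmod z <= escrad c r.
Proof.
move=> r0 bw; apply: closure_planar => _ [g [/in_GP[n [w [hw ->]]] ->]].
exists (fiter w n.+1 0); split=> //.
exact: (bounded_orbit0P r0 hw).1 (bw w hw) n.+1.
Qed.

(** For minimality: an invariant compact subset is planar, so it contains 0 by
    [planar_invariant_crit], hence the orbit of 0 and its closure. *)
Lemma orbit_closure_minimal c r ct : 0 <= r -> cmod (ct - c) < r ->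
  superattracting ct -> (forall w, Omega_cr c r w -> bounded_orbit0 w) ->
  minimal_set (in_G c r) (orbit_closure c r) /\ planar (orbit_closure c r).
Proof.
move=> r0 ctr sct bw; have bO := orbit_closure_bounded r0 bw.
have pO : planar (orbit_closure c r) by move=> /bO[z []].
split=> //; split.
- exists (Some (quad c 0)); apply: subset_closure; exists (quad c); split=> //.
  by apply: in_G_gen; exact: cdisk_center.
- apply: (@subclosed_compact (Chat R) _ setT) => //; first exact: closed_closure.
  exact: one_point_compactification_compact.
- move=> g Gg _ [[z|] Oz <-]; last by have := pO Oz.
  apply/closure_Some => B gB; have /closure_Some := Oz.
  move=> /(_ _ (in_G_continuous Gg gB))[y [[h [Gh [yh]]] By]].
  exists (g y); split=> //; exists (g \o h); split; first exact: in_G_comp.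
  by rewrite yh.
move=> K K0 cK iK KO; apply/seteqP; split=> // p Op.
have pK : planar K by move=> /KO.
have K00 := planar_invariant_crit ctr sct K0 cK iK pK.
have [z [pz _]] := bO p Op; rewrite pz in Op *.
have clK := compact_closed_C (compact_plane_part cK pK).
apply: clK; move/closure_Some : Op; apply: closure_subset => y [g [Gg [->]]].
by apply: (iK g Gg); exists (Some 0).
Qed.

Lemma planar_rbif c r : 0 <= r -> has_planar_minimal_set (in_G c r) -> r <= rbif c.
Proof.
move=> r0 hr; apply: ub_le_sup; last by [].
by exists (cmod c + 1) => s [_]; exact: planar_radius_ub.
Qed.

Lemma orbit_closure_boundedP c r : 0 <= r -> bounded_in_C (orbit_closure c r) <->
  (forall w, Omega_cr c r w -> bounded_orbit0 w).
Proof.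
move=> r0; split=> [[M OM] w hw|bw]; last first.
  by exists (escrad c r); exact: orbit_closure_bounded.
exists M => n; have [|z [+ zM]] := OM (Some (fiter w n.+1 0)); last by move=> [zE]; rewrite /= zE.
by apply: subset_closure; exists (fiter w n.+1); split=> //; exact: in_G_fiter.
Qed.

(* The points that escape under no sequence of parameters form an invariant
   compact set, which contains [0] as soon as it is not empty. *)
Lemma escape_everywhere c r ct : 0 <= r -> cmod (ct - c) < r ->
  superattracting ct -> ~ (forall w, Omega_cr c r w -> bounded_orbit0 w) ->
  forall z, exists n w, Omega_cr c r w /\ escrad c r < cmod (fiter w n z).
Proof.
move=> r0 ctr sct nb z; apply: contrapT => nz; apply: nb => w hw.
apply/(bounded_orbit0P r0 hw).
pose A := [set y | forall w, Omega_cr c r w -> filled (escrad c r) w y].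
suff : A 0 by apply.
apply: (@noisy_invariant_crit _ A ct (r - cmod (ct - c))) => //.
- apply: (@bounded_closed_compact_C _ _ (escrad c r)); last first.
    move=> y /(_ _ (Omega_cst (cdisk_center c r0)) 0%N); exact.
  have -> : A = \bigcap_(w in Omega_cr c r) filled (escrad c r) w by [].
  by apply: closed_bigI => w' _; exact: filled_closed.
- exists z => w' hw' n; rewrite leNgt; apply/negP => wn; apply: nz.
  by exists n, w'.
- by rewrite subr_gt0.
move=> y c' Ay cc' w' hw'.
have hc' : cdisk c r c' by rewrite /cdisk/=; have := cmod_triangle ct c' c; lra.
have := Ay _ (Omega_scat 1 (Omega_cst hc') hw') => h n.
by have := h n.+1; rewrite -add1n fiter_scat.
Qed.

End Bifurcation.

(** * Normality and Julia sets *)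

Section Subsequences.

(** Applied to the times of a sequence of iterates: either one iterate recurs and gives a constant
    subsequence, or the times tend to infinity. *)
Lemma nat_recurrent_or_infty (n : nat -> nat) :
  (exists v, forall k0, exists2 k, (k0 <= k)%N & n k = v) \/
  (forall N, exists k0, forall k, (k0 <= k)%N -> (N <= n k)%N).
Proof.
have [|nr] := pselect (exists v, forall k0, exists2 k, (k0 <= k)%N & n k = v); first by left.
right; elim=> [|N [k0 k0N]]; first by exists 0%N.
have [k1 k1N] : exists k1, forall k, (k1 <= k)%N -> n k <> N.
  apply: contrapT => h; apply: nr; exists N => k1; apply: contrapT => h1; apply: h.
  by exists k1 => k kk E; apply: h1; exists k.
exists (maxn k0 k1) => k; rewrite geq_max => /andP[/k0N kN /k1N/eqP kn].
by rewrite ltn_neqAle eq_sym kn.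
Qed.

Lemma subsequence (Q : nat -> nat -> Prop) :
  (forall m k0, exists2 k, (k0 <= k)%N & Q m k) ->
  exists2 psi : nat -> nat, (forall k, (psi k < psi k.+1)%N) & forall m, Q m (psi m).
Proof.
move=> h.
have /choice[s sP] : forall p : nat * nat, exists k, (p.2 <= k)%N /\ Q p.1 k.
  by move=> [m k0]; have [k] := h m k0; exists k.
pose psi := fix psi (m : nat) := if m is j.+1 then s (m, (psi j).+1) else s (0%N, 0%N).
exists psi => [k|[|m]]; first by have [] := sP (k.+1, (psi k).+1).
  by have [] := sP (0%N, 0%N).
by have [] := sP (m.+1, (psi m).+1).
Qed.

Lemma strict_mono_geq (psi : nat -> nat) : (forall k, (psi k < psi k.+1)%N) ->
  forall k, (k <= psi k)%N.
Proof. by move=> h; elim=> // k IH; exact: leq_ltn_trans IH (h k). Qed.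

End Subsequences.

Section Normality.
Variable R : realType.
Implicit Types (x y z : C R) (w u : nat -> C R).

Lemma sqrt1D_ge1 (a : R) : 1 <= Num.sqrt (1 + a ^+ 2).
Proof. by rewrite -{1}sqrtr1 ler_wsqrtr// lerDl sqr_ge0. Qed.

Lemma sqrt1D_gt0 (a : R) : 0 < Num.sqrt (1 + a ^+ 2).
Proof. exact: lt_le_trans ltr01 (sqrt1D_ge1 a). Qed.

Lemma sqrt1D_ge (a : R) : a <= Num.sqrt (1 + a ^+ 2).
Proof.
apply: le_trans (ler_norm a) _; rewrite -sqrtr_sqr ler_wsqrtr//.
by rewrite lerDr.
Qed.

Lemma sqrt1D_le (a : R) : 0 <= a -> Num.sqrt (1 + a ^+ 2) <= 1 + a.
Proof.
move=> a0; rewrite -[leRHS]ger0_norm; last by lra.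
rewrite -sqrtr_sqr ler_wsqrtr//; nra.
Qed.

Lemma chordal_le x y : chordal (Some x) (Some y) <= 2 * cmod (x - y).
Proof.
rewrite /= ler_pdivrMr ?mulr_gt0 ?sqrt1D_gt0//.
rewrite ler_peMr ?mulr_ge0 ?cmod_ge0//.
have := sqrt1D_ge1 (cmod x); have := sqrt1D_ge1 (cmod y); nra.
Qed.

Lemma chordal_infty x (M : R) : 0 < M -> M < cmod x -> chordal (Some x) None < 2 / M.
Proof.
move=> M0 Mx; rewrite /= ltr_pM2l// ltf_pV2 ?posrE ?sqrt1D_gt0//.
exact: lt_le_trans Mx (sqrt1D_ge _).
Qed.

(** The bound depends on [y] only, so an escaping orbit cannot converge chordally to a finite
    [y]. *)
Lemma chordal_far x y : 1 + 2 * cmod y <= cmod x ->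
  (Num.sqrt (1 + cmod y ^+ 2))^-1 <= chordal (Some x) (Some y).
Proof.
move=> yx; rewrite /= invfM mulrA ler_peMl ?invr_ge0 ?sqrtr_ge0//.
rewrite ler_pdivlMr ?sqrt1D_gt0// mul1r.
apply: le_trans (sqrt1D_le (cmod_ge0 x)) _.
by have := cmod_subr x y; lra.
Qed.

Section Filled.
Variables (rho : R) (w : nat -> C R).
Hypotheses (rho4 : 4 <= rho) (bw : pbound rho w).

(** On the open set of points beyond [rho] at time [m] the family is normal: a sequence of iterates
    either repeats one of them or, along a subsequence, tends to infinity uniformly. *)
Lemma julia_filled : julia w `<=` filled rho w.
Proof.
move=> z Jz; apply: contrapT => /(nfilled bw)[m mz].
apply: (Jz [set y | rho < cmod (fiter w m y)]) => //.
  apply/open_cballP => y /= my.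
  have e0 : 0 < cmod (fiter w m y) - rho by rewrite subr_gt0.
  have /continuous_cmodP/(_ y _ e0)[d d0 fd] := @cont_fiter _ w m.
  exists d => // x /fd; rewrite /=.
  by have := cmod_subr (fiter w m y) (fiter w m x); rewrite (cmodB (fiter w m y)); lra.
move=> h /choice[n hn].
have [[v rec]|inf] := nat_recurrent_or_infty n.
  have [psi psiS psiv] := subsequence (fun _ => rec).
  exists psi, (Some \o fiter w v.+1); split=> // K cK KU e e0; exists 0%N => k _ y Ky.
  rewrite /comp hn psiv; apply: le_lt_trans (chordal_le _ _) _.
  by rewrite subrr cmod0 mulr0.
have [psi psiS psin] : exists2 psi : nat -> nat, (forall k, (psi k < psi k.+1)%N) &
    forall k, (k <= n (psi k))%N.
  apply: (@subsequence (fun m k => (m <= n k)%N)) => j k0; have [k1 k1j] := inf j.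
  by exists (maxn k0 k1); rewrite ?leq_maxl// k1j// leq_maxr.
exists psi, (fun=> None); split=> // K cK KU e e0.
have e20 : 0 < 2 / e by rewrite divr_gt0.
have [j jM] := fiter_infty_unif rho4 (2 / e) m bw.
exists (m + j)%N => k mjk y Ky; rewrite /comp hn.
have -> : e = 2 / (2 / e) by rewrite invf_div mulrC mulfVK.
apply: chordal_infty => //; apply: jM (KU _ Ky).
exact: leq_trans mjk (leq_trans (psin k) (leqnSn _)).
Qed.

(** A limit [g] fails at one escaping point [y] near [z]: at a fixed time [y] is still close to a
    bounded orbit, so [g y] is not infinity, and later [y] escapes, so [g y] is not finite. *)
Lemma boundary_julia z : filled rho w z -> closure (~` filled rho w) z -> julia w z.
Proof.
have r4 := rho4; move=> Kz clz U oU Uz nU.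
have [|psi [g [psiS conv]]] := nU (fun k => fiter w k.+1); first by move=> k; exists k.
have /open_cballP/(_ z Uz)[e e0 eU] := oU.
(* A point of modulus at most [1 + rho] has chordal distance at least [eta] from infinity. *)
pose eta := 2 / (2 + rho).
have eta0 : 0 < eta by rewrite divr_gt0//; lra.
have DU : cdisk z (e / 2) `<=` U.
  by move=> y; rewrite /cdisk/= => ye; apply: eU; rewrite /cball/=; lra.
have [N NC] := conv _ (@compact_cdisk _ z (e / 2)) DU eta eta0.
have /continuous_cmodP/(_ z 1 ltr01)[d d0 fd] := @cont_fiter _ w (psi N).+1.
have m0 : 0 < Num.min (e / 2) d by rewrite lt_min d0 andbT; lra.
have [y [nKy]] := clz _ (nbhs_cball z m0); rewrite /cball /= lt_min => /andP[ye yd].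
have Dy : cdisk z (e / 2) y by exact: ltW.
have fy : cmod (fiter w (psi N).+1 y) < 1 + rho.
  have := cmod_subr (fiter w (psi N).+1 y) (fiter w (psi N).+1 z).
  by have := fd y yd; have := Kz (psi N).+1; lra.
have [m my] := nfilled bw nKy.
have := NC N (leqnn N) y Dy; rewrite /comp.
case gy : (g y) => [v|]; last first.
  apply/negP; rewrite -leNgt /= ler_pM2l// lef_pV2 ?posrE ?sqrt1D_gt0//; last by lra.
  by apply: le_trans (sqrt1D_le (cmod_ge0 _)) _; lra.
move=> _; have v0 : 0 < (Num.sqrt (1 + cmod v ^+ 2))^-1 by rewrite invr_gt0 sqrt1D_gt0.
have cy : compact [set y] by exact: compact_set1.
have yU : [set y] `<=` U by move=> _ ->; exact: DU.
have [N' N'C] := conv _ cy yU _ v0.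
have [M HM] := fiter_infty_unif rho4 (1 + 2 * cmod v) m bw.
pose k := maxn N' (m + M).
have := N'C k (leq_maxl _ _) y erefl; rewrite gy /comp; apply/negP; rewrite -leNgt.
apply: chordal_far; apply/ltW/HM => //.
by apply: leq_trans (leq_maxr N' _) _; apply/leqW/strict_mono_geq.
Qed.

(* Montel: on a disc inside the filled Julia set the iterates are bounded,
   hence equi-Lipschitz, and an ultrafilter limit is a uniform limit. *)
Lemma interior_not_julia z : interior (filled rho w) z -> ~ julia w z.
Proof.
have r4 := rho4; move=> /nbhs_cballP[e e0 eK].
pose d := e / 4; have d0 : 0 < d by rewrite /d; lra.
have dK y : cmod (y - z) <= 2 * d -> filled rho w y.
  by move=> yd; apply: eK; rewrite /cball/=; move: yd; rewrite /d; lra.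
move=> /(_ (cball z d)); apply.
- apply/open_cballP => y; rewrite {1}/cball/= => yz; exists (d - cmod (y - z)).
    by rewrite subr_gt0.
  by move=> x; rewrite /cball/=; have := cmod_triangle y x z; lra.
- by rewrite /cball/= subrr cmod0.
move=> h /choice[n hn].
pose L := 2 * rho / d.
have L0 : 0 < L by rewrite divr_gt0//; lra.
have lip k x y : cmod (x - z) <= d -> cmod (y - x) <= d ->
    cmod (h k y - h k x) <= L * cmod (y - x).
  move=> xz yx; rewrite hn; apply: cauchy_lipschitz => //; first exact: polyfun_fiter.
  move=> t tx; have Kt : filled rho w t.
    by apply: dK; have := cmod_triangle x t z; lra.
  have Kx : filled rho w x by apply: dK; lra.
  have := cmodD (fiter w (n k).+1 t) (- fiter w (n k).+1 x); rewrite cmodN.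
  by have := Kt (n k).+1; have := Kx (n k).+1; lra.
have hr k x : cmod (x - z) <= d -> cmod (h k x) <= rho.
  by move=> xz; rewrite hn; apply: (dK x); lra.
have [UF [UU UFinf]] := @ultraFilterLemma _ (\oo : set_system nat) _.
have lim x : exists v, cmod (x - z) <= d -> forall eps : R, 0 < eps ->
    UF [set k | cmod (h k x - v) < eps].
  have [xz|xz] := pselect (cmod (x - z) <= d); last by exists 0.
  have cD := @compact_cdisk R 0 rho.
  have FD : (h^~ x @ UF) (cdisk 0 rho).
    rewrite /fmap /=; apply: filterS (@filterT _ UF _) => k _ /=.
    by rewrite /cdisk/= subr0 hr.
  have [v [_ clv]] := cD (h^~ x @ UF) _ FD.
  exists v => _ eps eps0.
  have [//|nUF] := in_ultra_setVsetC [set k | cmod (h k x - v) < eps] UU.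
  have [y [ny yv]] := clv (~` cball v eps) (cball v eps) nUF (nbhs_cball v eps0).
  by case: ny.
have /choice[f fP] := lim.
have flip x y : cmod (x - z) <= d -> cmod (y - z) <= d -> cmod (y - x) <= d ->
    cmod (f y - f x) <= L * cmod (y - x).
  move=> xz yz yx; apply/ler_addgt0Pr => eps eps0; have eps20 : 0 < eps / 2 by lra.
  have /filter_ex[k [/= kx ky]] : UF ([set k | cmod (h k x - f x) < eps / 2] `&`
      [set k | cmod (h k y - f y) < eps / 2]) by apply: filterI; exact: fP.
  have := lip k x y xz yx; have := cmod_triangle (h k y) (f y) (f x).
  have := cmod_triangle (h k x) (h k y) (f x); rewrite (cmodB (f y) (h k y)); lra.
have unif (eps : R) : 0 < eps ->
    UF [set k | forall y, cmod (y - z) <= d -> cmod (h k y - f y) < eps].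
  move=> eps0; have /compact_near_coveringP := @compact_cdisk R z d.
  move=> /(_ nat UF (fun k y => cmod (y - z) <= d -> cmod (h k y - f y) < eps)).
  move=> H; apply: filterS (H _ _) => [k kD y yz|x xz]; first exact: (kD y yz yz).
  have eps30 : 0 < eps / 3 by lra.
  pose b := Num.min d (eps / (4 * L)).
  have b0 : 0 < b by rewrite lt_min d0 divr_gt0//; lra.
  have bd : b <= d by rewrite ge_min lexx.
  have bL : L * b <= eps / 4.
    have : b <= eps / (4 * L) by rewrite ge_min lexx orbT.
    rewrite ler_pdivlMr => [bL|]; last by lra.
    have -> : L * b = b * (4 * L) / 4 by field.
    lra.
  exists (cball x b, [set k | cmod (h k x - f x) < eps / 3]).
    by split; [exact: nbhs_cball|exact: fP].
  move=> [y k] [/= yx kx] yz; rewrite /cball/= in yx.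
  have h1 := lip k x y xz ltac:(lra); have h2 := flip x y xz yz ltac:(lra).
  have h3 : L * cmod (y - x) <= L * b by rewrite ler_pM2l// ltW.
  have := cmod_triangle (h k x) (h k y) (f y); have := cmod_triangle (f x) (h k x) (f y).
  by rewrite (cmodB (f x) (f y)); lra.
have [psi psiS psiP] : exists2 psi : nat -> nat, (forall k, (psi k < psi k.+1)%N) &
    forall m, forall y, cmod (y - z) <= d -> cmod (h (psi m) y - f y) < m.+1%:R^-1.
  apply: (@subsequence (fun m k => forall y, cmod (y - z) <= d -> cmod (h k y - f y) < m.+1%:R^-1)).
  move=> m k0; have m0 : 0 < m.+1%:R^-1 :> R by rewrite invr_gt0.
  have k0U : UF [set k | (k0 <= k)%N] by apply: UFinf; exists k0.
  have /filter_ex[k [k0k kP]] : UF ([set k | (k0 <= k)%N] `&`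
      [set k | forall y, cmod (y - z) <= d -> cmod (h k y - f y) < m.+1%:R^-1]).
    by apply: filterI => //; exact: unif.
  by exists k.
exists psi, (Some \o f); split=> // K cK KU eps eps0.
exists (Num.truncn (2 / eps)).+1 => k Nk y Ky.
have yz : cmod (y - z) <= d by apply: ltW; exact: KU.
apply: le_lt_trans (chordal_le _ _) _.
have kp := psiP k y yz; rewrite /comp.
have : 2 / eps < k.+1%:R.
  apply: lt_le_trans (truncnS_gt _) _; rewrite ler_nat; exact: leqW.
rewrite ltr_pdivrMr// => ke.
move: kp; rewrite -[X in _ < X]mul1r ltr_pdivlMr// => kp.
have := ltr0Sn R k; nra.
Qed.

(** From here on normality is replaced by the topological boundary of the filled set. *)
Lemma juliaE : julia w = filled rho w `&` closure (~` filled rho w).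
Proof.
apply/seteqP; split=> [z Jz|z [Kz clz]]; last exact: boundary_julia.
split; first exact: julia_filled.
move=> B zB; apply: contrapT => nB; apply: interior_not_julia Jz.
apply: filterS zB => y By; apply: contrapT => nKy; apply: nB; exists y; split=> //.
Qed.

End Filled.
End Normality.

(** * Connectedness of Julia sets *)

Section FilledTopology.
Variable R : realType.
Implicit Types (x y z : C R) (w u : nat -> C R) (X D : set (C R)).

Definition locally_constant X (Y : set (C R)) := forall z, X z ->
  exists2 d : R, 0 < d & forall z', X z' -> cmod (z' - z) < d -> (Y z' <-> Y z).

Lemma connected_lcP X : connected X <->
  forall Y, Y `<=` X -> Y !=set0 -> locally_constant X Y -> Y = X.
Proof.
split=> [cX Y YX Y0 lY|h B B0 [V oV BV] [V' cV' BV']]; first exact: connected_locally lY.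
apply: h => //; first by rewrite BV => z [].
move=> z Xz; have [Bz|nBz] := pselect (B z).
  have Vz : V z by move: Bz; rewrite BV => -[].
  have /open_cballP/(_ z Vz)[d d0 dV] := oV.
  by exists d => // z' Xz' z'z; split=> // _; rewrite BV; split=> //; exact: dV.
have nVz : (~` V') z by move=> Vz; apply: nBz; rewrite BV'.
have /open_cballP/(_ z nVz)[d d0 dV] := closed_openC cV'.
exists d => // z' Xz' z'z; split=> // Bz'; exfalso.
by apply: (dV z' z'z); move: Bz'; rewrite BV' => -[].
Qed.

Lemma locally_constantC X Y : locally_constant X Y -> locally_constant X (X `\` Y).
Proof.
move=> lY z Xz; have [d d0 zd] := lY z Xz; exists d => // z' Xz' z'z.
have [h1 h2] := zd z' Xz' z'z.
by split=> -[_ nY]; split=> // ?; apply: nY; [exact: h2|exact: h1].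
Qed.

Lemma locally_constant_sub X X' Y : X' `<=` X -> locally_constant X Y ->
  locally_constant X' (X' `&` Y).
Proof.
move=> XX lY z Xz; have [d d0 zd] := lY z (XX _ Xz); exists d => // z' Xz' z'z.
have [h1 h2] := zd z' (XX _ Xz') z'z.
by split=> -[_ Yz]; split=> //; [exact: h1|exact: h2].
Qed.

Lemma nested_compact (E : nat -> set (C R)) : compact (E 0%N) ->
  (forall n, closed (E n)) -> (forall n, E n !=set0) ->
  (forall n, E n.+1 `<=` E n) -> exists z, forall n, E n z.
Proof.
move=> cE clE E0 ES.
have mono m n : (m <= n)%N -> E n `<=` E m.
  elim: n => [|n IH]; first by rewrite leqn0 => /eqP ->.
  rewrite leq_eqVlt => /predU1P[->//|mn]; exact: subset_trans (ES n) (IH mn).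
have /choice[x xE] : forall n, exists x, E n x by move=> n; exact: E0.
have FE n : (x @ \oo) (E n) by exists n => // k /= nk; exact: mono nk _ (xE k).
have [z [_ clz]] := cE (x @ \oo) _ (FE 0%N).
by exists z => n; apply: clE => B zB; exact: clz (FE n) zB.
Qed.

(** The two parts of a separation of the intersection have disjoint neighbourhoods; by compactness
    some [E n] lies in their union and is separated by them. *)
Lemma nested_connected (E : nat -> set (C R)) : (forall n, compact (E n)) ->
  (forall n, connected (E n)) -> (forall n, E n.+1 `<=` E n) ->
  connected [set z | forall n, E n z].
Proof.
move=> cE cnE ES; set K := [set z | forall n, E n z].
have clE n : closed (E n) by exact: compact_closed_C.
have clK : closed K.
  have -> : K = \bigcap_n E n by apply/seteqP; split=> z h n //; exact: h.
  by apply: closed_bigI => n _.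
move=> B [b Bb] [V oV BV] [V' cV' BV']; apply: contrapT => BK.
have [a [Ka nBa]] : exists a, K a /\ ~ B a.
  apply: contrapT => na; apply: BK; apply/seteqP; split=> [z|z Jz]; first by rewrite BV => -[].
  by apply: contrapT => nBz; apply: na; exists z.
pose A := K `&` ~` V.
have cA : closed A by apply: closedI => //; exact: open_closedC.
have clB : closed B by rewrite BV'; exact: closedI.
have KE : K `<=` E 0%N by move=> z; exact.
have cB : compact B.
  by apply: subclosed_compact clB (cE 0%N) _ => z; rewrite BV => -[/KE].
have AB : A `&` B = set0.
  by apply/seteqP; split=> // z [[_ nVz]]; rewrite BV => -[].
have [e e0 eAB] := compact_closed_dist cA cB AB.
pose N X := [set z | exists2 x, X x & cmod (z - x) < e / 2].
have oN X : open (N X).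
  apply/open_cballP => z [x Xx zx]; exists (e / 2 - cmod (z - x)); first by rewrite subr_gt0.
  by move=> y; rewrite /cball/= => yz; exists x => //; have := cmod_triangle z y x; lra.
have NAB z : N A z -> N B z -> False.
  move=> [x Ax zx] [y By zy]; have := eAB x y Ax By; have := cmod_triangle z x y.
  by rewrite (cmodB x z); lra.
have sub X : X `<=` N X by move=> z Xz; exists z; rewrite // subrr cmod0; lra.
have [n nE] : exists n, E n `<=` N A `|` N B.
  apply: contrapT => nn.
  have [||||z zE] := @nested_compact (fun n => E n `&` ~` (N A `|` N B)).
  - apply: subclosed_compact (cE 0%N) _; last by move=> ? [].
    by apply: closedI => //; apply: open_closedC; exact: openU.
  - by move=> n; apply: closedI => //; apply: open_closedC; exact: openU.
  - move=> n; apply: contrapT => En; apply: nn; exists n => z Ez.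
    by apply: contrapT => nN; apply: En; exists z.
  - by move=> n z [/ES ? ?].
  have Kz : K z by move=> n; have [] := zE n.
  have [_] := zE 0%N; apply.
  have [Bz|nBz] := pselect (B z); first by right; exact: sub.
  by left; apply: sub; split=> // Vz; apply: nBz; rewrite BV.
have : E n `&` N B = E n.
  apply: cnE.
  - by exists b; split; [move: Bb; rewrite BV => -[]|exact: sub].
  - by exists (N B).
  exists (~` N A); first exact: open_closedC.
  apply/seteqP; split=> z [Ez Nz]; split=> //; first by move=> NAz; exact: NAB Nz.
  by have [//|] := nE z Ez.
move=> /seteqP[_ /(_ a (Ka n))[_ NBa]]; apply: NAB NBa; apply: sub; split=> // Va.
by apply: nBa; rewrite BV.
Qed.

(** For a locally constant part [Y] containing 0, the values all of whose preimages lie in [Y] form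
    a locally constant part of [D]. It contains [c], whose only preimage is 0, so it is all of
    [D]. *)
Lemma quad_preimage_connected D c : connected D -> D c -> connected (quad c @^-1` D).
Proof.
move=> cD Dc; set X := quad c @^-1` D.
have X0 : X 0 by rewrite /X /= /quad expr0n add0r.
suff H (Y : set (C R)) : Y `<=` X -> Y 0 -> locally_constant X Y -> Y = X.
  apply/connected_lcP => Y YX [y Yy] lY.
  have [Y0|nY0] := pselect (Y 0); first exact: H.
  have := H (X `\` Y) (@subDsetl _ _ _) (conj X0 nY0) (locally_constantC lY).
  by move=> /seteqP[_ /(_ y (YX _ Yy))[]].
move=> YX Y0 lY.
have root z : exists z0 : C R, quad c z0 = z.
  by exists (sqrtc (z - c : R[i])); rewrite /quad -[_ ^+ 2]/((sqrtc (z - c : R[i])) ^+ 2) sqr_sqrtc subrK.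
have rootP z z0 : quad c z = quad c z0 -> z = z0 \/ z = - z0.
  by move=> /addIr/eqP; rewrite eqf_sqr => /orP[]/eqP; [left|right].
have quadN z : quad c (- z) = quad c z by rewrite /quad sqrrN.
suff : [set s | D s /\ forall z, quad c z = s -> Y z] = D.
  move=> /seteqP[_ h]; apply/seteqP; split=> // z Xz.
  by have [_] := h _ Xz; exact.
apply: connected_locally => //; first by move=> ? [].
  exists c; split=> // z; rewrite /quad -[in RHS](add0r c) => /addIr/eqP.
  by rewrite expf_eq0 /= => /eqP ->.
move=> s Ds; have [z0 z0s] := root s.
have Xz0 : X z0 by rewrite /X /= z0s.
have XNz0 : X (- z0) by rewrite /X /= quadN z0s.
have [d1 d10 h1] := lY _ Xz0; have [d2 d20 h2] := lY _ XNz0.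
pose d := Num.min d1 d2; have d0 : 0 < d by rewrite lt_min d10.
have dd1 : d <= d1 by rewrite ge_min lexx.
have dd2 : d <= d2 by rewrite ge_min lexx orbT.
(* If [quad c z = t] then [t - s = (z - z0) * (z + z0)], so one of the two factors has modulus below
   [d]. *)
exists (d ^+ 2); first by rewrite exprn_gt0.
move=> t Dt ts.
have near z : quad c z = t -> cmod (z - z0) < d \/ cmod (z - - z0) < d.
  move=> zt; have E : t - s = (z - z0) * (z - - z0) by rewrite -zt -z0s /quad; ring.
  have [?|h] := ltP (cmod (z - z0)) d; first by left.
  have [?|h'] := ltP (cmod (z - - z0)) d; first by right.
  by move: ts; rewrite E cmodM ltNge expr2 ler_pM// ltW.
split=> -[_ SY]; split=> // z zE.
  have [y yt] := root t.
  have Yy : Y y by exact: SY.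
  have YNy : Y (- y) by apply: SY; rewrite quadN.
  have Xy : X y by exact: YX.
  have XNy : X (- y) by exact: YX.
  have Ncm a b : cmod (- a - b) = cmod (a - - b) by rewrite -cmodN opprD !opprK.
  have Yz0 : Y z0.
    have [yz|yz] := near y yt; first by apply: (h1 y Xy _).1 => //; lra.
    by apply: (h1 (- y) XNy _).1 => //; rewrite Ncm; lra.
  have YNz0 : Y (- z0).
    have [yz|yz] := near y yt; last by apply: (h2 y Xy _).1 => //; lra.
    by apply: (h2 (- y) XNy _).1 => //; rewrite Ncm opprK; lra.
  by have [->|->] := rootP z z0 ltac:(by rewrite zE z0s).
have Xz : X z by rewrite /X /= zE.
have [zz|zz] := near z zE.
  by apply: (h1 z Xz _).2; [lra|exact: SY].
by apply: (h2 z Xz _).2; [lra|apply: SY; rewrite quadN].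
Qed.

(** A locally constant part missing the exterior is bounded, and a maximum of [|p|] over its closure
    would be attained at an interior point, against [poly_open]. Thus every such part contains the
    connected exterior, and two complementary ones cannot both do so. *)
Lemma max_principle_connected X (rho : R) : 0 <= rho -> open X ->
  (forall z, rho < cmod z -> X z) ->
  (forall y, X y -> exists p : {poly R[i]}, [/\ (1 < size p)%N,
     rho < cmod (p.[y] : C R) & forall x, rho < cmod (p.[x] : C R) -> X x]) ->
  connected X.
Proof.
move=> rho0 oX extX pX; apply/connected_lcP => Y YX Y0 lY.
pose ext := [set z : C R | rho < cmod z].
have cext : connected ext by exact: exterior_connected.
have H (Z : set (C R)) : Z `<=` X -> Z !=set0 -> locally_constant X Z -> ext `<=` Z.
  move=> ZX [y Zy] lZ; suff [y' [ey' Zy']] : (ext `&` Z) !=set0.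
    have : ext `&` Z = ext.
      apply: connected_locally => //; first by exists y'.
      exact: locally_constant_sub lZ.
    by move=> /seteqP[_ h] z /h[].
  apply: contrapT => nZ.
  have Zr z : Z z -> cmod z <= rho.
    by move=> Zz; rewrite leNgt; apply/negP => rz; apply: nZ; exists z.
  have [p [p1 py pX']] := pX y (ZX _ Zy).
  have cZ : compact (closure Z).
    apply: (@bounded_closed_compact_C _ _ rho); first exact: closed_closure.
    have -> : [set z : C R | cmod z <= rho] = cdisk 0 rho.
      by apply/seteqP; split=> z; rewrite /cdisk/= subr0.
    rewrite (closure_id (cdisk 0 rho)).1; last exact: closed_cdisk.
    by apply: closure_subset => z /Zr; rewrite /cdisk/= subr0.
  have cp : continuous (fun z : C R => cmod (p.[z] : C R)).
    move=> z; apply: (@continuous_comp _ _ _ (fun z : C R => p.[z] : C R)).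
      by apply: polyfun_continuous; exists p.
    exact: continuous_cmod.
  have Z0 : closure Z !=set0 by exists y; exact: subset_closure.
  have [y1 /set_mem clZ1 y1M] := compact_EVT_max Z0 cZ (continuous_subspaceT cp).
  have py1 : rho < cmod (p.[y1] : C R).
    by apply: lt_le_trans py (y1M y (mem_set _)); exact: subset_closure.
  have Xy1 := pX' _ py1.
  have [d d0 dZ] := lZ _ Xy1.
  have Zy1 : Z y1.
    have [z [Zz zd]] := clZ1 _ (nbhs_cball y1 d0).
    by apply/(dZ z) => //; exact: ZX.
  have /open_cballP/(_ y1 Xy1)[d' d'0 dX] := oX.
  have m0 : 0 < Num.min d d' by rewrite lt_min d0.
  have [b b0 pb] := poly_open y1 p1 m0.
  have p0 : 0 < cmod (p.[y1] : C R) by exact: le_lt_trans rho0 py1.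
  pose t := b / (2 * cmod (p.[y1] : C R)).
  have t0 : 0 < t by rewrite divr_gt0// mulr_gt0.
  have [z zy pz] := pb ((1 + t)%:C%C * p.[y1]) ltac:(
    rewrite (_ : _ - _ = (t%:C%C : C R) * p.[y1]);
    [rewrite cmodM cmodR gtr0_norm// /t; rewrite invfM mulrA mulfVK ?gt_eqF//; lra
    | rewrite rmorphD /= rmorph1; ring]).
  move: zy; rewrite lt_min => /andP[zd zd'].
  have Zz : Z z by apply/(dZ z) => //; exact: dX.
  have : cmod (p.[z] : C R) <= cmod (p.[y1] : C R).
    by apply: y1M; apply: mem_set; exact: subset_closure.
  by rewrite pz cmodM cmodR gtr0_norm; nra.
apply/seteqP; split=> // x Xx; apply: contrapT => nYx.
have ext0 : ext (rho + 1)%:C%C by rewrite /ext/= cmodR ger0_norm; lra.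
have [//|_] := H (X `\` Y) (@subDsetl _ _ _) _ (locally_constantC lY) _ ext0.
  by exists x.
by apply; exact: H ext0.
Qed.

Section Filled.
Variables (rho : R).
Hypotheses (rho4 : 4 <= rho).

(** Non-constancy is read off from growth: outside the disc of radius [rho] the iterates do not
    decrease the modulus. *)
Lemma fiter_poly w n : pbound rho w ->
  exists2 p : {poly R[i]}, (1 < size p)%N & forall z, fiter w n z = p.[z].
Proof.
have r4 := rho4; move=> bw; have [p pE] := polyfun_fiter w n; exists p => //.
rewrite ltnNge; apply/negP => p1.
have big z : rho <= cmod z -> cmod z <= cmod (fiter w n z).
  move=> rz; elim: (n) => [//|k IH] /=.
  by have := quad_escape rho4 (bw k) (le_trans rz IH); have := cmod_ge0 (fiter w k z); lra.
pose z : C R := (rho + cmod (fiter w n 0) + 1)%:C%C.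
have cz : cmod z = rho + cmod (fiter w n 0) + 1.
  by rewrite cmodR ger0_norm//; have := cmod_ge0 (fiter w n 0); lra.
have := big z; rewrite cz => /(_ ltac:(have := cmod_ge0 (fiter w n 0); lra)).
have -> : fiter w n z = fiter w n 0 by rewrite !pE (size1_polyC p1) !hornerC.
lra.
Qed.

Definition level w n : set (C R) := [set z | cmod (fiter w n z) <= rho].

Lemma level_closed w n : closed (level w n).
Proof.
have -> : level w n = fiter w n @^-1` cdisk 0 rho.
  by apply/seteqP; split=> z; rewrite /level /cdisk/= subr0.
apply: closed_comp => [z _|]; first exact: cont_fiter.
exact: closed_cdisk.
Qed.

Lemma level_le w m n : pbound rho w -> (m <= n)%N -> level w n `<=` level w m.
Proof. by move=> bw mn z; exact: fiter_stay. Qed.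

Lemma level_compact w n : pbound rho w -> compact (level w n).
Proof.
move=> bw; apply: (@bounded_closed_compact_C _ _ rho (@level_closed w n)).
by move=> z /(level_le bw (leq0n n)); exact: id.
Qed.

Lemma filledE w : filled rho w = [set z | forall n, level w n z].
Proof. by []. Qed.

Lemma level_nonempty w n : level w n !=set0.
Proof.
suff [z zn] : exists z, fiter w n z = 0.
  by exists z; rewrite /level/= zn cmod0; have := rho4; lra.
elim: n w => [|n IH] w; first by exists 0.
have [y yn] := IH (sshift 1 w); exists (sqrtc (y - w 0%N : R[i])).
rewrite fiter_front -yn; congr fiter.
by rewrite /quad -[_ ^+ 2]/((sqrtc (y - w 0%N : R[i])) ^+ 2) sqr_sqrtc subrK.
Qed.

Lemma filled_nonempty w : pbound rho w -> filled rho w !=set0.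
Proof.
move=> bw; apply: (@nested_compact (level w)).
- exact: level_compact.
- exact: level_closed.
- exact: level_nonempty.
- by move=> n; exact: level_le.
Qed.

Lemma setC_level_connected w n : pbound rho w -> connected (~` level w n).
Proof.
have r4 := rho4; move=> bw; apply: (@max_principle_connected _ rho); first by lra.
- exact: closed_openC (@level_closed w n).
- by move=> z rz /(level_le bw (leq0n n)); rewrite /level/= leNgt rz.
move=> y ny; have [p p1 pE] := fiter_poly n bw; exists p; split=> //.
  by rewrite -pE ltNge; apply/negP.
by move=> x; rewrite -pE ltNge => /negP.
Qed.

Lemma setC_filled_connected w : pbound rho w -> connected (~` filled rho w).
Proof.
have r4 := rho4; move=> bw; apply: (@max_principle_connected _ rho); first by lra.
- exact: closed_openC (@filled_closed _ _ w).
- by move=> z rz /(_ 0%N); rewrite leNgt rz.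
move=> y /(nfilled bw)[m my]; have [p p1 pE] := fiter_poly m bw; exists p; split=> //.
  by rewrite -pE.
by move=> x; rewrite -pE => h /(_ m); rewrite leNgt h.
Qed.

(** Levels are pulled back one parameter at a time, so the critical value of each step must lie in
    the level of the remaining sequence. Hence the hypothesis on all shifts. *)
Lemma filled_connected w : pbound rho w ->
  (forall j, filled rho (sshift j w) 0) -> connected (filled rho w).
Proof.
move=> bw crit; rewrite filledE.
have cn n : connected (level w n).
  elim: n w bw crit => [|n IH] {}w bw crit.
    have -> : level w 0 = cdisk 0 rho by apply/seteqP; split=> z; rewrite /level /cdisk/= subr0.
    by apply: cdisk_connected; have := rho4; lra.
  have -> : level w n.+1 = quad (w 0%N) @^-1` level (sshift 1 w) n.
    by apply/seteqP; split=> z; rewrite /level /= -fiter_front.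
  apply: quad_preimage_connected.
    by apply: IH => [|j]; [exact: pbound_sshift|rewrite sshift_sshift; exact: crit].
  have := crit 0%N n.+1; rewrite sshift0 fiter_front /level/=.
  by rewrite /quad expr0n add0r.
apply: nested_connected => // n; first exact: level_compact.
exact: level_le.
Qed.

Lemma julia_connected w : pbound rho w ->
  (forall j, filled rho (sshift j w) 0) -> connected (julia w).
Proof.
move=> bw crit; rewrite (juliaE rho4 bw).
apply: (@unicoherent_C _ _ _ rho).
- exact: filled_closed.
- exact: closed_closure.
- exact: filled_connected.
- exact/connected_closure/setC_filled_connected.
- apply/seteqP; split=> // z _; have [|nK] := pselect (filled rho w z); first by left.
  by right; exact: subset_closure.
by move=> z /(_ 0%N); rewrite /cdisk/= subr0.
Qed.

Lemma filledN w z : filled rho w z -> filled rho w (- z).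
Proof.
move=> Kz [|n]; last by rewrite fiterN; exact: Kz.
by have := Kz 0%N; rewrite /= cmodN.
Qed.

Lemma juliaN w z : pbound rho w -> julia w z -> julia w (- z).
Proof.
move=> bw; rewrite (juliaE rho4 bw) => -[Kz clz]; split; first exact: filledN.
move=> B /nbhs_cballP[e e0 eB]; have [y [nKy yz]] := clz _ (nbhs_cball z e0).
exists (- y); split; first by move=> /filledN; rewrite opprK.
by apply: eB; rewrite /cball/= -cmodN opprB opprK addrC -[X in cmod X]opprB opprB.
Qed.

Lemma julia_extreme w x : pbound rho w -> filled rho w x ->
  exists2 z, julia w z & cmod x <= cmod z.
Proof.
move=> bw Kx; have K0 : filled rho w !=set0 by exists x.
have [z] := compact_EVT_max K0 (@filled_compact _ rho w) (continuous_subspaceT (@continuous_cmod R)).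
move=> /set_mem Kz zM; exists z; last exact/zM/mem_set.
rewrite (juliaE rho4 bw); split=> // B /nbhs_cballP[e e0 eB].
have [y yz] : exists2 y, cmod (y - z) < e & cmod z < cmod y.
  have [->|z0] := eqVneq z 0.
    exists (e / 2)%:C%C; rewrite ?subr0 ?cmod0 cmodR gtr0_norm//; lra.
  have cz := cmod_gt0 z0.
  pose k := e / 2 / cmod z; have k0 : 0 < k by rewrite divr_gt0//; lra.
  have kz : k * cmod z = e / 2 by rewrite /k mulfVK// gt_eqF.
  exists ((1 + k)%:C%C * z).
    have -> : (1 + k)%:C%C * z - z = k%:C%C * z by rewrite rmorphD rmorph1; ring.
    by rewrite cmodM cmodR gtr0_norm// kz; lra.
  by rewrite cmodM cmodR gtr0_norm; [rewrite mulrDl mul1r kz|]; lra.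
move=> zy; exists y; split; last exact: eB.
by move=> Ky; move: zy; rewrite ltNge zM//; exact: mem_set.
Qed.

Lemma julia_nonempty w : pbound rho w -> julia w !=set0.
Proof.
by move=> bw; have [x Kx] := filled_nonempty bw; have [z Jz _] := julia_extreme bw Kx; exists z.
Qed.

Lemma julia_disconnected w : pbound rho w -> ~ filled rho w 0 -> ~ connected (julia w).
Proof.
move=> bw nK0 cJ.
have bw1 := pbound_sshift 1 bw.
have nKc : ~ filled rho (sshift 1 w) (w 0%N).
  move=> h; apply: nK0; apply/(filled_front rho4 _ bw).
  by rewrite /quad expr0n add0r.
have [s cs sE] := sqrt_off_compact (@filled_compact _ rho (sshift 1 w))
  (setC_filled_connected bw1) nKc.
have JK := julia_filled rho4 bw.
have KK z : filled rho w z -> filled rho (sshift 1 w) (quad (w 0%N) z).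
  by move/(filled_front rho4 _ bw).
have cq : cont_on (julia w) (fun z => s (quad (w 0%N) z)).
  move=> z Jz e e0; have [d d0 sd] := cs _ (KK _ (JK _ Jz)) e e0.
  have cquad : continuous (quad (w 0%N)) := polyfun_continuous (polyfun_quad _).
  have /continuous_cmodP/(_ z _ d0)[d' d'0 qd] := cquad.
  by exists d' => // y Jy yz; apply: sd; [exact/KK/JK|exact: qd].
have cid : cont_on (julia w) (fun z => z) by move=> z _ e e0; exists e.
have sq z : julia w z -> z ^+ 2 = s (quad (w 0%N) z) ^+ 2.
  by move=> Jz; rewrite sE ?/quad ?addrK//; exact/KK/JK.
have J0 z : julia w z -> z != 0 by move=> Jz; apply: contra_notN nK0 => /eqP <-; exact: JK.
have s0 z : julia w z -> s (quad (w 0%N) z) != 0.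
  by move=> Jz; rewrite -sqrf_eq0 -sq// sqrf_eq0 J0.
have [z Jz] := julia_nonempty bw; have JNz := juliaN bw Jz.
have qN : quad (w 0%N) (- z) = quad (w 0%N) z by rewrite /quad sqrrN.
(* The root [s (quad (w 0) z)] is the same at [z] and [- z], while on a connected Julia set it would
   agree up to a constant sign with the identity. *)
have zN : z = - z.
  have [h|h] := connected_sign cJ cid cq sq s0; have := h _ JNz; rewrite qN => ->.
    exact: h.
  exact: h.
by move/eqP: zN; rewrite -subr_eq0 opprK -mulr2n mulrn_eq0 /= (negbTE (J0 z Jz)).
Qed.

End Filled.
End FilledTopology.

(** * Random parameters *)

Section Measurability.
Variable R : realType.
Implicit Types (x y z : C R) (w u : nat -> C R).

(** [<<s cyls n >>] collects the events decided by the first [n] parameters; independence is stated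
    relative to it. *)
Definition cyls (n : nat) : set (set (nat -> C R)) :=
  [set X | exists A : nat -> set (C R), (forall i, cmeasurable (A i)) /\ X = cyl n A].

Notation T n := (g_sigma_algebraType (cyls n)).

Lemma cmeasurableT : cmeasurable [set: C R].
Proof. by rewrite /cmeasurable preimage_setT; exact: measurableT. Qed.

Lemma cmeasurableI (A B : set (C R)) : cmeasurable A -> cmeasurable B ->
  cmeasurable (A `&` B).
Proof. by move=> mA mB; rewrite /cmeasurable preimage_setI; exact: measurableI. Qed.

Lemma cyls_coord n i (B : set (C R)) : (i < n)%N -> cmeasurable B ->
  cyls n [set w | B (w i)].
Proof.
move=> ni mB; exists (fun j => if j == i then B else setT); split=> [j|].
  by case: ifP => // _; exact: cmeasurableT.
apply/seteqP; split=> w /= h; last by have := h i ni; rewrite eqxx.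
by move=> j _; case: eqP => // ->.
Qed.

Lemma measurable_level d (X : measurableType d) (f : X -> R) (e : R) :
  measurable_fun setT f -> measurable [set t | f t <= e].
Proof.
move=> mf; have := mf measurableT `]-oo, e]%classic (measurable_itv _).
by rewrite setTI; congr measurable; apply/seteqP; split=> t /=; rewrite in_itv.
Qed.

Lemma measurable_level_lt d (X : measurableType d) (f : X -> R) (e : R) :
  measurable_fun setT f -> measurable [set t | f t < e].
Proof.
move=> mf; have := mf measurableT `]-oo, e[%classic (measurable_itv _).
by rewrite setTI; congr measurable; apply/seteqP; split=> t /=; rewrite in_itv.
Qed.

Lemma measurable_cmod d (X : measurableType d) (f : X -> C R) :
  measurable_fun setT (fun t => complex.Re (f t) : R) ->
  measurable_fun setT (fun t => complex.Im (f t) : R) ->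
  forall v, measurable_fun setT (fun t => cmod (f t - v)).
Proof.
move=> mR mI v.
pose g t := (complex.Re (f t) - complex.Re v) ^+ 2 + (complex.Im (f t) - complex.Im v) ^+ 2.
have -> : (fun t => cmod (f t - v)) = Num.sqrt \o g.
  by apply/funext => t; rewrite /g /cmod /=; case: (f t) => a b; case: (v).
apply: measurableT_comp; first exact: measurable_realfun.continuous_measurable_fun (@sqrt_continuous R).
by apply: measurable_funD; apply: measurable_funX; apply: measurable_funB.
Qed.

Lemma measurable_toC_Re : measurable_fun setT (fun p : R * R => complex.Re (toC p) : R).
Proof. exact: measurable_fst. Qed.

Lemma measurable_toC_Im : measurable_fun setT (fun p : R * R => complex.Im (toC p) : R).
Proof. exact: measurable_snd. Qed.

Lemma cmeasurable_cdisk z (e : R) : cmeasurable (cdisk z e).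
Proof. exact: measurable_level (measurable_cmod measurable_toC_Re measurable_toC_Im z). Qed.

Lemma cmeasurable_cball z (e : R) : cmeasurable (cball z e).
Proof. exact: measurable_level_lt (measurable_cmod measurable_toC_Re measurable_toC_Im z). Qed.

Lemma measurable_coord_Re n i : (i < n)%N ->
  measurable_fun setT (fun w : T n => complex.Re (w i) : R).
Proof.
move=> ni _ Y mY; rewrite setTI; apply: sub_sigma_algebra.
apply: (cyls_coord (B := [set z | Y (complex.Re z)]) ni).
by have := measurable_toC_Re measurableT mY; rewrite setTI.
Qed.

Lemma measurable_coord_Im n i : (i < n)%N ->
  measurable_fun setT (fun w : T n => complex.Im (w i) : R).
Proof.
move=> ni _ Y mY; rewrite setTI; apply: sub_sigma_algebra.
apply: (cyls_coord (B := [set z | Y (complex.Im z)]) ni).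
by have := measurable_toC_Im measurableT mY; rewrite setTI.
Qed.

Lemma measurable_fiter n j k z : (j + k <= n)%N ->
  measurable_fun setT (fun w : T n => complex.Re (fiter (sshift j w) k z) : R) /\
  measurable_fun setT (fun w : T n => complex.Im (fiter (sshift j w) k z) : R).
Proof.
elim: k => [|k IH] jkn; first by split; exact: measurable_cst.
have jk : (j + k < n)%N by rewrite -addnS.
have [mR mI] := IH (ltnW jk); split.
- have -> : (fun w : T n => complex.Re (fiter (sshift j w) k.+1 z) : R) =
    (fun w : T n => (complex.Re (fiter (sshift j w) k z) * complex.Re (fiter (sshift j w) k z) -
       complex.Im (fiter (sshift j w) k z) * complex.Im (fiter (sshift j w) k z)) +
       complex.Re (w (j + k)%N)).
    apply/funext => w /=; rewrite /quad /sshift expr2.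
    by case: (fiter _ _ _) => a b; case: (w _).
  apply: measurable_funD; last exact: measurable_coord_Re.
  by apply: measurable_funB; apply: measurable_funM.
- have -> : (fun w : T n => complex.Im (fiter (sshift j w) k.+1 z) : R) =
    (fun w : T n => (complex.Re (fiter (sshift j w) k z) * complex.Im (fiter (sshift j w) k z) +
       complex.Im (fiter (sshift j w) k z) * complex.Re (fiter (sshift j w) k z)) +
       complex.Im (w (j + k)%N)).
    apply/funext => w /=; rewrite /quad /sshift expr2.
    by case: (fiter _ _ _) => a b; case: (w _).
  apply: measurable_funD; last exact: measurable_coord_Im.
  by apply: measurable_funD; apply: measurable_funM.
Qed.

Lemma fiter_le_cyls n j k z v (e : R) : (j + k <= n)%N ->
  <<s cyls n >> [set w | cmod (fiter (sshift j w) k z - v) <= e].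
Proof.
move=> jkn; have [mR mI] := measurable_fiter z jkn.
exact: (@measurable_level _ (T n) _ e (measurable_cmod mR mI v)).
Qed.

Lemma fiter_lt_cyls n j k z v (e : R) : (j + k <= n)%N ->
  <<s cyls n >> [set w | cmod (fiter (sshift j w) k z - v) < e].
Proof.
move=> jkn; have [mR mI] := measurable_fiter z jkn.
exact: (@measurable_level_lt _ (T n) _ e (measurable_cmod mR mI v)).
Qed.

Lemma cylsI n (A B : set (nat -> C R)) : <<s cyls n >> A -> <<s cyls n >> B ->
  <<s cyls n >> (A `&` B).
Proof. exact: (@measurableI _ (T n)). Qed.

Lemma cylsD n (A B : set (nat -> C R)) : <<s cyls n >> A -> <<s cyls n >> B ->
  <<s cyls n >> (A `\` B).
Proof. exact: (@measurableD _ (T n)). Qed.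

Lemma cyls_measurable n (A : set (nat -> C R)) : <<s cyls n >> A ->
  measurable (A : set (Omega R)).
Proof.
apply: smallest_sub; first exact: smallest_sigma_algebra.
by move=> X [B [mB XB]]; apply: sub_sigma_algebra; exists n, B.
Qed.

Lemma cyl_cyls n (A : nat -> set (C R)) : (forall i, cmeasurable (A i)) ->
  <<s cyls n >> (cyl n A).
Proof. by move=> mA; apply: sub_sigma_algebra; exists A. Qed.

End Measurability.

(** * The product measure and independence *)

Section ProductMeasure.
Variables (R : realType) (c : C R) (r : R) (P : probability (Omega R) R).
Hypotheses (r_gt0 : 0 < r) (HP : is_product_measure c r P).
Implicit Types (X Y : set (Omega R)) (A B : nat -> set (C R)) (S : set (C R)).

Definition pr X : R := fine (P X).
Definition mval S : R := fine (mu c r S).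

Lemma prE X : measurable X -> P X = (pr X)%:E.
Proof. by move=> mX; rewrite fineK// fin_num_measure. Qed.

Lemma pr_ge0 X : 0 <= pr X.
Proof. exact: fine_ge0. Qed.

Lemma pr_le X Y : measurable X -> measurable Y -> X `<=` Y -> pr X <= pr Y.
Proof.
by move=> mX mY XY; rewrite -lee_fin -!prE// le_measure ?inE.
Qed.

Lemma pr_le1 X : measurable X -> pr X <= 1.
Proof. by move=> mX; rewrite -lee_fin -prE// probability_le1. Qed.

Lemma prT : pr setT = 1.
Proof. by rewrite /pr probability_setT. Qed.

Lemma prDI X Y : measurable X -> measurable Y -> pr X = pr (X `\` Y) + pr (X `&` Y).
Proof.
move=> mX mY; apply: EFin_inj.
have mD := measurableD mX mY; have mI := measurableI _ _ mX mY.
by rewrite EFinD -(prE mX) -(prE mD) -(prE mI) -measureDI.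
Qed.

Lemma prU_le X Y : measurable X -> measurable Y -> pr (X `|` Y) <= pr X + pr Y.
Proof.
move=> mX mY; have mXY := measurableU _ _ mX mY.
rewrite (prDI mXY mX) addrC lerD//; apply: pr_le => //.
- exact: measurableI.
- exact: measurableD.
by move=> w [[]].
Qed.

Lemma muE S : mu c r S = (mval S)%:E.
Proof. by rewrite /mval /mu gt_eqF. Qed.

Lemma pr_cyl n A : (forall i, cmeasurable (A i)) ->
  pr (cyl n A) = \prod_(i < n) mval (A i).
Proof.
move=> mA; rewrite /pr HP//.
have -> : (\prod_(i < n) mu c r (A i) = (\prod_(i < n) mval (A i))%:E)%E; last by [].
apply: (big_ind2 (fun (a : \bar R) b => a = b%:E)) => //.
  by move=> a b a' b' -> ->; rewrite EFinM.
by move=> i _; exact: muE.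
Qed.

Lemma mval_pr S : cmeasurable S -> mval S = pr (cyl 1 (fun=> S)).
Proof. by move=> mS; rewrite pr_cyl// big_ord1. Qed.

Lemma measurable_cyl n A : (forall i, cmeasurable (A i)) ->
  measurable (cyl n A : set (Omega R)).
Proof. by move=> mA; exact: (cyls_measurable (@cyl_cyls _ n A mA)). Qed.

Lemma mval_ge0 S : cmeasurable S -> 0 <= mval S.
Proof. by move=> mS; rewrite mval_pr// pr_ge0. Qed.

Lemma mvalT : mval setT = 1.
Proof.
rewrite mval_pr; last exact: cmeasurableT.
by rewrite -prT; congr pr; apply/seteqP; split=> // w _ i.
Qed.

Lemma mval_cdisk : mval (cdisk c r) = 1.
Proof. by rewrite -mvalT /mval /mu gt_eqF// setTI setIid. Qed.

Lemma mval_square S (a b s : R) : cmeasurable S -> 0 < s ->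
  (forall y : C R, a <= complex.Re y <= a + s -> b <= complex.Im y <= b + s ->
     S y /\ cdisk c r y) -> 0 < mval S.
Proof.
move=> mS s0 sq.
(* The area of the disc is never computed. As division by 0 gives 0 and [fine] sends infinity to 0,
   a quotient equal to 1 shows the area to be non-zero and finite. *)
have D1 : fine (leb2 (cdisk c r)) / fine (leb2 (cdisk c r)) = 1.
  by have := mvalT; rewrite /mval /mu gt_eqF// setTI.
have D0 : fine (leb2 (cdisk c r)) != 0.
  by apply: contra_eq_neq D1 => ->; rewrite mul0r eq_sym oner_neq0.
have Dfin : leb2 (cdisk c r) \is a fin_num.
  by move: D0; case: (leb2 _) => // /=; rewrite eqxx.
have mD := cmeasurable_cdisk c r.
have mSD : measurable (@toC R @^-1` (S `&` cdisk c r)) by exact: cmeasurableI.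
pose L := ((@lebesgue_measure R) \x (@lebesgue_measure R))%E.
have L0 Q : (0 <= L Q)%E by exact: measure_ge0.
have leS : (leb2 (S `&` cdisk c r) <= leb2 (cdisk c r))%E.
  by apply: (@le_measure _ _ _ L); rewrite ?inE// => p [].
have geS : ((s * s)%:E <= leb2 (S `&` cdisk c r))%E.
  have mQ : measurable (`[a, a + s]%classic `*` `[b, b + s]%classic : set (R * R)).
    exact: measurableX.
  have -> : (s * s)%:E = L (`[a, a + s]%classic `*` `[b, b + s]%classic).
    rewrite /L product_measure1E//= !lebesgue_measure_itv /= !lte_fin !ltrDl s0.
    by rewrite -!EFinB -EFinM; congr EFin; ring.
  apply: (@le_measure _ _ _ L); rewrite ?inE// => -[x y] [/= xs ys].
  by apply: sq => /=; [move: xs|move: ys]; rewrite in_itv.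
have D0' : 0 < fine (leb2 (cdisk c r)).
  by rewrite lt_neqAle eq_sym D0 /=; apply: fine_ge0; exact: L0.
have SDfin : leb2 (S `&` cdisk c r) \is a fin_num.
  rewrite ge0_fin_numE; last exact: L0.
  by apply: le_lt_trans leS _; rewrite ltey_eq Dfin.
rewrite /mval /mu gt_eqF//= divr_gt0//.
apply: (@lt_le_trans _ _ (s * s)); first by rewrite mulr_gt0.
by rewrite -lee_fin fineK.
Qed.

Lemma mval_cdisk_cball z (d : R) : cdisk c r z -> 0 < d ->
  0 < mval (cdisk c r `&` cball z d).
Proof.
have r0 := r_gt0; move=> zr d0; rewrite /cdisk/= in zr.
pose k := Num.min (1 / 2) (d / (4 * r)).
have k0 : 0 < k by rewrite lt_min; apply/andP; split; [lra|rewrite divr_gt0//; lra].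
have k1 : k <= 1 / 2 by rewrite ge_min lexx.
have kr : 4 * (k * r) <= d.
  have : k <= d / (4 * r) by rewrite ge_min lexx orbT.
  by rewrite ler_pdivlMr; [lra|lra].
have kr0 : 0 < k * r by rewrite mulr_gt0.
(* [z] may lie on the boundary circle; moved towards [c] by at most [k * r], it leaves room for a
   square of side [s] inside both discs. *)
pose p : C R := c + (1 - k)%:C%C * (z - c).
pose s := k * r / 4.
apply: (@mval_square _ (complex.Re p) (complex.Im p) s).
- by apply: cmeasurableI; [exact: cmeasurable_cdisk|exact: cmeasurable_cball].
- by rewrite /s; lra.
move=> y /andP[y1 y2] /andP[y3 y4].
have yp : cmod (y - p) <= k * r / 2.
  apply: le_trans (cmod_le_ReIm _) _.
  have -> : complex.Re (y - p) = complex.Re y - complex.Re p by case: (y); case: (p).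
  have -> : complex.Im (y - p) = complex.Im y - complex.Im p by case: (y); case: (p).
  by rewrite !ger0_norm ?subr_ge0//; rewrite /s in y2 y4; lra.
have pc : cmod (p - c) <= (1 - k) * r.
  rewrite /p addrC addKr cmodM cmodR ger0_norm; last by lra.
  by rewrite ler_wpM2l//; lra.
have pz : cmod (p - z) <= k * r.
  have -> : p - z = - (k%:C%C * (z - c)) by rewrite /p rmorphB rmorph1; ring.
  by rewrite cmodN cmodM cmodR gtr0_norm// ler_pM2l.
have yc : cdisk c r y by rewrite /cdisk/=; have := cmod_triangle p y c; lra.
split=> //; split=> //; rewrite /cball/=; have := cmod_triangle p y z; lra.
Qed.

(** Both sides are finite measures in [X], and they agree on the cylinders over the first [n]
    parameters, a generating family stable under intersection. *)
Lemma independence n N A X : (forall i, cmeasurable (A i)) -> <<s cyls n >> X ->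
  pr (X `&` [set w : Omega R | forall i, (i < N)%N -> A i (w (n + i)%N)]) =
  pr X * \prod_(i < N) mval (A i).
Proof.
move=> mA mX; set D := [set w | _].
pose A' := fun i => if (i < n)%N then setT else A (i - n)%N.
have mA' i : cmeasurable (A' i) by rewrite /A'; case: ifP => // _; exact: cmeasurableT.
have DE : D = cyl (n + N) A'.
  apply/seteqP; split=> w h i iN.
    rewrite /A'; case: ltnP => // ni; have := h (i - n)%N; rewrite subnKC//.
    by apply; rewrite ltn_subLR.
  by have := h (n + i)%N; rewrite /A' ltn_add2l (ltnNge (n + _) n) leq_addr /= addKn; exact.
have mD : measurable (D : set (Omega R)) by rewrite DE; exact: measurable_cyl.
pose k := \prod_(i < N) mval (A i).
have k0 : 0 <= k by apply: prodr_ge0 => i _; exact: mval_ge0.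
pose m1 : {measure set (Omega R) -> \bar R} := mrestr P mD.
pose m2 : {measure set (Omega R) -> \bar R} := mscale (NngNum k0) P.
have HE (E : set (Omega R)) : <<s cyls n >> E -> m1 E = m2 E.
  apply: (@g_sigma_algebra_measure_unique _ _ (Omega R) (@cyls R n) _ (fun=> setT) _ _ m1 m2).
  - by move=> Y [B [mB ->]]; exact: measurable_cyl.
  - move=> _; exists (fun=> setT); split=> [_|]; first exact: cmeasurableT.
    by apply/seteqP; split=> // w _ i.
  - by apply/seteqP; split=> // w _; exists 0%N.
  - move=> _ _ [B1 [mB1 ->]] [B2 [mB2 ->]]; exists (fun i => B1 i `&` B2 i); split.
      by move=> i; exact: cmeasurableI.
    by apply/seteqP; split=> [w [h1 h2] i ni|w h]; [split; [exact: h1|exact: h2]|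
      split=> i /h[]].
  - move=> _ [B [mB ->]]; rewrite /m1 /m2 /= /mrestr /mscale /=.
    pose B' := fun i => if (i < n)%N then B i else A (i - n)%N.
    have mB' i : cmeasurable (B' i) by rewrite /B'; case: ifP.
    have -> : cyl n B `&` D = cyl (n + N) B'.
      apply/seteqP; split=> [w [h1 h2] i iN|w h].
        rewrite /B'; case: ltnP => ni; first exact: h1.
        by have := h2 (i - n)%N; rewrite subnKC//; apply; rewrite ltn_subLR.
      split=> i iN; first by have := h i; rewrite /B' iN; apply; rewrite (leq_trans iN) ?leq_addr.
      by have := h (n + i)%N; rewrite /B' ltn_add2l (ltnNge (n + _) n) leq_addr /= addKn; exact.
    rewrite !prE; [|exact: measurable_cyl|exact: measurable_cyl].
    rewrite -EFinM; congr EFin; rewrite !pr_cyl// big_split_ord /= mulrC; congr (_ * _).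
      by apply: eq_bigr => i _; rewrite /B' ltnNge leq_addr /= addKn.
    by apply: eq_bigr => i _; rewrite /B' ltn_ord.
  - move=> _; rewrite /m1 /= /mrestr setTI; apply: le_lt_trans (probability_le1 P mD) _.
    exact: ltry.
have mX' := cyls_measurable mX.
have := HE X mX; rewrite /m1 /m2 /= /mrestr /mscale /= !prE//; last exact: measurableI.
by rewrite -EFinM mulrC; apply: EFin_inj.
Qed.

(* The regions [V i] depend on the first [n] parameters only, and each has its
   own block of the next [N] parameters that excludes [B]. *)
Lemma block_bound n N (I : eqType) (s : seq I) (V : I -> set (Omega R))
  (A : I -> nat -> set (C R)) (eta : R) (B X : set (Omega R)) :
  (forall i j, cmeasurable (A i j)) ->
  (forall i, i \in s -> <<s cyls n >> (V i)) -> measurable B ->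
  (forall i w, i \in s -> V i w -> (forall j, (j < N)%N -> A i j (w (n + j)%N)) -> ~ B w) ->
  (forall i, i \in s -> eta <= \prod_(j < N) mval (A i j)) ->
  <<s cyls n >> X -> (forall w, X w -> exists2 i, i \in s & V i w) ->
  pr (X `&` B) <= (1 - eta) * pr X.
Proof.
move=> mA; elim: s X => [|i s IH] X mV mB VB etaA mX XV.
  have -> : X = set0 by apply/seteqP; split=> // w /XV[].
  by rewrite set0I /pr measure0 mulr0.
have mVi : <<s cyls n >> (V i) by apply: mV; exact: mem_head.
have mX' := cyls_measurable mX; have mVi' := cyls_measurable mVi.
have mXV := cylsI mX mVi; have mXV' := cyls_measurable mXV.
have mXD := cylsD mX mVi; have mXD' := cyls_measurable mXD.
have mXB : measurable (X `&` B) by exact: measurableI.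
(* Cutting [X] along [V i] makes the possibly overlapping regions disjoint. *)
rewrite (prDI mXB mVi') (prDI mX' mVi') mulrDr; apply: lerD.
  have -> : (X `&` B) `\` V i = (X `\` V i) `&` B.
    by apply/seteqP; split=> [w [[]]|w [[]]].
  apply: IH => //.
  - by move=> j js; apply: mV; rewrite inE js orbT.
  - by move=> j w js; apply: VB; rewrite inE js orbT.
  - by move=> j js; apply: etaA; rewrite inE js orbT.
  move=> w [Xw nVw]; have [j] := XV w Xw; rewrite inE => /predU1P[->//|js Vj].
  by exists j.
pose D : set (Omega R) := [set w | forall j, (j < N)%N -> A i j (w (n + j)%N)].
have mD : measurable D.
  have -> : D = cyl (n + N) (fun j => if (j < n)%N then setT else A i (j - n)%N).
    apply/seteqP; split=> w h j jN.
      case: ltnP => // nj; have := h (j - n)%N; rewrite subnKC//.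
      by apply; rewrite ltn_subLR.
    by have := h (n + j)%N; rewrite ltn_add2l (ltnNge (n + _) n) leq_addr /= addKn; exact.
  by apply: measurable_cyl => j; case: ifP => // _; exact: cmeasurableT.
apply: (@le_trans _ _ (pr ((X `&` V i) `\` D))).
  apply: pr_le; [exact: measurableI|exact: measurableD|].
  move=> w [[Xw Bw] Vw]; split=> // Dw.
  by apply: (VB i w) => //; exact: mem_head.
have := prDI mXV' mD; rewrite independence// => E.
have e := etaA i (mem_head _ _); have := pr_ge0 (X `&` V i); nra.
Qed.

Lemma pr_Om n : pr (cyl n (fun=> cdisk c r)) = 1.
Proof.
rewrite pr_cyl; last by move=> _; exact: cmeasurable_cdisk.
by rewrite big1// => i _; exact: mval_cdisk.
Qed.

Lemma negligible_not_Omega : P.-negligible [set w : Omega R | ~ Omega_cr c r w].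
Proof.
have mC n : measurable (~` cyl n (fun=> cdisk c r) : set (Omega R)).
  by apply: measurableC; apply: measurable_cyl => _; exact: cmeasurable_cdisk.
have : P.-negligible (\bigcup_n (~` cyl n (fun=> cdisk c r) : set (Omega R))).
  apply: negligible_bigcup => n; exists (~` cyl n (fun=> cdisk c r)); split=> //.
  apply: (eq_trans (prE (mC n))).
  have mO : measurable (cyl n (fun=> cdisk c r) : set (Omega R)).
    by apply: measurable_cyl => _; exact: cmeasurable_cdisk.
  have := prDI measurableT mO; rewrite setTD setTI prT pr_Om => E.
  by congr EFin; lra.
apply: negligibleS => w nw; apply: contrapT => h; apply: nw => n.
apply: contrapT => nwn; apply: h; exists n.+1 => // hc; apply: nwn.
exact: (hc n (ltnSn n)).
Qed.

End ProductMeasure.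

(** * Almost sure escape and good times *)

Section EscapeProbability.
Variables (R : realType) (c : C R) (r : R) (P : probability (Omega R) R).
Hypotheses (r_gt0 : 0 < r) (HP : is_product_measure c r P).
Local Notation rho := (escrad c r).
Hypothesis Hesc : forall z : C R, exists n w, Omega_cr c r w /\ rho < cmod (fiter w n z).
Implicit Types (w : nat -> C R) (z : C R).

(** On a cylinder only finitely many parameters are known to be admissible; padding with the centre
    gives a sequence to which the escape lemmas apply. *)
Definition trunc m w : nat -> C R := fun i => if (i < m)%N then w i else c.

Lemma trunc_Omega m w : (forall i, (i < m)%N -> cdisk c r (w i)) -> Omega_cr c r (trunc m w).
Proof.
move=> h i; rewrite /trunc; case: ifP => [/h//|_].
by apply: cdisk_center; exact: ltW.
Qed.

Lemma fiter_trunc m j k w z : (j + k <= m)%N ->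
  fiter (sshift j (trunc m w)) k z = fiter (sshift j w) k z.
Proof.
move=> jkm; apply: eq_fiter => i ik; rewrite /sshift /trunc.
by rewrite (leq_trans _ jkm)// ltn_add2l.
Qed.

Lemma seq_min_pos (I : eqType) (s : seq I) (F : I -> R) :
  (forall i, i \in s -> 0 < F i) ->
  exists eta : R, [/\ 0 < eta, eta <= 1 & forall i, i \in s -> eta <= F i].
Proof.
elim: s => [|i s IH] F0; first by exists 1.
have [|eta [e0 e1 eF]] := IH; first by move=> j js; apply: F0; rewrite inE js orbT.
exists (Num.min eta (F i)); split.
- by rewrite lt_min e0 F0// mem_head.
- by rewrite ge_min e1.
move=> j; rewrite inE => /predU1P[->|/eF h]; first by rewrite ge_min lexx orbT.
by rewrite ge_min h.
Qed.

(** Near each point, parameters close to an escaping block drive a whole ball out of the disc.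
    Finitely many balls suffice, and their blocks are padded by arbitrary admissible parameters to
    one length, escape being irreversible. *)
Lemma uniform_blocks : exists (s : seq (C R)) (dd : C R -> R) (N : nat)
    (A : C R -> nat -> set (C R)) (eta : R),
  [/\ (forall z, cmod z <= rho -> exists2 i, i \in s & cmod (z - i) < dd i),
      (forall i j, cmeasurable (A i j)),
      (forall i z b, i \in s -> cmod (z - i) < dd i ->
         (forall j, (j < N)%N -> A i j (b j)) -> rho < cmod (fiter b N z)),
      (forall i, i \in s -> eta <= \prod_(j < N) mval c r (A i j)) &
      [/\ 0 < eta, eta <= 1 & (0 < N)%N]].
Proof.
have r0 := r_gt0.
have /choice[t tP] : forall z, exists t : nat * (nat -> C R) * R,
    [/\ Omega_cr c r t.1.2, 0 < t.2 & forall w' z', cmod (z' - z) < t.2 ->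
      (forall i, (i < t.1.1)%N -> cmod (w' i - t.1.2 i) < t.2) ->
      rho < cmod (fiter w' t.1.1 z')].
  move=> z; have [n [w [hw wn]]] := Hesc z.
  have e0 : 0 < cmod (fiter w n z) - rho by rewrite subr_gt0.
  have [d d0 wd] := fiter_near w n z e0.
  exists (n, w, d); split=> //= w' z' zz ww; have := wd w' z' zz ww.
  have := cmod_subr (fiter w n z) (fiter w' n z').
  by rewrite (cmodB (fiter w n z)); lra.
pose dd z := (t z).2.
have cD : cover_compact (cdisk (0 : C R) rho).
  by rewrite -compact_cover; exact: compact_cdisk.
have [||D' _ D'c] := cD (C R) setT (fun z => cball z (dd z)).
- move=> z _; apply/open_cballP => y zy; exists (dd z - cmod (y - z)).
    by rewrite subr_gt0.
  by move=> x; rewrite /cball/=; have := cmod_triangle y x z; lra.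
- by move=> z _; exists z => //; have [_ d0 _] := tP z; rewrite /cball/= subrr cmod0.
pose s : seq (C R) := finmap.enum_fset D'.
(* The successor keeps [N] positive even if every escape time is 0. *)
pose N := (\max_(i <- s) (t i).1.1).+1.
pose A i j := if (j < (t i).1.1)%N then cdisk c r `&` cball ((t i).1.2 j) (dd i) else cdisk c r.
have mA i j : cmeasurable (A i j).
  rewrite /A; case: ifP => _; last exact: cmeasurable_cdisk.
  by apply: cmeasurableI; [exact: cmeasurable_cdisk|exact: cmeasurable_cball].
have [eta [e0 e1 eA]] : exists eta : R, [/\ 0 < eta, eta <= 1 &
    forall i, i \in s -> eta <= \prod_(j < N) mval c r (A i j)].
  apply: seq_min_pos => i _; apply: prodr_gt0 => j _; rewrite /A; case: ifP => _.
    by have [hw d0 _] := tP i; apply: (mval_cdisk_cball r_gt0 HP _ d0); exact: hw.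
  by rewrite (mval_cdisk r_gt0 HP).
exists s, dd, N, A, eta; split=> //.
- move=> z zr; have [|i] := D'c z; first by rewrite /cdisk/= subr0.
  by move=> /= iD zi; exists i.
move=> i z b si zi bA; have [hw d0 near] := tP i.
have nN : ((t i).1.1 <= N)%N by apply/leqW; exact: leq_bigmax_seq.
have bD j : (j < N)%N -> cdisk c r (b j).
  by move=> /bA; rewrite /A; case: ifP => // _ [].
have hb := trunc_Omega bD.
have -> : fiter b N z = fiter (trunc N b) N z.
  by apply: eq_fiter => j jN; rewrite /trunc jN.
apply: (fiter_escape (escrad4 c (ltW r_gt0)) (Omega_pbound hb) nN); apply: near => // j jn.
have jN := leq_trans jn nN; have := bA j jN; rewrite /A /trunc jn jN => -[_].
exact.
Qed.

Lemma escape_prob : exists (q : R) (N : nat), [/\ 0 <= q, q < 1, (0 < N)%N &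
  forall j k, pr P [set w : Omega R | cmod (fiter (sshift j w) k 0) <= rho] <= q ^+ (k %/ N)].
Proof.
have r0 := r_gt0; have r4 := escrad4 c (ltW r_gt0).
have [s [dd [N [A [eta [cov mA blk etaA [e0 e1 N0]]]]]]] := uniform_blocks.
exists (1 - eta), N; split=> //; [lra|lra|].
pose Om m : set (Omega R) := cyl m (fun=> cdisk c r).
have mOm m : <<s @cyls R m >> (Om m) by apply: cyl_cyls => _; exact: cmeasurable_cdisk.
pose B j k : set (Omega R) := [set w | cmod (fiter (sshift j w) k 0) <= rho].
have mB j k m : (j + k <= m)%N -> <<s @cyls R m >> (B j k).
  move=> jkm; have := @fiter_le_cyls R m j k 0 0 rho jkm.
  by congr (<<s _ >> _); apply/seteqP; split=> w; rewrite /B /= subr0.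
(* Leaving the disc is irreversible for admissible parameters; the cut with [Om] makes the events
   [E j k] decrease in [k]. *)
pose E j k := Om (j + k * N)%N `&` B j (k * N)%N.
have mE j k : <<s @cyls R (j + k * N) >> (E j k) by apply: cylsI => //; exact: mB.
have stay j k k' w : (k <= k')%N -> Om (j + k')%N w -> B j k' w -> B j k w.
  move=> kk Ow; rewrite /B /=.
  rewrite -(@fiter_trunc (j + k')) // -(@fiter_trunc (j + k') j k) ?leq_add2l//.
  apply: fiter_stay => //; apply: pbound_sshift; apply: Omega_pbound.
  exact: trunc_Omega.
have Om_le m m' w : (m <= m')%N -> Om m' w -> Om m w.
  by move=> mm h i im; apply: h; exact: leq_trans im mm.
have prE_le j k : pr P (E j k) <= (1 - eta) ^+ k.
  elim: k => [|k IH]; first by rewrite expr0 pr_le1//; exact: cyls_measurable (mE j 0%N).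
  have sub : E j k.+1 `<=` E j k.
    move=> w [Ow Bw]; split.
      by apply: Om_le Ow; rewrite leq_add2l leq_mul2r leqnSn orbT.
    by apply: stay Ow Bw; rewrite leq_mul2r leqnSn orbT.
  have mE1 := cyls_measurable (mE j k); have mE2 := cyls_measurable (mE j k.+1).
  apply: (@le_trans _ _ (pr P (E j k `&` E j k.+1))).
    apply: pr_le => //; first exact: measurableI.
    by move=> w Ew; split=> //; exact: sub.
  apply: le_trans (_ : (1 - eta) * pr P (E j k) <= _); last first.
    by rewrite exprS ler_wpM2l//; lra.
  apply: (@block_bound _ _ _ _ r_gt0 HP (j + k * N) N _ s
    (fun i => [set w | cmod (fiter (sshift j w) (k * N) 0 - i) < dd i]) A) => //.
  - by move=> i _; exact: fiter_lt_cyls.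
  - move=> i w si Vw Aw [_]; rewrite /B /= => Bw.
    have := blk i _ (sshift (j + k * N) w) si Vw Aw.
    by rewrite ltNge -sshift_sshift -fiterD -mulSnr Bw.
  by move=> w [_]; rewrite /B /= => /cov[i si iw]; exists i.
move=> j k; have mBk := cyls_measurable (@mB j k _ (leqnn _)).
have mOk := cyls_measurable (mOm (j + k)%N).
rewrite -/(B j k) (prDI P mBk mOk).
have -> : pr P (B j k `\` Om (j + k)%N) = 0.
  apply/eqP; rewrite eq_le pr_ge0 andbT.
  have := prDI P measurableT mOk; rewrite setTD setTI prT (pr_Om r_gt0 HP) => E0.
  have -> : 0 = pr P (~` Om (j + k)%N) by lra.
  apply: pr_le; [exact: measurableD|exact: measurableC|by move=> w []].
rewrite add0r; apply: le_trans (prE_le j (k %/ N)%N).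
apply: pr_le; [exact: measurableI|exact: cyls_measurable (mE _ _)|].
have kN : (k %/ N * N <= k)%N by exact: leq_trunc_div.
move=> w [Bw Ow]; split; first by apply: Om_le Ow; rewrite leq_add2l.
exact: stay kN Ow Bw.
Qed.

Lemma ae_escape : {ae P, forall w : Omega R, escapes0 w}.
Proof.
have r0 := r_gt0; have r4 := escrad4 c (ltW r_gt0).
have [q [N [q0 q1 N0 qB]]] := escape_prob.
pose B k : set (Omega R) := [set w | cmod (fiter (sshift 0 w) k 0) <= rho].
have mB k : measurable (B k).
  have := @fiter_le_cyls R k 0 k 0 0 rho (leqnn k) => /cyls_measurable.
  by congr measurable; apply/seteqP; split=> w; rewrite /B /= subr0.
have nB : P.-negligible (\bigcap_k B k).
  exists (\bigcap_k B k); split=> //; first exact: bigcapT_measurable.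
  apply: (eq_trans (prE P _)); first exact: bigcapT_measurable.
  congr EFin; apply/eqP; rewrite eq_le pr_ge0 andbT.
  apply/ler_addgt0Pr => e e0; rewrite add0r.
  have [k ke] : exists k, q ^+ k < e.
    have /cvgrPdist_lt/(_ e e0)[k _ h] : q ^+ n @[n --> \oo] --> 0.
      by apply: cvg_expr; rewrite ger0_norm.
    exists k; have := h k (leqnn k); rewrite sub0r normrN ger0_norm// exprn_ge0//.
  apply: le_trans (ltW ke); apply: le_trans (_ : pr P (B (k * N)%N) <= _).
    apply: pr_le => //; first exact: bigcapT_measurable.
    by move=> w h; exact: h.
  by apply: le_trans (qB 0%N (k * N)%N) _; rewrite mulnK.
have := negligibleU (negligible_not_Omega r_gt0 HP) nB.
apply: negligibleS => w ne.
have [hw|nw] := pselect (Omega_cr c r w); last by left.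
right=> k _; rewrite /B /= sshift0 leNgt; apply/negP => wk; apply: ne => M.
by have [L LM] := fiter_infty r4 M (Omega_pbound hw) wk; exists L.
Qed.

(** With delay [s = N * a], a time [m] is bad with probability at most [N * q^a / (1 - q)],
    uniformly in [m]. The event that all late times are bad is no likelier, so its intersection over
    [a] is negligible. The delay depends on [w]. *)
Lemma ae_good_times : {ae P, forall w : Omega R, exists s, forall M, exists2 m, (M <= m)%N &
  forall j, (j < m)%N -> rho < cmod (fiter (sshift j w) (m + s - j) 0)}.
Proof.
have [q [N [q0 q1 N0 qB]]] := escape_prob.
pose B j k : set (Omega R) := [set w | cmod (fiter (sshift j w) k 0) <= rho].
have mB j k : measurable (B j k).
  have := @fiter_le_cyls R (j + k) j k 0 0 rho (leqnn _) => /cyls_measurable.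
  by congr measurable; apply/seteqP; split=> w; rewrite /B /= subr0.
pose bad s m : set (Omega R) := \bigcup_(j in [set j | (j < m)%N]) B j (m + s - j)%N.
have mbad s m : measurable (bad s m) by apply: bigcup_measurable => j _; exact: mB.
have prbad s m : pr P (bad s m) <= \sum_(j < m) q ^+ ((m + s - j) %/ N).
  suff H k : (k <= m)%N -> pr P (\bigcup_(j in [set j | (j < k)%N]) B j (m + s - j)%N)
      <= \sum_(j < k) q ^+ ((m + s - j) %/ N) by exact: H.
  elim: k => [_|k IH km].
    by rewrite big_ord0 (_ : \bigcup_(j in _) _ = set0) ?/pr ?measure0// -subset0 => w [].
  rewrite big_ord_recr /=.
  have -> : \bigcup_(j in [set j | (j < k.+1)%N]) B j (m + s - j)%N =
      \bigcup_(j in [set j | (j < k)%N]) B j (m + s - j)%N `|` B k (m + s - k)%N.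
    apply/seteqP; split=> [w [j /=]|w [[j /= jk Bj]|Bk]].
    - rewrite ltnS leq_eqVlt => /predU1P[->|jk] Bj; first by right.
      by left; exists j.
    - by exists j => //=; exact: leqW.
    - by exists k => //=.
  apply: le_trans (prU_le P _ _) _ => //; first by apply: bigcup_measurable => j _; exact: mB.
  by apply: lerD; [exact: IH (ltnW km)|exact: qB].
have geo M : \sum_(i < M) q ^+ i <= (1 - q)^-1.
  have E : (1 - q) * (\sum_(i < M) q ^+ i) = 1 - q ^+ M.
    elim: M => [|M IH]; first by rewrite big_ord0 mulr0 expr0 subrr.
    by rewrite big_ord_recr /= mulrDr IH exprS; ring.
  rewrite -[leRHS]mul1r ler_pdivlMr; last by lra.
  by rewrite mulrC E gerBl exprn_ge0.
(* The exponent is constant on runs of [N] consecutive indices, hence the factor [N]. *)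
have sumb a M : \sum_(k < M * N) q ^+ ((N * a + k) %/ N) = N%:R * (q ^+ a * \sum_(i < M) q ^+ i).
  elim: M => [|M IH]; first by rewrite mul0n !big_ord0 !mulr0.
  rewrite mulSnr big_split_ord /= IH big_ord_recr /= !mulrDr; congr (_ + _).
  under eq_bigr => i _ do rewrite addnA mulnC -mulnDl divnMDl// (divn_small (ltn_ord i)) addn0 exprD.
  by rewrite sumr_const card_ord mulr_natl.
have badle a m : pr P (bad (N * a)%N m) <= N%:R * (q ^+ a / (1 - q)).
  apply: le_trans (prbad _ _) _.
  apply: le_trans (_ : \sum_(k < m.+1 * N) q ^+ ((N * a + k) %/ N) <= _); last first.
    by rewrite sumb ler_wpM2l// ler_wpM2l ?exprn_ge0.
  (* Reindexed by [k = m - j], which runs from 1 to [m]. *)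
  have -> : \sum_(j < m) q ^+ ((m + N * a - j) %/ N) = \sum_(1 <= k < m.+1) q ^+ ((N * a + k) %/ N).
    rewrite -(big_mkord xpredT (fun j => q ^+ ((m + N * a - j) %/ N))) big_nat_rev /= big_add1 /=.
    rewrite big_nat [RHS]big_nat; apply: eq_bigr => i /andP[_ im]; congr (_ ^+ (_ %/ _)).
    by rewrite add0n addnC -addnBA ?leq_subr// subKn// ltnW.
  rewrite -(big_mkord xpredT (fun k => q ^+ ((N * a + k) %/ N))).
  rewrite (@big_cat_nat _ _ _ 1 0 (m.+1 * N)) ?muln_gt0 ?N0//=.
  rewrite (@big_cat_nat _ _ _ m.+1 1 (m.+1 * N)) ?leq_pmulr//=.
  rewrite addrCA lerDl addr_ge0// big_nat sumr_ge0// => k _; exact: exprn_ge0.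
pose Z a : set (Omega R) := \bigcup_M \bigcap_(m in [set m | (M <= m)%N]) bad (N * a)%N m.
have mcap a M : measurable (\bigcap_(m in [set m | (M <= m)%N]) bad (N * a)%N m).
  by apply: bigcap_measurableType => m _; exact: mbad.
have mZ a : measurable (Z a) by apply: bigcupT_measurable => M; exact: mcap.
have prZ a : pr P (Z a) <= N%:R * (q ^+ a / (1 - q)).
  pose F M : set (Omega R) := \bigcap_(m in [set m | (M <= m)%N]) bad (N * a)%N m.
  have cv : P (F M) @[M --> \oo] --> P (Z a).
    apply: nondecreasing_cvg_mu; [by move=> M; exact: mcap|exact: mZ|].
    move=> M M' MM; apply/subsetPset => w h m /= Mm; apply: h => /=.
    exact: leq_trans MM Mm.
  rewrite -lee_fin -prE//; apply: (cvge_le _ cv).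
  apply: nearW => M; rewrite prE; last exact: mcap.
  rewrite lee_fin; apply: le_trans (badle a M); apply: pr_le => //; first exact: mcap.
  by move=> w h; exact: (h M (leqnn M)).
have nZ : P.-negligible (\bigcap_a Z a).
  have mcZ : measurable (\bigcap_a Z a) by exact: bigcapT_measurable.
  exists (\bigcap_a Z a); split=> //.
  apply: (eq_trans (prE P mcZ)).
  congr EFin; apply/eqP; rewrite eq_le pr_ge0 andbT.
  apply/ler_addgt0Pr => e e0; rewrite add0r.
  have NR : 0 < N%:R :> R by rewrite ltr0n.
  pose e' := e * (1 - q) / N%:R.
  have e'0 : 0 < e' by rewrite divr_gt0// mulr_gt0//; lra.
  have [a ae] : exists a, q ^+ a < e'.
    have /cvgrPdist_lt/(_ e' e'0)[k _ h] : q ^+ n @[n --> \oo] --> 0.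
      by apply: cvg_expr; rewrite ger0_norm.
    by exists k; have := h k (leqnn k); rewrite sub0r normrN ger0_norm// exprn_ge0.
  apply: le_trans (_ : pr P (Z a) <= _); first by apply: pr_le => // w h; exact: h.
  apply: le_trans (prZ a) _; rewrite mulrA ler_pdivrMr; last by lra.
  by move: ae; rewrite /e' ltr_pdivlMr// mulrC => /ltW.
apply: negligibleS nZ => w ne a _; apply: contrapT => nZw; apply: ne.
exists (N * a)%N => M; apply: contrapT => nm; apply: nZw; exists M => // m /= Mm.
apply: contrapT => nbad; apply: nm; exists m => // j jm.
by rewrite ltNge; apply/negP => h; apply: nbad; exists j.
Qed.

End EscapeProbability.

(** * Total disconnectedness *)

Section TotallyDisconnected.
Variable R : realType.
Implicit Types (x y z v : C R) (u : nat -> C R) (X : set (C R)).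

(** Local bounds with one constant [K] add up along short steps of the segment from [v] to [z],
    whose common length comes from compactness. *)
Lemma locally_lipschitz (g : C R -> C R) v (e K : R) : 0 <= K ->
  (forall z, cmod (z - v) <= e -> exists2 d : R, 0 < d &
     forall x y, cmod (x - v) <= e -> cmod (y - v) <= e ->
       cmod (x - z) < d -> cmod (y - z) < d -> cmod (g x - g y) <= K * cmod (x - y)) ->
  forall z, cmod (z - v) <= e -> cmod (g z - g v) <= K * cmod (z - v).
Proof.
move=> K0 loc z ze.
have e0 : 0 <= e by apply: le_trans ze; exact: cmod_ge0.
have /compact_near_coveringP := @compact_cdisk R v e.
move=> /(_ R (0^'+)%R (fun d x => cdisk v e x -> forall y, cmod (y - v) <= e ->
  cmod (y - x) < d -> cmod (g y - g x) <= K * cmod (y - x))).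
case.
  move=> x xe; have [d d0 xd] := loc x xe.
  exists (cball x (d / 2), [set t | t < d / 2]).
    split; first by apply: nbhs_cball; lra.
    by apply: nbhs_right_lt; lra.
  move=> [x' t] [/= x'x td] x'e y ye yx; rewrite /cball/= in x'x.
  by apply: xd => //; [have := cmod_triangle x' y x; lra|lra].
move=> d d0 dK.
have {dK} dK (x y : C R) : cmod (x - v) <= e -> cmod (y - v) <= e -> cmod (y - x) < d / 2 ->
    cmod (g y - g x) <= K * cmod (y - x).
  move=> xe ye; apply: (dK (d / 2)) => //=; last by rewrite divr_gt0.
  by rewrite sub0r normrN gtr0_norm ?divr_gt0// gtr_pMr// invf_lt1// ltr1n.
have d20 : 0 < d / 2 by rewrite divr_gt0.
have [N N0 eN] : exists2 N : nat, (0 < N)%N & e / N%:R < d / 2.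
  exists (Num.truncn (e / (d / 2))).+1 => //.
  by rewrite ltr_pdivrMr ?ltr0n// mulrC -ltr_pdivrMr//; exact: truncnS_gt.
have NR : 0 < N%:R :> R by rewrite ltr0n.
pose p (k : nat) := seg v z (k%:R / N%:R).
have pe k : (k <= N)%N -> cmod (p k - v) <= e.
  move=> kN; rewrite /p -[X in _ - X](seg0 v z) seg_dist subr0 ger0_norm ?divr_ge0//.
  apply: le_trans ze; rewrite ler_piMl ?cmod_ge0// ler_pdivrMr// mul1r ler_nat//.
have pS k : cmod (p k.+1 - p k) = N%:R^-1 * cmod (z - v).
  rewrite /p seg_dist -natr1 mulrDl mul1r addrC addKr ger0_norm// invr_ge0//.
have H k : (k <= N)%N -> cmod (g (p k) - g v) <= K * (k%:R / N%:R * cmod (z - v)).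
  elim: k => [_|k IH kN]; first by rewrite /p mul0r seg0 subrr cmod0 !mul0r mulr0.
  have h1 := IH (ltnW kN).
  have h2 : cmod (g (p k.+1) - g (p k)) <= K * cmod (p k.+1 - p k).
    apply: dK; [exact: pe (ltnW kN)|exact: pe|].
    rewrite pS; apply: le_lt_trans eN; rewrite mulrC ler_wpM2r// invr_ge0//.
  have := cmod_triangle (g (p k)) (g (p k.+1)) (g v).
  by rewrite pS in h2; rewrite -natr1 mulrDl mul1r; nra.
have := H N (leqnn N); rewrite /p divff ?gt_eqF// seg1 mul1r//.
Qed.

Lemma inverse_branch_lipschitz (f g : C R -> C R) v (e L : R) : 0 < L -> continuous g ->
  (forall z, cmod (z - v) <= e -> f (g z) = z) ->
  (forall z, cmod (z - v) <= e -> exists2 b, L <= cmod b & sderiv f (g z) b) ->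
  forall z, cmod (z - v) <= e -> cmod (g z - g v) <= 2 / L * cmod (z - v).
Proof.
move=> L0 cg fg fb; apply: locally_lipschitz; first by rewrite divr_ge0// ltW.
move=> z ze; have [b Lb fb'] := fb z ze.
have b0 : b != 0 by apply/eqP => b0; move: Lb; rewrite b0 cmod0; lra.
have [d d0 fd] := sderiv_inj b0 fb'.
have /continuous_cmodP/(_ z _ d0)[d' d'0 gd] := cg.
exists d' => // x y xe ye xz yz.
have := fd _ _ (gd _ xz) (gd _ yz); rewrite !fg// => h.
rewrite mulrAC ler_pdivlMr//; have := cmod_ge0 (g x - g y); nra.
Qed.

(* Points of a connected set at prescribed distances from [x] are separated,
   so a bounded number of small pieces cannot cover it. *)
Lemma connected_pigeonhole X x y (I : eqType) (s : seq I) (V : I -> set (C R)) (d : R) :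
  connected X -> X x -> X y -> 0 < d ->
  (forall z, X z -> exists2 i, i \in s & V i z) ->
  (forall i z z', X z -> X z' -> V i z -> V i z' -> cmod (z - z') < d) ->
  cmod (x - y) <= (size s).+1%:R * d.
Proof.
move=> cX Xx Xy d0 cov small; rewrite leNgt; apply/negP => xy.
have cI : connected ((fun z => cmod (z - x)) @` X).
  apply: connected_continuous_connected => //; apply: continuous_subspaceT.
  apply: continuous_realP => z e e0; exists e => // z' zz.
  rewrite ltr_norml; have := cmod_triangle z' z x; have := cmod_triangle z z' x.
  by rewrite (cmodB z z') => *; apply/andP; split; lra.
have iI := (connected_intervalP _).1 cI.
have /choice[z zP] : forall k : 'I_(size s).+1, exists z, X z /\ cmod (z - x) = k%:R * d.
  move=> k; have [z Xz zk] : ((fun z => cmod (z - x)) @` X) (k%:R * d).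
    apply: (iI (cmod (x - x)) (cmod (y - x))); [by exists x|by exists y|].
    rewrite subrr cmod0 mulr_ge0 ?(ltW d0)//=; apply: ltW; rewrite (cmodB y).
    by apply: le_lt_trans xy; rewrite ler_pM2r// ler_nat ltnW.
  by exists z.
have /choice[j jP] : forall k, exists j, j \in s /\ V j (z k).
  by move=> k; have [j] := cov (z k) (zP k).1; exists j.
have lt k : (index (j k) s < size s)%N by rewrite index_mem; exact: (jP k).1.
pose f k : 'I_(size s) := Ordinal (lt k).
have [k [l [kl fkl]]] : exists k l : 'I_(size s).+1, (k < l)%N /\ f k = f l.
  apply: contrapT => nkl.
  have finj : injective f.
    move=> k l fkl; apply/val_inj; case: (ltngtP k l) => // kl; exfalso; apply: nkl.
      by exists k, l.
    by exists l, k.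
  by have := leq_card f finj; rewrite !card_ord ltnn.
have jkl : j k = j l.
  have [jk _] := jP k; have [jl _] := jP l.
  move: fkl => /(congr1 val) /= E.
  by rewrite -(nth_index (j k) jk) E nth_index.
have [Xk zk] := zP k; have [Xl zl] := zP l.
have := small (j k) (z l) (z k) Xl Xk _ (jP k).2; rewrite jkl => /(_ (jP l).2).
have := cmod_triangle (z k) (z l) x; rewrite zk zl.
have : (k.+1%:R : R) <= l%:R by rewrite ler_nat.
rewrite -natr1; nra.
Qed.

Variable rho : R.
Hypothesis rho4 : 4 <= rho.

(** The radius is the same for all parameter sequences, since along an orbit in the disc one step
    expands small differences by at most [2 * rho + 1]. It therefore serves at every good time. *)
Lemma fiter_unif_near s (e : R) : 0 < e -> exists2 d : R, 0 < d &
  forall u z z', pbound rho u -> cmod (fiter u s z) <= rho -> cmod (z' - z) <= d ->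
    cmod (fiter u s z' - fiter u s z) <= e.
Proof.
have r4 := rho4; elim: s e => [|s IH] e e0; first by exists e.
pose e' := Num.min 1 (e / (2 * rho + 1)).
have e'0 : 0 < e' by rewrite lt_min ltr01 divr_gt0//; lra.
have e'1 : e' <= 1 by rewrite ge_min lexx.
have e'e : e' * (2 * rho + 1) <= e.
  have : e' <= e / (2 * rho + 1) by rewrite ge_min lexx orbT.
  by rewrite ler_pdivlMr//; lra.
have [d d0 IHd] := IH e' e'0; exists d => // u z z' bu zs zz.
have zs' : cmod (fiter u s z) <= rho by exact: (fiter_stay rho4 bu (leqnSn s) zs).
have := IHd u z z' bu zs' zz => h.
have -> : fiter u s.+1 z' - fiter u s.+1 z =
  (fiter u s z' - fiter u s z) * ((fiter u s z' - fiter u s z) + fiter u s z + fiter u s z).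
  by rewrite /= /quad; ring.
rewrite cmodM; apply: le_trans e'e; apply: ler_pM; rewrite ?cmod_ge0//.
apply: le_trans (cmodD _ _) _; have := cmodD (fiter u s z' - fiter u s z) (fiter u s z).
lra.
Qed.

Section GoodTimes.
Variables (w : nat -> C R) (s : nat).
Hypothesis bw : pbound rho w.

(** The critical points started at times before [m] are all outside the disc at time [m + s]. So
    none of them can pass at time [m] through a point that stays for [s] further steps, and inverse
    branches of [fiter w m] exist around such points. *)
Definition good (m : nat) := forall j, (j < m)%N ->
  rho < cmod (fiter (sshift j w) (m + s - j) 0).

Hypothesis good_inf : forall M, exists2 m, (M <= m)%N & good m.

Lemma good_crit m j y : good m -> (j < m)%N ->
  cmod (fiter (sshift m w) s y) <= rho -> fiter (sshift j w) (m - j) 0 <> y.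
Proof.
move=> gm jm ys E; have := gm j jm; rewrite ltNge => /negP; apply.
have -> : (m + s - j = (m - j) + s)%N by rewrite addnBAC// ltnW.
by rewrite fiterD E sshift_sshift subnKC// ltnW.
Qed.

(* Between two good times the inverse branch is dilated by [1 + t] about the
   orbit of [x] before being pulled back further; [H] is the polynomial whose
   inverse branch is the resulting composition. *)
Lemma dilated_branch (d t : R) : 0 < t -> t * (2 * rho) <= d ->
  (forall u z z', pbound rho u -> cmod (fiter u s z) <= rho -> cmod (z' - z) <= d ->
    cmod (fiter u s z' - fiter u s z) <= 1) ->
  forall k, exists2 m, good m & forall x, cmod (fiter w (m + s.+1) x) <= rho ->
    exists (H : C R -> C R) a, [/\ polyfun H, sderiv H x a,
      fder w m x = ((1 + t)%:C%C) ^+ k * a &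
      forall (G : C R -> C R) v (e : R), 0 < e -> continuous G -> G v = fiter w m x ->
        (forall z, cmod (z - v) <= e -> cmod (fiter (sshift m w) s (G z)) <= rho) ->
        exists Psi : C R -> C R, [/\ continuous Psi, Psi v = x &
          forall z, cmod (z - v) <= e -> [/\ H (Psi z) = G z, cmod (Psi z) <= rho &
            exists2 b, b != 0 & sderiv H (Psi z) b]]].
Proof.
have r4 := rho4; move=> t0 td near; elim=> [|k [m gm IH]].
  have [m _ gm] := good_inf 0; exists m => // x xm.
  exists (fiter w m), (fder w m x); split.
  - exact: polyfun_fiter.
  - exact: sderiv_fiter.
  - by rewrite expr0 mul1r.
  move=> G v e e0 cG Gv Gs.
  have crit z j : cmod (z - v) <= e -> (j < m)%N -> fiter (sshift j w) (m - j) 0 <> G z.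
    by move=> zv jm; apply: good_crit => //; exact: Gs.
  have [g cg [gv gG]] := inverse_branch cG e0 (esym Gv) crit.
  exists g; split=> // z zv; split; first exact: gG.
    apply: (@fiter_stay _ _ rho4 w 0 (m + s) (g z) bw) => //.
    by rewrite fiterD gG// Gs.
  exists (fder w m (g z)); last exact: sderiv_fiter.
  apply: fder_neq0 => j jm; apply/eqP => gj; apply: (crit z j zv jm).
  by rewrite -gG// -gj -fiterD subnKC// ltnW.
have [m' mm' gm'] := good_inf m.+1; exists m' => // x xm'.
have xm : cmod (fiter w (m + s.+1) x) <= rho.
  by apply: (fiter_stay rho4 bw _ xm'); rewrite leq_add2r ltnW.
have [H [a [pH dH aH lift]]] := IH x xm.
pose n := (m' - m)%N; have mn : (m + n = m')%N by rewrite subnKC// ltnW.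
have n0 : (0 < n)%N by rewrite subn_gt0.
pose wm := sshift m w; have bwm : pbound rho wm by exact: pbound_sshift.
pose vm := fiter w m x.
have t1 : (1 + t)%:C%C != 0 :> R[i] by rewrite eq_complex /= gt_eqF//; lra.
(* [H'] contracts by [kk] about [vm], so its inverse branch dilates by [1 + t]. *)
pose kk : C R := ((1 + t)%:C%C)^-1.
have kq : (1 + t)%:C%C * kk = 1 by rewrite /kk mulfV.
pose H' y := fiter wm n (kk * H y + (vm - kk * vm)).
have vmr : cmod vm <= rho by apply: (fiter_stay rho4 bw _ xm); rewrite leq_addr.
(* The value of [H] at [x] is recovered by lifting the constant map [vm]. *)
have Hx : H x = vm.
  have c1 : continuous (fun _ : C R => vm) by exact: cont_cst.
  have [|Psi [_ Pv /(_ 0)[]]] := lift (fun=> vm) 0 1 ltr01 c1 erefl.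
    move=> z _; rewrite -fiterD.
    by apply: (fiter_stay rho4 bw _ xm); rewrite leq_add2l leqnSn.
    by rewrite subrr cmod0.
  by rewrite Pv.
have dH' y b : sderiv H y b ->
    sderiv H' y (fder wm n (kk * H y + (vm - kk * vm)) * (kk * b)).
  move=> dHy; have h1 := sderiv_comp dHy (@sderiv_affine _ (H y) kk (vm - kk * vm)).
  exact: sderiv_comp h1 (sderiv_fiter _ _ _).
have Hvm : kk * H x + (vm - kk * vm) = vm by rewrite Hx; ring.
exists H', (fder wm n vm * (kk * a)); split.
- apply: (@polyfun_comp _ (fiter wm n) (fun y => kk * H y + (vm - kk * vm))).
    exact: polyfun_fiter.
  exact: (polyfunD (polyfunM (polyfun_cst kk) pH) (polyfun_cst _)).
- by rewrite -{1}Hvm; exact: dH'.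
- rewrite -mn fderD aH exprS -/vm -/wm.
  rewrite (_ : _ * _ * (_ * (kk * a)) = ((1 + t)%:C%C * kk) *
    (fder wm n vm * ((1 + t)%:C%C ^+ k * a))); last by ring.
  by rewrite kq mul1r.
move=> G v e e0 cG Gv Gs.
have crit z j : cmod (z - v) <= e -> (j < n)%N -> fiter (sshift j wm) (n - j) 0 <> G z.
  move=> zv jn; rewrite /wm sshift_sshift.
  have -> : (n - j = m' - (m + j))%N by rewrite subnDA.
  apply: good_crit => //; last exact: Gs.
  by rewrite -mn ltn_add2l.
have vmG : fiter wm n vm = G v by rewrite /vm -fiterD mn.
have [h ch [hv hG]] := inverse_branch cG e0 vmG crit.
have hns z : cmod (z - v) <= e -> cmod (fiter wm (n + s) (h z)) <= rho.
  by move=> zv; rewrite fiterD hG// /wm sshift_sshift mn Gs.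
have hr z : cmod (z - v) <= e -> cmod (h z) <= rho.
  by move=> zv; apply: (@fiter_stay _ _ rho4 wm 0 (n + s) (h z) bwm) => //; exact: hns.
pose G' z : C R := (1 + t)%:C%C * h z - t%:C%C * vm.
have cG' : continuous G'.
  have ca : continuous (fun _ : C R => (1 + t)%:C%C : C R) by exact: cont_cst.
  have cb : continuous (fun _ : C R => (t%:C%C : C R) * vm) by exact: cont_cst.
  exact: contB (contM ca ch) cb.
have G'h z : G' z - h z = t%:C%C * (h z - vm).
  by rewrite /G' rmorphD rmorph1; ring.
have G'v : G' v = fiter w m x.
  by rewrite /G' hv -/vm rmorphD rmorph1; ring.
have G's z : cmod (z - v) <= e -> cmod (fiter (sshift m w) s (G' z)) <= rho.
  move=> zv; rewrite -/wm.
  (* As [n > 0], the point [h z] stays for more than [s] steps; the resulting margin of 1 absorbs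
     the dilation. *)
  have s1 : cmod (fiter wm s (h z)) <= rho - 1.
    by apply: (fiter_stay1 rho4 bwm _ (hns z zv)); rewrite -[X in (X < _)%N]add0n ltn_add2r.
  have : cmod (fiter wm s (G' z) - fiter wm s (h z)) <= 1.
    apply: near => //; first by lra.
    rewrite G'h cmodM cmodR gtr0_norm//; apply: le_trans td; rewrite ler_pM2l//.
    by have := cmodD (h z) (- vm); rewrite cmodN; have := hr z zv; lra.
  by have := cmod_subr (fiter wm s (G' z)) (fiter wm s (h z)); lra.
have [Psi [cPsi Pv PsiP]] := lift G' v e e0 cG' G'v G's.
have PsiH z : cmod (z - v) <= e -> kk * H (Psi z) + (vm - kk * vm) = h z.
  move=> zv; have [-> _ _] := PsiP z zv.
  have -> : G' z = (1 + t)%:C%C * (h z - vm) + vm by rewrite /G' rmorphD rmorph1; ring.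
  rewrite mulrDr mulrA [kk * _]mulrC kq mul1r; ring.
exists Psi; split=> // z zv; have [HP Pr [b b0 dHb]] := PsiP z zv; split=> //.
  by rewrite /H' PsiH// hG.
exists (fder wm n (h z) * (kk * b)); last by rewrite -PsiH//; exact: dH'.
rewrite mulf_neq0 ?mulf_neq0// ?invr_neq0//.
apply: fder_neq0 => j jn; apply/eqP => hj; apply: (crit z j zv jn).
by rewrite -hG// -hj -fiterD subnKC// ltnW.
Qed.

(** The derivative is [(1 + t) ^+ k * a], and [inverse_branch_bound] keeps [|a|] above
    [d / (2 * rho) = t] for every [k]. Staying until [m + s.+1] rather than [m + s] provides the
    margin for a disc of radius [d] about [fiter w m x]. *)
Lemma good_expanding (L : R) : exists2 m, good m &
  forall x, cmod (fiter w (m + s.+1) x) <= rho -> L <= cmod (fder w m x).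
Proof.
have r4 := rho4; have [d d0 near] := fiter_unif_near s ltr01.
pose t := d / (2 * rho); have t0 : 0 < t by rewrite divr_gt0//; lra.
have td : t * (2 * rho) = d by rewrite /t mulfVK// gt_eqF//; lra.
have [k kL] := expr_unbounded (`|L| / t) t0.
have td' : t * (2 * rho) <= d by rewrite td.
have [m gm mH] := dilated_branch t0 td' near k.
exists m => // x xm; have [H [a [pH dH aH lift]]] := mH x xm.
have cid : continuous (fun y : C R => y) by move=> ?; exact: id.
have xm1 : cmod (fiter (sshift m w) s (fiter w m x)) <= rho - 1.
  by rewrite -fiterD; apply: (fiter_stay1 rho4 bw _ xm); rewrite ltn_add2l.
have [|Psi [cPsi Pv PsiP]] := lift (fun y => y) (fiter w m x) d d0 cid erefl.
  move=> z zv; have := near (sshift m w) (fiter w m x) z (pbound_sshift m bw) _ zv.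
  move=> /(_ ltac:(lra)).
  by have := cmod_subr (fiter (sshift m w) s z) (fiter (sshift m w) s (fiter w m x)); lra.
have la : d / (2 * rho) <= cmod a.
  apply: (@inverse_branch_bound _ H Psi (fiter w m x) d (2 * rho)) => //.
  - by lra.
  - by move=> z zv; have [] := PsiP z zv.
  - move=> z zv; have [_ zr _] := PsiP z zv.
    have [|_ vr _] := PsiP (fiter w m x); first by rewrite subrr cmod0 ltW.
    by have := cmodD (Psi z) (- Psi (fiter w m x)); rewrite cmodN; lra.
  - by move=> z zv; have [] := PsiP z zv.
  by rewrite Pv.
rewrite aH cmodM cmodX cmodR gtr0_norm; last by lra.
move: kL; rewrite ltr_pdivrMr// => kL.
have : (1 + t) ^+ k * t <= (1 + t) ^+ k * cmod a by rewrite ler_wpM2l// exprn_ge0//; lra.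
by have := ler_norm L; lra.
Qed.

(** Goodness puts [w j] off the level set [D], so [fiter w j.+1 - w j] has a square root that
    depends on [fiter w j.+1] only. On the connected [X] it equals [fiter w j] up to a constant
    sign, so each value of [fiter w j.+1] determines that of [fiter w j]. *)
Lemma good_injective m X : good m -> connected X -> X `<=` level rho w (m + s) ->
  forall x y, X x -> X y -> fiter w m x = fiter w m y -> x = y.
Proof.
move=> gm cX XD.
suff H j : (j <= m)%N -> forall x y, X x -> X y -> fiter w j x = fiter w j y -> x = y.
  exact: H.
elim: j => [//|j IH jm] x y Xx Xy E; apply: IH => //; first exact: ltnW.
pose D := level rho (sshift j.+1 w) (m + s - j.+1).
have bj : pbound rho (sshift j.+1 w) by exact: pbound_sshift.
have jms : (j.+1 <= m + s)%N by rewrite (leq_trans jm) ?leq_addr.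
have XDj z : X z -> D (fiter w j.+1 z).
  by move=> /XD; rewrite /D /level /= -fiterD subnKC.
have nDw : ~ D (w j).
  rewrite /D /level /= => h; have := gm j jm; rewrite ltNge => /negP; apply.
  have -> : (m + s - j = (m + s - j.+1).+1)%N by rewrite subnSK.
  rewrite fiter_front sshift_sshift addn1.
  by rewrite /quad expr0n add0r /sshift addn0.
have [sg csg sgE] := sqrt_off_compact (@level_compact _ _ rho4 _ _ bj)
  (@setC_level_connected _ _ rho4 _ _ bj) nDw.
have cfj k : continuous (fiter w k) by exact: cont_fiter.
have cq : cont_on X (fun z => sg (fiter w j.+1 z)).
  move=> z Xz e e0; have [d d0 sd] := csg _ (XDj z Xz) e e0.
  have /continuous_cmodP/(_ z _ d0)[d' d'0 qd] := cfj j.+1.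
  by exists d' => // z' Xz' zz; apply: sd; [exact: XDj|exact: qd].
have sq z : X z -> fiter w j z ^+ 2 = sg (fiter w j.+1 z) ^+ 2.
  by move=> Xz; rewrite sgE; [rewrite /= /quad addrK|exact: XDj].
have q0 z : X z -> sg (fiter w j.+1 z) != 0.
  move=> Xz; rewrite -sqrf_eq0 sgE; last exact: XDj.
  by rewrite subr_eq0; apply: contra_notN nDw => /eqP <-; exact: XDj.
have [h|h] := connected_sign cX (continuous_cont_on (cfj j)) cq sq q0.
  by rewrite (h x Xx) (h y Xy) E.
by rewrite (h x Xx) (h y Xy) E.
Qed.

Lemma good_connected_point X x y : connected X -> X `<=` filled rho w -> X x -> X y -> x = y.
Proof.
have r4 := rho4; move=> cX XK Xx Xy.
apply/eqP; rewrite -subr_eq0; apply/eqP/cmod0_eq0/eqP.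
rewrite eq_le cmod_ge0 andbT; apply/ler_addgt0Pr => e e0; rewrite add0r.
have [d1 d10 near1] := fiter_unif_near s ltr01.
have [d2 d20 near2] := fiter_unif_near s.+1 ltr01.
pose d := Num.min d1 d2; have d0 : 0 < d by rewrite lt_min d10.
have dd1 : d <= d1 by rewrite ge_min lexx.
have dd2 : d <= d2 by rewrite ge_min lexx orbT.
have cD : cover_compact (cdisk (0 : C R) rho).
  by rewrite -compact_cover; exact: compact_cdisk.
have [||D' _ D'c] := cD (C R) setT (fun z => cball z (d / 2)).
- move=> z _; apply/open_cballP => z' zz'; exists (d / 2 - cmod (z' - z)).
    by rewrite subr_gt0.
  by move=> z''; rewrite /cball/=; have := cmod_triangle z' z'' z; lra.
- by move=> z _; exists z => //; rewrite /cball/= subrr cmod0; lra.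
pose cs : seq (C R) := finmap.enum_fset D'.
(* The number of pieces depends on [d] only and is fixed before the expansion [L] and the time
   [m]. *)
pose M : R := (size cs).+1%:R; have M0 : 0 < M by rewrite ltr0n.
pose eta := e / M; have eta0 : 0 < eta by rewrite divr_gt0.
pose L := 2 * d / eta + 1.
have L0 : 0 < L by rewrite /L ltr_wpDl// divr_ge0//; lra.
have Leta : 2 * d < L * eta by rewrite /L [(_ + 1) * _]mulrDl mulfVK ?gt_eqF//; lra.
have [m gm mL] := good_expanding L.
apply: le_trans (_ : M * eta <= e); last by rewrite /eta mulrC mulfVK// gt_eqF.
apply: (@connected_pigeonhole X x y _ cs (fun b => [set z | cmod (fiter w m z - b) < d / 2])) => //.
  move=> z Xz; have [|b bD zb] := D'c (fiter w m z).
    by rewrite /cdisk/= subr0; exact: XK.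
  by exists b.
move=> {x y Xx Xy} b z z' Xz Xz' /= zb z'b.
pose v := fiter w m z; pose v' := fiter w m z'.
have vv' : cmod (v' - v) < d.
  by have := cmod_triangle b v' v; rewrite (cmodB b); rewrite /v /v'; lra.
have bm : pbound rho (sshift m w) by exact: pbound_sshift.
have Dv k y : cmod (y - v) <= d -> (k == s) || (k == s.+1) ->
    cmod (fiter (sshift m w) k y) <= rho.
  move=> yv kk.
  have vk : cmod (fiter (sshift m w) k v) <= rho - 1.
    by rewrite /v -fiterD; apply: (fiter_stay1 rho4 bw (ltnSn _)); exact: XK.
  have : cmod (fiter (sshift m w) k y - fiter (sshift m w) k v) <= 1.
    by case/orP: kk vk => /eqP -> vk; [apply: near1|apply: near2] => //; lra.
  by have := cmod_subr (fiter (sshift m w) k y) (fiter (sshift m w) k v); lra.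
have cid : continuous (fun y : C R => y) by move=> ?; exact: id.
have crit y j : cmod (y - v) <= d -> (j < m)%N -> fiter (sshift j w) (m - j) 0 <> y.
  by move=> yv jm; apply: good_crit => //; apply: Dv; rewrite ?eqxx.
have [g cg [gv gG]] := inverse_branch cid d0 (erefl v : fiter w m z = v) crit.
(* [z'] and [g v'] have the same image under [fiter w m]. To identify them by injectivity, one
   connected set must contain both; [X] and the image of the branch meet at [z]. *)
pose Y := X `|` g @` cdisk v d.
have vD : cdisk v d v by apply: cdisk_center; exact: ltW.
have cY : connected Y.
  apply: connectedU => //; first by exists z; split=> //; exists v.
  apply: connected_continuous_connected; first by apply: cdisk_connected; exact: ltW.
  exact: continuous_subspaceT.
have YD : Y `<=` level rho w (m + s).
  move=> y' [/XK|[y yv <-]]; first exact.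
  by rewrite /level /= fiterD gG// Dv// eqxx.
have z'g : g v' = z'.
  apply: (good_injective gm cY YD); [by right; exists v' => //; exact: ltW|by left|].
  by rewrite gG//; exact: ltW.
have lip := @inverse_branch_lipschitz (fiter w m) g v d L L0 cg gG _ v' (ltW vv').
rewrite cmodB -z'g -gv; apply: le_lt_trans (lip _) _.
  move=> y yv; exists (fder w m (g y)); last exact: sderiv_fiter.
  by apply: mL; rewrite fiterD gG// Dv// eqxx orbT.
rewrite mulrAC ltr_pdivrMr// mulrC; have : 2 * cmod (v' - v) < 2 * d by lra.
by rewrite [L * _]mulrC in Leta *; lra.
Qed.

Lemma good_totally_disconnected : totally_disconnected (julia w).
Proof.
move=> x Jx; apply/seteqP; split=> [y xy|_ ->]; last exact: connected_component_refl.
apply: (@good_connected_point (connected_component (julia w) x)).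
- exact: component_connected.
- move=> z /connected_component_sub; exact: julia_filled.
- exact: xy.
- exact: connected_component_refl.
Qed.

End GoodTimes.
End TotallyDisconnected.

(** * The two alternatives exclude each other *)

Section Dichotomy.
Variable R : realType.
Implicit Types (w : nat -> C R) (z c : C R).

(** If the filled set were [{0}], that of the shifted sequence would be [{w 0}], and by symmetry
    [{0}] again. All parameters would then vanish, and the fixed point 1 would not escape. *)
Lemma filled_neq0 (rho : R) w : 4 <= rho -> pbound rho w ->
  exists2 z, filled rho w z & z != 0.
Proof.
move=> rho4 bw; apply: contrapT => nz.
have K0 z : filled rho w z -> z = 0.
  by move=> Kz; apply/eqP; rewrite -[_ == _]negbK; apply/negP => z0; apply: nz; exists z.
have w0 k : w k = 0 /\ forall z, filled rho (sshift k.+1 w) z -> z = 0.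
  have step (u : nat -> C R) : pbound rho u -> (forall z, filled rho u z -> z = 0) ->
      u 0%N = 0 /\ forall z, filled rho (sshift 1 u) z -> z = 0.
    move=> bu Ku; have Ku1 y : filled rho (sshift 1 u) y -> y = u 0%N.
      move=> Ky; pose x : C R := sqrtc (y - u 0%N : R[i]).
      have qx : quad (u 0%N) x = y.
        by rewrite /quad -[x ^+ 2]/((sqrtc (y - u 0%N : R[i])) ^+ 2) sqr_sqrtc subrK.
      have /Ku x0 : filled rho u x by apply/(filled_front rho4 _ bu); rewrite qx.
      by rewrite -qx x0 /quad expr0n add0r.
    have [y Ky] := filled_nonempty rho4 (pbound_sshift 1 bu).
    have yN : - y = y by rewrite {2}(Ku1 _ Ky); exact: Ku1 (filledN Ky).
    have y0 : y = 0.
      by apply/eqP; move/eqP: yN; rewrite -subr_eq0 -opprD oppr_eq0 -mulr2n mulrn_eq0.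
    have u0 : u 0%N = 0 by rewrite -(Ku1 _ Ky).
    by split=> // z /Ku1 ->.
  elim: k => [|k [_ IH]]; first exact: step.
  have [] := step _ (pbound_sshift k.+1 bw) IH.
  by rewrite sshift_sshift addn1 /sshift addn0.
have : filled rho w 1.
  move=> n; have -> : fiter w n 1 = 1.
    by elim: n => //= n ->; rewrite /quad (w0 n).1 expr1n addr0.
  by rewrite cmod1; lra.
by move=> /K0/eqP; rewrite oner_eq0.
Qed.

(** A single point would be both connected and totally disconnected; the Julia set contains distinct
    points [z] and [- z]. *)
Lemma julia_not_totally_disconnected (rho : R) w : 4 <= rho -> pbound rho w ->
  connected (julia w) -> ~ totally_disconnected (julia w).
Proof.
move=> rho4 bw cJ tJ; have [x Kx x0] := filled_neq0 rho4 bw.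
have [z Jz xz] := julia_extreme rho4 bw Kx.
have JNz := juliaN rho4 bw Jz.
have z0 : z != 0.
  by apply/eqP => z0; have := cmod_gt0 x0; move: xz; rewrite z0 cmod0; lra.
have : connected_component (julia w) z (- z).
  by rewrite connected_component_id.
rewrite tJ// => /eqP; rewrite -subr_eq0 -opprD oppr_eq0 -mulr2n mulrn_eq0 /=.
by rewrite (negbTE z0).
Qed.

Lemma ae_contra c (r : R) (P : probability (Omega R) R) (Q : Omega R -> Prop) :
  0 < r -> is_product_measure c r P -> {ae P, forall w, Q w} ->
  exists2 w, Omega_cr c r w & Q w.
Proof.
move=> r0 HP aQ; apply: contrapT => nw.
have [A [mA A0 TA]] := negligibleU (negligible_not_Omega r0 HP) aQ.
have AT : A = setT.
  apply/seteqP; split=> // w _; apply: TA.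
  have [hw|] := pselect (Omega_cr c r w); last by left.
  by right=> /= Qw; apply: nw; exists w.
have := etrans (esym A0) (etrans (congr1 (fun X => P X) AT) (probability_setT P)).
by move=> /eqP; rewrite eqe eq_sym oner_eq0.
Qed.

End Dichotomy.

Theorem theorem4p6 (R : realType) (c : C R) (r : R)
  (P : probability (Omega R) R) :
  0 <= r ->
  is_product_measure c r P ->
  (exists ct : C R, interior (cdisk c r) ct /\ superattracting ct) ->
  let S1 := r <= rbif c in
  let S2 := forall w, Omega_cr c r w -> bounded_orbit0 w in
  let S3 := forall w, Omega_cr c r w -> connected (julia w) in
  let S4 := minimal_set (in_G c r) (orbit_closure c r) /\
            planar (orbit_closure c r) in
  let S1' := rbif c < r in
  let S2' := {ae P, forall w : Omega R, escapes0 w} in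
  let S3' := {ae P, forall w : Omega R, totally_disconnected (julia w)} in
  let S4' := ~ bounded_in_C (orbit_closure c r) in
  ((S1 <-> S2) /\ (S1 <-> S3) /\ (S1 <-> S4)) /\
  ((S1' <-> S2') /\ (S1' <-> S3') /\ (S1' <-> S4')) /\
  ((S1 /\ S2 /\ S3 /\ S4) \/ (S1' /\ S2' /\ S3' /\ S4')).
Proof.
move=> r0 HP [ct [/interior_cdisk ctr sct]] S1 S2 S3 S4 S1' S2' S3' S4'.
have r_gt0 : 0 < r by have := cmod_ge0 (ct - c); lra.
have r4 := escrad4 c r0.
have h12 : S1 -> S2 := rbif_bounded r0 ctr sct.
have h24 : S2 -> S4 := orbit_closure_minimal r0 ctr sct.
have h41 : S4 -> S1 by move=> [mO pO]; apply: planar_rbif => //; exists (orbit_closure c r).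
have h23 : S2 -> S3.
  (* Shifts of admissible sequences are admissible, so (2) bounds the critical orbit under every
     shift. *)
  move=> s2 w hw; apply: (julia_connected r4 (Omega_pbound hw)) => j.
  by apply/(bounded_orbit0P r0 (Omega_sshift j hw)); apply: s2; exact: Omega_sshift.
have h32 : S3 -> S2.
  move=> s3 w hw; apply/(bounded_orbit0P r0 hw); apply: contrapT => nK0.
  exact: (julia_disconnected r4 (Omega_pbound hw) nK0 (s3 w hw)).
have n2esc : ~ S2 -> S2'.
  by move=> n2; exact: (ae_escape r_gt0 HP (escape_everywhere r0 ctr sct n2)).
have n2dis : ~ S2 -> S3'.
  move=> n2; have := ae_good_times r_gt0 HP (escape_everywhere r0 ctr sct n2) => good.
  have := negligibleU (negligible_not_Omega r_gt0 HP) good.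
  apply: negligibleS => w ntd; have [hw|] := pselect (Omega_cr c r w); last by left.
  right=> /= -[s ms]; apply: ntd.
  exact: (good_totally_disconnected r4 (Omega_pbound hw) ms).
have esc2 : S2' -> ~ S2.
  move=> /(ae_contra r_gt0 HP)[w hw esc] /(_ w hw)[M wM]; have [N NM] := esc M.
  by have := NM N.+1 (leqnSn N); rewrite ltNge wM.
have dis2 : S3' -> ~ S2.
  move=> /(ae_contra r_gt0 HP)[w hw td] s2.
  exact: (julia_not_totally_disconnected r4 (Omega_pbound hw) (h23 s2 w hw)).
have b2 : S4' <-> ~ S2 by rewrite /S4'; split=> h h'; apply: h; apply/orbit_closure_boundedP.
have n12 : S1' <-> ~ S2.
  split=> [|n2]; first by rewrite /S1' ltNge => /negP n1 s2; apply/n1/h41/h24.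
  by rewrite /S1' ltNge; apply/negP => s1; apply/n2/h12.
split; last split.
- split; first by split=> // /h24/h41.
  by split; split; [move=> /h12/h23|move=> /h32/h24/h41|move=> /h12/h24|exact: h41].
- split; first by split=> [/n12/n2esc|/esc2/n12].
  by split; split; [move=> /n12/n2dis|move=> /dis2/n12|move=> /n12/b2|move=> /b2/n12].
have [s2|n2] := pselect S2.
  by left; split; [exact/h41/h24|split=> //; split; [exact: h23|exact: h24]].
right; split; first exact/n12.
by split; [exact: n2esc|split; [exact: n2dis|exact/b2]].
Qed.
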